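(* Consider the conditionally Gaussian model of the context (with $\psi$ bounded). Let $K,N\ge1$, fix observations $Y_K=(y_1,\dots,y_K)$, and let $\nu_k^N$ be the empirical measures of the Gaussianized optimal particle filter with $N$ particles. Then, with $\kappa=\kappa(Y_K)$ given by $$\kappa^{-1}=\exp\Bigl(\max_{0\le j\le K-1}|y_{j+1}|_S^2+\sup_{v\in\mathcal{X}}|H\psi(v)|_S^2\Bigr),$$ we have $$d(\nu_K^N,\mu_K)\ \le\ \sum_{k=0}^K(2\kappa^{-2})^kN^{-1/2},$$ where $\mu_K$ is the filtering distribution.
   Context: $\mathcal{X}$, $\mathcal{Y}$ are finite-dimensional Euclidean spaces and $\mathcal{M}(\mathcal{X})$ is the set of probability measures on $\mathcal{X}$. For symmetric positive definite $A$, $|\cdot|_A=|A^{-1/2}\cdot|$. Model. $\psi:\mathcal{X}\to\mathcal{X}$ is bounded (and measurable), $H:\mathcal{X}\to\mathcal{Y}$ is linear, and $$u_{k+1}=\psi(u_k)+\xi_k,\qquad y_{k+1}=Hu_{k+1}+\eta_{k+1},$$ with $u_0\sim\mu_0\in\mathcal{M}(\mathcal{X})$, $\xi_k\sim N(0,\Sigma)$ i.i.d., $\eta_k\sim N(0,\Gamma)$ i.i.d., and $u_0,\{\xi_k\},\{\eta_k\}$ independent; $\Sigma=\sigma^2\Sigma_0$, $\Gamma=\gamma^2\Gamma_0$ with $\Sigma_0,\Gamma_0$ strictly positive definite and $\sigma,\gamma\in(0,\infty)$. Set $C^{-1}=\Sigma^{-1}+H^*\Gamma^{-1}H$, $S=H\Sigma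 H^*+\Gamma$, $K_{\rm gain}=\Sigma H^*S^{-1}$ (the Kalman gain). The filtering distribution $\mu_k$ is the conditional law of $u_k$ given $Y_k=(y_1,\dots,y_k)$. Gaussianized optimal particle filter (GOPF). Initialize $v_0^{(n)}\sim\mu_0$ i.i.d., $n=1,\dots,N$, and for $k\ge0$: set $$w_{k+1}^{(n),*}=\exp\bigl(-\tfrac12|y_{k+1}-H\psi(v_k^{(n)})|_S^2\bigr),\qquad w_{k+1}^{(n)}=\frac{w_{k+1}^{(n),*}}{\sum_{m=1}^Nw_{k+1}^{(m),*}};$$ draw $\widetilde v_k^{(n)}$, $n=1,\dots,N$, independently from $\{v_k^{(m)}\}_{m=1}^N$ with weights $\{w_{k+1}^{(m)}\}_{m=1}^N$; set $v_{k+1}^{(n)}=(I-K_{\rm gain}H)\psi(\widetilde v_k^{(n)})+K_{\rm gain}y_{k+1}+\zeta_k^{(n)}$ with $\zeta_k^{(n)}\sim N(0,C)$ i.i.d. Define $\nu_k^N=\frac1N\sum_{n=1}^N\delta_{v_k^{(n)}}$. Metric. For random elements $\mu,\nu$ of $\mathcal{M}(\mathcal{X})$, $d(\mu,\nu)=\sup_{|f|_\infty\le1}\sqrt{\mathbb{E}^\omega|\mu(f)-\nu(f)|^2}$, where the supremum is over measurable $f:\mathcal{X}\to\mathbb{R}$ bounded by $1$ and $\mathbb{E}^\omega$ is expectation over the randomness of the algorithm (the observations being fixed). *)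

(* Defs.v *)
From HB Require Import structures.
From mathcomp Require Import all_boot all_order all_algebra.
From mathcomp Require Import all_classical all_reals all_analysis.

Set Implicit Arguments.
Unset Strict Implicit.
Unset Printing Implicit Defensive.
Import Order.TTheory GRing.Theory Num.Theory.
Import numFieldNormedType.Exports.

Local Open Scope classical_set_scope.
Local Open Scope ring_scope.

(* Matrices carry the sigma-algebra generated by their entries; over the reals
   this is the Borel sigma-algebra. *)
Definition measure_matrix_display : measure_display -> measure_display.
Proof. exact. Qed.

Section measurable_matrix.
Context {d} {T : measurableType d}.
Variables m n : nat.

Definition mx_measurable : set (set 'M[T]_(m, n)) :=
  <<s [set E | exists i j, exists2 B : set T, measurable B &
         E = (fun M : 'M[T]_(m, n) => M i j) @^-1` B] >>.

Let mx_set0 : mx_measurable set0.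
Proof. exact: sigma_algebra0. Qed.

Let mx_setC A : mx_measurable A -> mx_measurable (~` A).
Proof. exact: sigma_algebraC. Qed.

Let mx_bigcup (F : _^nat) : (forall i, mx_measurable (F i)) ->
  mx_measurable (\bigcup_i (F i)).
Proof. exact: sigma_algebra_bigcup. Qed.

HB.instance Definition _ := @isMeasurable.Build (measure_matrix_display d)
  'M[T]_(m, n) mx_measurable mx_set0 mx_setC mx_bigcup.

Lemma measurable_mx_coord i j :
  measurable_fun [set: 'M[T]_(m, n)] (fun M => M i j).
Proof.
by move=> _ B mB; rewrite setTI; apply: sub_sigma_algebra; exists i, j, B.
Qed.

Lemma measurable_mxP d' (S : measurableType d') (f : S -> 'M[T]_(m, n)) :
  (forall i j, measurable_fun setT (fun x => f x i j)) -> measurable_fun setT f.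
Proof.
move=> mf _ A mA; rewrite setTI.
suff : mx_measurable `<=` [set A | measurable (f @^-1` A)] by apply.
apply: smallest_sub.
- split => /=.
  + by rewrite preimage_set0.
  + by move=> B; rewrite setTD preimage_setC; exact: measurableC.
  + by move=> F mF; rewrite preimage_bigcup; exact: bigcup_measurable.
- move=> _ [i [j [B mB ->]]] /=.
  have := mf i j measurableT B mB; rewrite setTI; exact.
Qed.

End measurable_matrix.

(* Lebesgue measure on R^n, the n-fold product of the one on R, transported
   to column vectors by stacking coordinates. *)
Section lebesgue_cV.
Variable R : realType.

Section step.
Variables (n : nat) (mu : {sigma_finite_measure set 'cV[R]_n -> \bar R}).

Let stack (z : measurableTypeR R * 'cV[R]_n) : 'cV[R]_n.+1 :=
  col_mx (z.1%:M : 'M[R]_1) z.2.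

Let unstack (x : 'cV[R]_n.+1) : measurableTypeR R * 'cV[R]_n :=
  (x ord0 ord0, dsubmx (x : 'cV[R]_(1 + n))).

Let stackK : cancel stack unstack.
Proof.
move=> [a v]; rewrite /unstack /stack /= col_mxKd; congr pair.
have -> : ord0 = lshift n (ord0 : 'I_1) :> 'I_n.+1 by exact/val_inj.
by apply: etrans (col_mxEu _ _ _ _) _; rewrite mxE.
Qed.

Let measurable_stack : measurable_fun setT stack.
Proof.
apply: measurable_mxP => i j; rewrite /stack.
case: (@split_ordP 1 n i) => k ->.
- rewrite [X in measurable_fun _ X](_ : _ = fst); first exact: measurable_fst.
  by apply/funext => z; apply: etrans (col_mxEu _ _ _ _) _; rewrite !ord1 mxE.
- rewrite [X in measurable_fun _ X](_ : _ = (fun v : 'cV[R]_n => v k j) \o snd).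
    by apply: measurableT_comp; [exact: measurable_mx_coord|exact: measurable_snd].
  by apply/funext => z; exact: col_mxEd.
Qed.

Let measurable_unstack : measurable_fun setT unstack.
Proof.
apply: measurable_fun_pair; first exact: measurable_mx_coord.
apply: measurable_mxP => i j.
rewrite [X in measurable_fun _ X](_ : _ = (fun v : 'cV[R]_n.+1 => v (rshift 1 i) j)).
  exact: measurable_mx_coord.
by apply/funext => z; rewrite mxE.
Qed.

Definition lebesgue_step : set 'cV[R]_n.+1 -> \bar R :=
  pushforward (@lebesgue_measure R \x mu)%E stack.

Let lebesgue_step0 : lebesgue_step set0 = 0%E.
Proof. by rewrite /lebesgue_step /pushforward preimage_set0 measure0. Qed.

Let lebesgue_step_ge0 A : (0 <= lebesgue_step A)%E.
Proof. exact: measure_ge0. Qed.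

Let lebesgue_step_sigma_additive : semi_sigma_additive lebesgue_step.
Proof.
have mpre A : measurable A -> measurable (stack @^-1` A).
  by move=> mA; rewrite -[X in measurable X]setTI; exact: measurable_stack.
move=> F mF tF mUF; rewrite /lebesgue_step /pushforward preimage_bigcup.
apply: measure_semi_sigma_additive.
- by move=> k; exact: mpre.
- apply/trivIsetP => /= i j _ _ ij; rewrite -preimage_setI.
  by move/trivIsetP : tF => /(_ _ _ _ _ ij) ->//; rewrite preimage_set0.
- by rewrite -preimage_bigcup; exact: mpre.
Qed.

HB.instance Definition _ := @isMeasure.Build _ _ _ lebesgue_step
  lebesgue_step0 lebesgue_step_ge0 lebesgue_step_sigma_additive.

Let lebesgue_step_sigma_finite : sigma_finite setT lebesgue_step.
Proof.
have /sigma_finiteP[F [TF ndF Foo]] := sigma_finiteT (@lebesgue_measure R).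
have /sigma_finiteP[G [TG ndG Goo]] := sigma_finiteT mu.
have mFG k : measurable (F k `*` G k) /\
    ((@lebesgue_measure R \x mu)%E (F k `*` G k) < +oo)%E.
  have [? ?] := Foo k; have [? ?] := Goo k.
  split; first exact: measurableX.
  by rewrite product_measure1E// lte_mul_pinfty// ge0_fin_numE.
exists (fun k => unstack @^-1` (F k `*` G k)).
  rewrite -preimage_bigcup (_ : \bigcup_k _ = setT) ?preimage_setT//.
  apply/seteqP; split=> // -[x y] _.
  have [i _ Fx] : (\bigcup_k F k) x by rewrite -TF.
  have [j _ Gy] : (\bigcup_k G k) y by rewrite -TG.
  exists (maxn i j) => //; split.
  - by move: x Fx; exact/subsetPset/ndF/leq_maxl.
  - by move: y Gy; exact/subsetPset/ndG/leq_maxr.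
move=> k; have [mF Fk] := mFG k; split.
  by rewrite -[X in measurable X]setTI; exact: measurable_unstack.
rewrite /lebesgue_step /pushforward -comp_preimage.
by rewrite (_ : unstack \o stack = id) //; apply/funext => z; exact: stackK.
Qed.

HB.instance Definition _ := @Measure_isSigmaFinite.Build _ _ _
  lebesgue_step lebesgue_step_sigma_finite.

End step.

Fixpoint lebesgue_cV n : {sigma_finite_measure set 'cV[R]_n -> \bar R} :=
  match n with
  | 0 => \d_(0 : 'cV[R]_0)
  | k.+1 => lebesgue_step (lebesgue_cV k)
  end.

End lebesgue_cV.

Section gaussian.
Variables (R : realType) (n : nat).
Implicit Types (A B : 'M[R]_n) (x : 'cV[R]_n).

Definition spd A : Prop :=
  A^T = A /\ forall x, x != 0 -> 0 < (x^T *m A *m x) ord0 ord0.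

(* |x|_A^2 = |A^{-1/2} x|^2; see [mnorm2_inv_sqrt] *)
Definition mnorm2 A x : R := (x^T *m invmx A *m x) ord0 ord0.

Lemma mnorm2_inv_sqrt A B x : B^T = B -> B *m B = invmx A ->
  mnorm2 A x = \sum_i (B *m x) i ord0 ^+ 2.
Proof.
move=> Bsym BB; rewrite /mnorm2 -BB mulmxA -mulmxA -{1}Bsym -trmx_mul mxE.
by apply: eq_bigr => i _; rewrite mxE expr2.
Qed.

Definition gaussian_pdf A x : R :=
  (Num.sqrt ((2 * pi) ^+ n * \det A))^-1 * expR (- (mnorm2 A x / 2)).

(* the centred normal law N(0, A) *)
Definition gaussian A (B : set 'cV[R]_n) : \bar R :=
  (\int[lebesgue_cV R n]_(x in B) (gaussian_pdf A x)%:E)%E.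

End gaussian.

Section random_measures.
Context {d d'} {W : measurableType d} {T : measurableType d'} {R : realType}.
Variable P : probability W R.

Definition has_law (X : {RV P >-> T}) (L : set T -> \bar R) : Prop :=
  forall A, measurable A -> P (X @^-1` A) = L A.

Definition empirical (N : nat) (v : nat -> T) : {measure set T -> \bar R} :=
  mscale (N%:R^-1)%:nng (msum (fun n => \d_(v n)) N).

(* The distance between two random measures, as an extended real. *)
Definition rdist (nu mu : W -> {measure set T -> \bar R}) : \bar R :=
  ereal_sup [set sqrte 'E_P[fun w =>
      ((\int[nu w]_x f x - \int[mu w]_x f x) ^+ 2)%R]%E
    | f in [set f : T -> R | measurable_fun setT f /\
                             forall x, (`|f x| <= 1)%R]].

End random_measures.

(* A regular conditional law of X given Y. *)
Definition is_cond_law {d d1 d2} {W : measurableType d} {S : measurableType d1}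
    {T : measurableType d2} {R : realType} (P : probability W R)
    (X : W -> T) (Y : W -> S) (mu : R.-pker S ~> T) : Prop :=
  forall A B, measurable A -> measurable B ->
    P (X @^-1` A `&` Y @^-1` B) = (\int[P]_(w in Y @^-1` B) mu (Y w) A)%E.

(* A conditional law is determined by [is_cond_law] only up to null sets of
   values of Y. For the filtering distribution the law of the observations
   charges every nonempty open set, so that at most one version is continuous
   in the observations (Bayes' formula provides it); this pins the conditional
   law at each fixed value. *)
Definition continuous_version {d2} {R : realType} {p K : nat}
    {T : measurableType d2} (mu : R.-pker 'M[R]_(p, K) ~> T) : Prop :=
  forall A, measurable A -> continuous (fun Y => mu Y A).

Section filtering.
Variables (R : realType) (d p : nat).
Variables (psi : 'cV[R]_d -> 'cV[R]_d) (H : 'M[R]_(p, d)).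
Variables (Sigma : 'M[R]_d) (Gamma : 'M[R]_p).
Variable mu0 : probability 'cV[R]_d R.

Section model.
Context {dW} {W : measurableType dW}.
Variable P : probability W R.

(* Product rule for finitely many coordinates, that is, mutual independence of
   the whole family u_0, xi_0, xi_1, ..., eta_1, eta_2, ... *)
Definition indep_inputs (u0 : {RV P >-> 'cV[R]_d})
    (xi : nat -> {RV P >-> 'cV[R]_d}) (eta : nat -> {RV P >-> 'cV[R]_p}) :=
  forall (m : nat) (A : set 'cV[R]_d) (B : nat -> set 'cV[R]_d)
      (C : nat -> set 'cV[R]_p),
    measurable A -> (forall k, measurable (B k)) ->
    (forall k, measurable (C k)) ->
    P (u0 @^-1` A `&` \bigcap_(k < m) (xi k @^-1` B k)
                  `&` \bigcap_(k < m) (eta k.+1 @^-1` C k)) =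
    (P (u0 @^-1` A) * \prod_(k < m) P (xi k @^-1` B k)
                    * \prod_(k < m) P (eta k.+1 @^-1` C k))%E.

(* y 0 and eta 0 are unused *)
Record is_model (u xi : nat -> {RV P >-> 'cV[R]_d})
    (y eta : nat -> {RV P >-> 'cV[R]_p}) : Prop := {
  model_init : has_law (u 0%N) mu0;
  model_xi : forall k, has_law (xi k) (gaussian Sigma);
  model_eta : forall k, has_law (eta k.+1) (gaussian Gamma);
  model_indep : indep_inputs (u 0%N) xi eta;
  model_signal : forall k w, u k.+1 w = psi (u k w) + xi k w;
  model_obs : forall k w, y k.+1 w = H *m u k.+1 w + eta k.+1 w }.

(* Y_K = (y_1, ..., y_K), with y_(k+1) in column k *)
Definition obs_matrix (y : nat -> {RV P >-> 'cV[R]_p}) (K : nat) (w : W) :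
    'M[R]_(p, K) :=
  \matrix_(i, k) y k.+1 w i ord0.

End model.

Definition innov_cov : 'M[R]_p := H *m Sigma *m H^T + Gamma.

Definition kalman_gain : 'M[R]_(d, p) := Sigma *m H^T *m invmx innov_cov.

Definition post_cov : 'M[R]_d := invmx (invmx Sigma + H^T *m invmx Gamma *m H).

Section gopf.
Context {dW} {W : measurableType dW}.
Variable P : probability W R.
Variables (N K : nat) (Y : 'M[R]_(p, K)).

(* unnormalized and normalized weights of the particle positions x 0, ...,
   x (N - 1) for the next observation z *)
Definition weight_star (z : 'cV[R]_p) (x : 'cV[R]_d) : R :=
  expR (- (mnorm2 innov_cov (z - H *m psi x) / 2)).

Definition weight (z : 'cV[R]_p) (x : nat -> 'cV[R]_d) (n : nat) : R :=
  weight_star z (x n) / \sum_(m < N) weight_star z (x m).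

(* The sigma-algebra generated by the initial particles, the first k rounds of
   resampling and the first l rounds of noise. *)
Definition history (v vt zeta : nat -> nat -> {RV P >-> 'cV[R]_d})
    (k l : nat) : set (set W) :=
  <<s [set E | exists n A, [/\ (n < N)%N, measurable A &
        [\/ E = v 0%N n @^-1` A,
            exists2 j, (j < k)%N & E = vt j n @^-1` A |
            exists2 j, (j < l)%N & E = zeta j n @^-1` A]]] >>.

(* A run on the observations Y: v k n, vt k n and zeta k n are the particle,
   the resampled particle and the noise of index n < N at time k. *)
Record is_gopf (v vt zeta : nat -> nat -> {RV P >-> 'cV[R]_d}) : Prop := {
  gopf_init : forall A : nat -> set 'cV[R]_d, (forall n, measurable (A n)) ->
    P (\bigcap_(n < N) (v 0%N n @^-1` A n)) = (\prod_(n < N) mu0 (A n))%E;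
  (* given the past, the vt k n are independent with law
     \sum_m w_(k+1)^(m) \d_(v_k^(m)) *)
  gopf_resample : forall (k : 'I_K) E (A : nat -> set 'cV[R]_d),
    history v vt zeta k k E -> (forall n, measurable (A n)) ->
    P (E `&` \bigcap_(n < N) (vt k n @^-1` A n)) =
    (\int[P]_(w in E)
       (\prod_(n < N) \sum_(m < N)
          weight (col k Y) (fun i => v k i w) m * \1_(A n) (v k m w))%:E)%E;
  gopf_noise : forall (k : 'I_K) E (A : nat -> set 'cV[R]_d),
    history v vt zeta k.+1 k E -> (forall n, measurable (A n)) ->
    P (E `&` \bigcap_(n < N) (zeta k n @^-1` A n)) =
    (P E * \prod_(n < N) gaussian post_cov (A n))%E;
  gopf_move : forall (k : 'I_K) n w, (n < N)%N ->
    v k.+1 n w = (1%:M - kalman_gain *m H) *m psi (vt k n w)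
                 + kalman_gain *m col k Y + zeta k n w }.

End gopf.

Definition kappa (K : nat) (Y : 'M[R]_(p, K)) : R :=
  (expR (\big[Num.max/0]_(k < K) mnorm2 innov_cov (col k Y)
         + sup (range (fun v => mnorm2 innov_cov (H *m psi v)))))^-1.

(* The error bound at the observations Y, for every run of the filter on any
   probability space. *)
Definition gopf_bound (N K : nat) (Y : 'M[R]_(p, K))
    (mu : {measure set 'cV[R]_d -> \bar R}) : Prop :=
  forall (dW : measure_display) (W : measurableType dW) (P : probability W R)
      (v vt zeta : nat -> nat -> {RV P >-> 'cV[R]_d}),
    is_gopf N Y v vt zeta ->
    (rdist P (fun w => empirical N (fun n => v K n w)) (fun=> mu) <=
     (\sum_(k < K.+1) (2 * kappa Y ^- 2) ^+ k / Num.sqrt N%:R)%:E)%E.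

End filtering.

(* Main.v *)
Require Import Defs.
From HB Require Import structures.
From mathcomp Require Import all_boot all_order all_algebra.
From mathcomp Require Import all_classical all_reals all_analysis.
From mathcomp Require Import measurable_realfun ring lra.
Set Implicit Arguments.
Unset Strict Implicit.
Unset Printing Implicit Defensive.
Import Order.TTheory GRing.Theory Num.Theory.
Import numFieldNormedType.Exports.
Local Open Scope classical_set_scope.
Local Open Scope ring_scope.

(** The proof identifies the filtering distribution with an explicit version
    given by Bayes' formula, and then compares the particle filter with that
    version, one time step after the other.

    Bayes' formula. For observations z_1, ..., z_k put

      Z_k h = E (h (u_k) * prod_(j <= k) exp (- |z_j - H u_j|_Gamma^2 / 2)),

    the expectation being over the signal alone, and pi_k h = Z_k h / Z_k 1.
    The signal is independent of the observation noise, and the density of the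
    translate of a Gaussian law is explicit ([gaussian_translate]), so the joint
    law of the state and of the observations has Z_K as its density relative to
    a positively weighted law of the noise ([kallianpur_striebel]). For each
    fixed event, a conditional law therefore agrees with pi_K for almost every
    value of the observations ([cond_law_bayes]). A countable pi-system of
    events, the rational lower orthants, makes the exceptional set independent
    of the event ([cond_law_bayes_ae]). If the conditional law is continuous in
    the observations, the agreement holds everywhere: the observations charge
    every box, so each point is a limit of points of agreement, and pi_K is
    continuous by dominated convergence ([cond_law_bayes_continuous]).

    Recursion. Completing the square ([complete_square], [gaussian_update]) gives
    Z_(k+1) h = c * Z_k (g_k * T_k h) with c > 0 ([unnorm_filterS]), where
    g_k v = exp (- |z_(k+1) - H psi v|_S^2 / 2) is the weight of the algorithm
    and T_k is the Gaussian proposal kernel that moves the particles. Hence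
    pi_(k+1) h = pi_k (g_k * T_k h) / pi_k g_k.

    Error. A function f bounded by 1 is 2 h - 1 with h valued in the unit
    interval, so it suffices to bound the root mean square error of the particle
    means of every such h at time k by e_k / 2, where e_k is the sum over
    j <= k of (2 kappa^-2)^j / sqrt N ([filter_error], by induction on k).
    Given the past, the new particles are independent with the law
    nu_k (g_k * T_k .) / nu_k g_k, nu_k being the empirical law at time k. So,
    the variance of h being at most 1/4, resampling and moving cost at most
    1 / (2 sqrt N) ([step_sampling_error]). Since the weights lie between kappa
    and 1 ([kappa_le_weight]) and, with A = g_k * T_k h and B = g_k,

      nu A / nu B - pi A / pi B
        = ((nu A - pi A) + (pi A / pi B) * (pi B - nu B)) / nu B,

    where pi A <= pi B, the error inherited from time k is at most
    (2 / kappa) * (e_k / 2) <= 2 kappa^-2 * (e_k / 2). The two errors add up to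
    e_(k+1) / 2 by Minkowski's inequality ([Ex_sqrD_le]). *)

(** * Densities and integral functionals *)

Section integral_functionals.
Local Open Scope ereal_scope.
Context {d : measure_display} {T : measurableType d} {R : realType}.

Import HBNNSimple.

(** Induction on nonnegative measurable functions: indicators, cone operations
    and monotone limits. *)
Lemma ge0_measurable_ind (Pr : (T -> \bar R) -> Prop) :
  (forall A, measurable A -> Pr (fun x => (\1_A x)%:E)) ->
  (forall (k : R) (f : T -> R), (0 <= k)%R -> (forall x, 0 <= f x)%R ->
     measurable_fun setT f -> Pr (EFin \o f) -> Pr (fun x => (k * f x)%:E)) ->
  (forall f g : T -> R, (forall x, 0 <= f x)%R -> (forall x, 0 <= g x)%R ->
     measurable_fun setT f -> measurable_fun setT g ->
     Pr (EFin \o f) -> Pr (EFin \o g) -> Pr (fun x => (f x + g x)%:E)) ->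
  (forall (f : nat -> T -> R) (h : T -> \bar R),
     (forall n x, 0 <= f n x)%R -> (forall n, measurable_fun setT (f n)) ->
     (forall x, nondecreasing_seq (f ^~ x)) ->
     (forall x, (f n x)%:E @[n --> \oo] --> h x) ->
     (forall n, Pr (EFin \o f n)) -> Pr h) ->
  forall h : T -> \bar R, measurable_fun setT h -> (forall x, 0 <= h x) -> Pr h.
Proof.
move=> P1 PZ PD Plim h mh h0.
pose g := nnsfun_approx measurableT mh.
apply: (Plim (fun n => g n)) => //.
- by move=> x m n mn; exact/lefP/nd_nnsfun_approx.
- by move=> x; apply: cvg_nnsfun_approx.
move=> n; set s := g n.
(* A simple function is the sum over its range of multiples of indicators. *)
have -> : EFin \o s = fun x => (\sum_(y <- finmap.enum_fset (fset_set (range s))) (y * \1_(s @^-1` [set y]) x))%:E.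
  by apply/funext => x /=; rewrite {1}fimfunE fsbig_finite.
have ge0 y : y \in finmap.enum_fset (fset_set (range s)) -> (0 <= y)%R.
  by rewrite in_fset_set// inE => -[x _ <-]; exact: fun_ge0.
move: ge0; elim: (finmap.enum_fset (fset_set (range s))) => [|a l IH] ge0.
  rewrite [X in Pr X](_ : _ = fun x => (\1_(set0 : set T) x)%:E); first exact: P1.
  by apply/funext => x; rewrite big_nil indic0.
rewrite [X in Pr X](_ : _ = fun x => (a * \1_(s @^-1` [set a]) x +
   \sum_(y <- l) (y * \1_(s @^-1` [set y]) x))%:E); last first.
  by apply/funext => x; rewrite big_cons.
have a0 : (0 <= a)%R by apply: ge0; rewrite in_cons eqxx.
have l0 y : y \in l -> (0 <= y)%R by move=> yl; apply: ge0; rewrite in_cons yl orbT.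
have m1 y : measurable_fun setT (\1_(s @^-1` [set y]) : T -> R).
  exact: measurable_indic.
apply: PD.
- by move=> x; rewrite mulr_ge0.
- by move=> x; rewrite big_seq; apply: sumr_ge0 => y yl; rewrite mulr_ge0// l0.
- exact: measurable_funM.
- by apply: measurable_sum => y; exact: measurable_funM.
- by apply: PZ => //; exact: P1.
- exact: IH.
Qed.

(** A functional on nonnegative functions that is integration against some
    measure. Equality of two such functionals may be tested on indicators. *)
Definition is_integral (I : (T -> \bar R) -> \bar R) :=
  exists m : {measure set T -> \bar R},
    forall h : T -> \bar R, measurable_fun setT h -> (forall x, 0 <= h x) ->
      I h = \int[m]_x h x.

Lemma is_integral_ext (I J : (T -> \bar R) -> \bar R) :
  is_integral I -> is_integral J ->
  (forall A, measurable A -> I (fun x => (\1_A x)%:E) = J (fun x => (\1_A x)%:E)) ->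
  forall h : T -> \bar R, measurable_fun setT h -> (forall x, 0 <= h x) -> I h = J h.
Proof.
move=> [m Im] [m' Jm'] IJ h mh h0.
rewrite Im// Jm'//; apply: eq_measure_integral => A mA _.
have m1 : measurable_fun setT (fun x => (\1_A x : R)%:E).
  by apply/measurable_EFinP; exact: measurable_indic.
have := IJ A mA; rewrite Im ?Jm'// ?integral_indic ?setIT//.
Qed.

Lemma is_integral_measure (m : {measure set T -> \bar R}) :
  is_integral (fun h => \int[m]_x h x).
Proof. by exists m. Qed.

Lemma is_integral_sum (I : nat -> (T -> \bar R) -> \bar R) n :
  (forall i, is_integral (I i)) -> is_integral (fun h => \sum_(i < n) I i h).
Proof.
move=> /choice[m mI]; exists (msum m n) => h mh h0.
by rewrite ge0_integral_measure_sum//; apply: eq_bigr => i _; rewrite mI.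
Qed.

Lemma is_integralZ (I : (T -> \bar R) -> \bar R) (k : R) :
  (0 <= k)%R -> is_integral I -> is_integral (fun h => k%:E * I h).
Proof.
move=> k0 [m mI]; exists (mscale (NngNum k0) m) => h mh h0.
by rewrite ge0_integral_mscale// mI.
Qed.

(** Integration of h times a density is integration against a measure. *)
Lemma is_integral_density (mu : {measure set T -> \bar R}) (f : T -> R) :
  measurable_fun setT f -> (forall x, 0 <= f x)%R ->
  is_integral (fun h => \int[mu]_x ((f x)%:E * h x)).
Proof.
move=> mf f0.
have f0' x : 0 <= (f x)%:E by rewrite lee_fin.
have mf' : measurable_fun setT (EFin \o f) by exact/measurable_EFinP.
pose nu A := \int[mu]_(x in A) (f x)%:E.
have nu0 : nu set0 = 0 by rewrite /nu integral_set0.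
have nu_ge0 A : 0 <= nu A by rewrite /nu integral_ge0.
have nu_sigma : semi_sigma_additive nu.
  move=> F mF tF mUF; rewrite /nu ge0_integral_bigcup//=; last first.
    exact: measurable_funTS.
  by apply: is_cvg_ereal_nneg_natsum_cond => n _ _; exact: integral_ge0.
pose M := isMeasure.Build _ _ _ nu nu0 nu_ge0 nu_sigma.
pose m : {measure set T -> \bar R} := HB.pack nu M.
exists m; apply: ge0_measurable_ind.
- move=> A mA; transitivity (nu A); last by rewrite integral_indic// setIT.
  rewrite /nu [RHS]integral_mkcond.
  apply: eq_integral => x _; rewrite patchE indicE.
  by case: ifPn => _; rewrite ?mule1 ?mule0.
- move=> k g k0 g0 mg IH.
  under eq_integral do rewrite EFinM muleCA.
  rewrite ge0_integralZl ?lee_fin//; last 2 first.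
    by apply: emeasurable_funM; exact/measurable_EFinP.
    by move=> x _; rewrite mule_ge0 ?lee_fin.
  under [RHS]eq_integral do rewrite EFinM.
  rewrite [RHS]ge0_integralZl//; first by rewrite -IH.
    exact/measurable_EFinP.
  by move=> x _; rewrite lee_fin.
- move=> g h g0 h0 mg mh IHg IHh.
  under eq_integral do rewrite EFinD ge0_muleDr ?lee_fin//.
  rewrite ge0_integralD//; first last.
  + by apply: emeasurable_funM; exact/measurable_EFinP.
  + by move=> x _; rewrite mule_ge0 ?lee_fin.
  + by apply: emeasurable_funM; exact/measurable_EFinP.
  + by move=> x _; rewrite mule_ge0 ?lee_fin.
  under [RHS]eq_integral do rewrite EFinD.
  rewrite [RHS]ge0_integralD//; first by congr (_ + _); [exact: IHg|exact: IHh].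
  + by move=> x _; rewrite lee_fin.
  + exact/measurable_EFinP.
  + by move=> x _; rewrite lee_fin.
  + exact/measurable_EFinP.
- move=> g h g0 mg ndg gh IH.
  have -> : (fun x => (f x)%:E * h x) = (fun x => limn (fun n => (f x)%:E * (g n x)%:E)).
    apply/funext => x; apply/esym/cvg_lim => //.
    exact: cvgeZl.
  have -> : h = (fun x => limn (fun n => (g n x)%:E)).
    by apply/funext => x; apply/esym/cvg_lim.
  rewrite (@monotone_convergence _ _ _ mu setT measurableT (fun n x => (f x)%:E * (g n x)%:E)).
  + rewrite (@monotone_convergence _ _ _ m setT measurableT (fun n x => (g n x)%:E)).
    * by congr (limn _); apply/funext => n; exact: IH.
    * by move=> n; apply/measurable_EFinP.
    * by move=> n x _; rewrite lee_fin.
    * by move=> x _ a b ab; rewrite lee_fin; exact: ndg.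
  + by move=> n; apply: emeasurable_funM; exact/measurable_EFinP.
  + by move=> n x _; rewrite mule_ge0 ?lee_fin.
  + by move=> x _ a b ab; rewrite lee_wpmul2l// lee_fin; exact: ndg.
Qed.

End integral_functionals.

Lemma is_integral_pushforward {d d' : measure_display} {W : measurableType d}
    {T : measurableType d'} {R : realType} (X : W -> T)
    (I : (W -> \bar R) -> \bar R) :
  measurable_fun setT X -> is_integral I -> is_integral (fun h => I (h \o X)).
Proof.
move=> mX [m mI].
exists (pushforward m X) => h mh h0.
rewrite mI; [|exact: measurableT_comp|by move=> w; exact: h0].
by apply/esym; rewrite (ge0_integral_pushforward mX).
Unshelve. exact: mX.
Qed.

Lemma is_integral_weighted {d d' : measure_display} {W : measurableType d}
    {T : measurableType d'} {R : realType} (P : {measure set W -> \bar R})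
    (X : W -> T) (f : W -> R) :
  measurable_fun setT X -> measurable_fun setT f -> (forall w, 0 <= f w) ->
  is_integral (fun h => \int[P]_w ((f w)%:E * h (X w)))%E.
Proof.
move=> mX mf f0.
have [m mI] := is_integral_pushforward mX (is_integral_density P mf f0).
by exists m.
Qed.

(** The reciprocal is not continuous at 0, so it is written with exp and ln. *)
Lemma measurable_fun_gt0V {d : measure_display} {T : measurableType d}
    {R : realType} (f : T -> R) :
  measurable_fun setT f -> (forall x, 0 < f x) ->
  measurable_fun setT (fun x => (f x)^-1).
Proof.
move=> mf f0; rewrite (_ : (fun x => _) = fun x => expR (- ln (f x))).
  by do 3!apply: measurableT_comp => //.
by apply/funext => x; rewrite expRN lnK// posrE.
Qed.

(** * Independence and Tonelli *)

Section independence.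
Local Open Scope ereal_scope.
Context {d d1 d2 : measure_display} {W : measurableType d}
  {T1 : measurableType d1} {T2 : measurableType d2} {R : realType}.

(** A finite measure on a product is determined by its values on rectangles. *)
Lemma eq_measure_rectangles (m m' : {measure set (T1 * T2) -> \bar R}) :
  m setT < +oo ->
  (forall A B, measurable A -> measurable B -> m (A `*` B) = m' (A `*` B)) ->
  forall C, measurable C -> m C = m' C.
Proof.
move=> moo mE C mC.
apply: (measure_unique [set A `*` B | A in measurable & B in measurable]
          (fun=> setT)) => //.
- by rewrite measurable_prod_measurableType.
- move=> _ _ [A mA [B mB <-]] [A' mA' [B' mB' <-]].
  exists (A `&` A'); first exact: measurableI.
  by exists (B `&` B'); [exact: measurableI|rewrite setXI].
- by move=> _; exists setT => //; exists setT => //; rewrite setXTT.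
- by rewrite bigcup_const//; exists 0%N.
- by move=> _ [A mA [B mB <-]]; exact: mE.
Qed.

Variable P : probability W R.

(** If Z has law m and is independent of X, then an integral in (X, Z) can be
    computed by integrating Z out first. *)
Lemma integral_indep (X : W -> T1) (Z : W -> T2) (m : probability T2 R) :
  measurable_fun setT X -> measurable_fun setT Z ->
  (forall A B, measurable A -> measurable B ->
     P (X @^-1` A `&` Z @^-1` B) = P (X @^-1` A) * m B) ->
  forall F : T1 * T2 -> \bar R, measurable_fun setT F -> (forall z, 0 <= F z) ->
    \int[P]_w F (X w, Z w) = \int[P]_w \int[m]_z F (X w, z).
Proof.
move=> mX mZ XZ F mF F0.
have mXZ : measurable_fun setT (fun w => (X w, Z w)) by exact: measurable_fun_pair.
pose XZm : {mfun W >-> (T1 * T2)%type} := mfun_Sub (mem_set mXZ).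
pose Xm : {mfun W >-> T1} := mfun_Sub (mem_set mX).
have mF' : measurable_fun setT (fun x => \int[m]_z F (x, z)).
  exact: measurable_fun_fubini_tonelli_F.
transitivity (\int[distribution P XZm]_z F z).
  by rewrite ge0_integral_distribution.
transitivity (\int[distribution P Xm]_x \int[m]_z F (x, z)); last first.
  by rewrite ge0_integral_distribution// => x; exact: integral_ge0.
rewrite -fubini_tonelli1//.
apply: eq_measure_integral => C mC _; apply/esym.
exact: product_measure_unique.
Qed.

End independence.

(** * Quadratic forms and the Kalman identity *)

Section quadratic.
Context {R : realType}.

Lemma spd_unitmx n (A : 'M[R]_n) : spd A -> A \in unitmx.
Proof.
move=> [Asym Apos]; rewrite -row_free_unit -kermx_eq0.
apply/rowV0P => v /sub_kermxP vA; apply/eqP; apply: contraT => v0.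
have v'0 : v^T != 0.
  by apply: contra_neq v0 => /(congr1 trmx); rewrite trmxK linear0.
by have := Apos _ v'0; rewrite trmxK vA mul0mx mxE ltxx.
Qed.

Lemma spdZ n (A : 'M[R]_n) (s : R) : 0 < s -> spd A -> spd (s ^+ 2 *: A).
Proof.
move=> s0 [Asym Apos]; split; first by rewrite linearZ /= Asym.
move=> x x0; rewrite -scalemxAr -scalemxAl mxE mulr_gt0 ?exprn_gt0//.
exact: Apos.
Qed.

Lemma spd_ge0 n (A : 'M[R]_n) (x : 'cV[R]_n) : spd A ->
  0 <= (x^T *m A *m x) ord0 ord0.
Proof.
move=> [_ Apos]; have [->|x0] := eqVneq x 0; last exact/ltW/Apos.
by rewrite mulmx0 mxE.
Qed.

Lemma mnorm2_ge0 n (A : 'M[R]_n) (x : 'cV[R]_n) : spd A -> 0 <= mnorm2 A x.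
Proof.
move=> As; have Au := spd_unitmx As.
have := spd_ge0 (invmx A *m x) As.
rewrite trmx_mul trmx_inv (proj1 As) /mnorm2 -!mulmxA.
by rewrite (mulmxA (invmx A)) (mulVmx Au) mul1mx.
Qed.

Lemma invmx_sym n (A : 'M[R]_n) : spd A -> (invmx A)^T = invmx A.
Proof. by move=> [As _]; rewrite trmx_inv As. Qed.

Lemma mnorm2B_le n (A : 'M[R]_n) (x z : 'cV[R]_n) : spd A ->
  mnorm2 A (x - z) <= 2 * mnorm2 A x + 2 * mnorm2 A z.
Proof.
move=> As; have := mnorm2_ge0 (x + z) As; rewrite -subr_ge0 => h.
rewrite -subr_ge0; apply: le_trans h _; rewrite subr0 le_eqVlt; apply/orP; left.
rewrite /mnorm2 !(linearD, linearN) /= !(mulmxDl, mulNmx, mulmxDr, mulmxN).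
by rewrite !mxE; apply/eqP; ring.
Qed.

Lemma innov_cov_spd d p (H : 'M[R]_(p, d)) (Sigma : 'M[R]_d) (Gamma : 'M[R]_p) :
  spd Sigma -> spd Gamma -> spd (innov_cov H Sigma Gamma).
Proof.
move=> Ss Gs; rewrite /innov_cov; split.
  by rewrite linearD /= !trmx_mul trmxK (proj1 Ss) (proj1 Gs) mulmxA.
move=> x x0; rewrite mulmxDr mulmxDl mxE ltr_wpDl//; last exact: (proj2 Gs).
have := spd_ge0 (H^T *m x) Ss; rewrite trmx_mul trmxK.
by rewrite !mulmxA.
Qed.

(** Completing the square: the product of the Gaussian densities of the signal
    and of the observation factors into the predictive density of the
    observation and the posterior density of the signal. *)
Lemma complete_square d p (H : 'M[R]_(p, d)) (Sigma : 'M[R]_d)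
    (Gamma : 'M[R]_p) (a x : 'cV[R]_d) (y : 'cV[R]_p) :
  spd Sigma -> spd Gamma ->
  let K := kalman_gain H Sigma Gamma in
  mnorm2 Sigma (x - a) + mnorm2 Gamma (y - H *m x) =
  mnorm2 (innov_cov H Sigma Gamma) (y - H *m a) +
  mnorm2 (post_cov H Sigma Gamma) (x - ((1%:M - K *m H) *m a + K *m y)).
Proof.
move=> Ss Gs K.
have Su := spd_unitmx (innov_cov_spd H Ss Gs).
have Sigu := spd_unitmx Ss; have Gamu := spd_unitmx Gs.
set r := y - H *m a; set z := x - a.
have -> : y - H *m x = r - H *m z.
  by rewrite /r /z mulmxBr opprB addrA subrK.
have -> : x - ((1%:M - K *m H) *m a + K *m y) = z - K *m r.
  rewrite /z /r mulmxBl mul1mx mulmxBr mulmxA opprD addrA opprB.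
  by rewrite opprB !addrA; congr (_ - _); rewrite addrAC.
move: r z => {y x} r z.
rewrite /mnorm2 /post_cov invmxK.
set S := innov_cov _ _ _ in K Su *.
set Q := invmx Sigma + H^T *m invmx Gamma *m H.
(* The identity amounts to Q K = H^T Gamma^-1 and Gamma^-1 = S^-1 + K^T Q K. *)
have QK : Q *m K = H^T *m invmx Gamma.
  rewrite /Q /K /kalman_gain mulmxDl !mulmxA (mulVmx Sigu) mul1mx.
  rewrite -mulmxDl -[RHS](mulmxK Su); congr (_ *m _).
  by rewrite /S /innov_cov mulmxDr -!mulmxA (mulVmx Gamu) mulmx1 addrC.
have SG : K^T *m (H^T *m invmx Gamma) + invmx S = invmx Gamma.
  have Ssym : S^T = S := proj1 (innov_cov_spd H Ss Gs).
  rewrite /K /kalman_gain !trmx_mul trmx_inv Ssym trmxK (proj1 Ss).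
  rewrite -{2}[invmx S]mulmx1 -(mulmxV Gamu) !mulmxA -mulmxDl.
  rewrite -!mulmxA -mulmxDr !mulmxA.
  by rewrite -/(innov_cov H Sigma Gamma) -/S (mulVmx Su) mul1mx.
have Qsym : Q^T = Q.
  by rewrite /Q linearD /= !trmx_mul trmxK !invmx_sym// mulmxA.
have KQ : K^T *m Q = invmx Gamma *m H.
  by rewrite -[LHS]trmxK trmx_mul trmxK Qsym QK trmx_mul trmxK invmx_sym.
clearbody K.
suff E : z^T *m invmx Sigma *m z + (r - H *m z)^T *m invmx Gamma *m (r - H *m z) =
         r^T *m invmx S *m r + (z - K *m r)^T *m Q *m (z - K *m r).
  by move/matrixP/(_ ord0 ord0): E; rewrite !mxE.
have trB m n (U V : 'M[R]_(m, n)) : (U - V)^T = U^T - V^T by rewrite linearB.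
rewrite !trB !trmx_mul !mulmxBl !mulmxBr.
have E1 : z^T *m Q *m z = z^T *m invmx Sigma *m z + z^T *m H^T *m invmx Gamma *m (H *m z).
  by rewrite /Q mulmxDr mulmxDl !mulmxA.
have E2 : z^T *m Q *m (K *m r) = z^T *m H^T *m invmx Gamma *m r.
  by rewrite -mulmxA (mulmxA Q) QK !mulmxA.
have E3 : r^T *m K^T *m Q *m z = r^T *m invmx Gamma *m (H *m z).
  by rewrite -(mulmxA r^T) KQ !mulmxA.
have E4 : r^T *m invmx Gamma *m r =
    r^T *m invmx S *m r + r^T *m K^T *m Q *m (K *m r).
  have -> : r^T *m K^T *m Q *m (K *m r) =
      r^T *m (K^T *m (H^T *m invmx Gamma)) *m r by rewrite -QK !mulmxA.
  by rewrite -mulmxDl -mulmxDr [invmx S + _]addrC SG.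
rewrite E1 E2 E3 E4 !opprB !addrA.
by apply/matrixP => i j; rewrite !mxE; ring.
Qed.

End quadratic.

(** * Lebesgue measure on column vectors *)

Section matrix_measurability.
Context {R : realType} {d : measure_display} {T : measurableType d}.

Lemma measurable_coord m n (f : T -> 'M[R]_(m, n)) i j :
  measurable_fun setT f -> measurable_fun setT (fun x => f x i j).
Proof. by move=> mf; exact: (measurableT_comp (measurable_mx_coord i j) mf). Qed.

Lemma measurable_mxD m n (f g : T -> 'M[R]_(m, n)) :
  measurable_fun setT f -> measurable_fun setT g ->
  measurable_fun setT (fun x => f x + g x).
Proof.
move=> mf mg; apply: measurable_mxP => i j.
under eq_fun do rewrite mxE.
by apply: measurable_funD; exact: measurable_coord.
Qed.

Lemma measurable_mxM m n p (A : T -> 'M[R]_(m, n)) (f : T -> 'M[R]_(n, p)) :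
  measurable_fun setT A -> measurable_fun setT f ->
  measurable_fun setT (fun x => A x *m f x).
Proof.
move=> mA mf; apply: measurable_mxP => i j.
under eq_fun do rewrite mxE.
by apply: measurable_sum => k; apply: measurable_funM; exact: measurable_coord.
Qed.

Lemma measurable_mxT m n (f : T -> 'M[R]_(m, n)) :
  measurable_fun setT f -> measurable_fun setT (fun x => (f x)^T).
Proof.
move=> mf; apply: measurable_mxP => i j.
by under eq_fun do rewrite mxE; exact: measurable_coord.
Qed.

Lemma measurable_mxN m n (f : T -> 'M[R]_(m, n)) :
  measurable_fun setT f -> measurable_fun setT (fun x => - f x).
Proof.
move=> mf; apply: measurable_mxP => i j; under eq_fun do rewrite mxE.
by apply: measurableT_comp => //; exact: measurable_coord.
Qed.

Lemma measurable_col m n (f : T -> 'M[R]_(m, n)) j :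
  measurable_fun setT f -> measurable_fun setT (fun x => col j (f x)).
Proof.
move=> mf; apply: measurable_mxP => i k.
by under eq_fun do rewrite mxE; exact: measurable_coord.
Qed.

Lemma measurable_mnorm2 n (A : 'M[R]_n) (f : T -> 'cV[R]_n) :
  measurable_fun setT f -> measurable_fun setT (fun x => mnorm2 A (f x)).
Proof.
move=> mf; apply: measurable_coord; apply: measurable_mxM => //.
by apply: measurable_mxM => //; exact: measurable_mxT.
Qed.

Lemma measurable_expR_mnorm2 n (A : 'M[R]_n) (f : T -> 'cV[R]_n) :
  measurable_fun setT f ->
  measurable_fun setT (fun x => expR (- (mnorm2 A (f x) / 2))).
Proof.
move=> mf; apply: measurableT_comp => //; apply: measurableT_comp => //.
by apply: measurable_funM => //; exact: measurable_mnorm2.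
Qed.

End matrix_measurability.

Lemma measure_pushforward {d d' : measure_display} {S : measurableType d}
    {T : measurableType d'} {R : realType} (m : {measure set S -> \bar R})
    (f : S -> T) : measurable_fun setT f ->
  exists m' : {measure set T -> \bar R}, forall A, m' A = m (f @^-1` A).
Proof. by move=> mf; exists (pushforward m f). Unshelve. exact: mf. Qed.

Section lebesgue_translation.
Local Open Scope ereal_scope.
Context {R : realType}.

Lemma lebesgue_measure_translate (a : R) (A : set R) : measurable A ->
  lebesgue_measure ((fun x : R => (x + a)%R) @^-1` A) = lebesgue_measure A.
Proof.
move=> mA.
have mt : @measurable_fun _ _ (measurableTypeR R) (measurableTypeR R) setT (+%R^~ a).
  exact: (@measurable_funD _ (measurableTypeR R) R setT id (cst a)).
have [t tE] := measure_pushforward (@lebesgue_measure R) mt.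
rewrite -[LHS]tE; apply/esym; apply: lebesgue_measure_unique => //.
move=> _ [[b c]] _ <-; rewrite tE /=.
have -> : +%R^~ a @^-1` `]b, c]%classic = `](b - a)%R, (c - a)%R]%classic.
  by apply/seteqP; split => x /=; rewrite !in_itv /= ltrBlDr lerBrDr.
rewrite !lebesgue_measure_itv /= !lte_fin ltrD2r.
by case: ifP => // _; rewrite -!EFinD; congr EFin; ring.
Qed.

Lemma lebesgue_cVE n (A : set 'cV[R]_n.+1) :
  lebesgue_cV R n.+1 A = (@lebesgue_measure R \x lebesgue_cV R n)
    ((fun z : measurableTypeR R * 'cV[R]_n => col_mx (z.1%:M : 'M[R]_1) z.2) @^-1` A).
Proof. by []. Qed.

Lemma measurable_stack n :
  measurable_fun setT (fun z : measurableTypeR R * 'cV[R]_n =>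
    (col_mx (z.1%:M : 'M[R]_1) z.2 : 'cV[R]_n.+1)).
Proof.
apply: measurable_mxP => i j.
case: (@split_ordP 1 n i) => k ->.
- rewrite [X in measurable_fun _ X](_ : _ = fst); first exact: measurable_fst.
  by apply/funext => z; apply: etrans (col_mxEu _ _ _ _) _; rewrite !ord1 mxE.
- rewrite [X in measurable_fun _ X](_ : _ = (fun v : 'cV[R]_n => v k j) \o snd).
    by apply: measurableT_comp; [exact: measurable_mx_coord|exact: measurable_snd].
  by apply/funext => z; exact: col_mxEd.
Qed.

Lemma measurable_preimage {d d'} {S : measurableType d} {T : measurableType d'}
    (f : S -> T) A : measurable_fun setT f -> measurable A -> measurable (f @^-1` A).
Proof. by move=> mf mA; rewrite -[X in measurable X]setTI; exact: mf. Qed.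

Lemma lebesgue_cV_translate n (a : 'cV[R]_n) (A : set 'cV[R]_n) : measurable A ->
  lebesgue_cV R n ((fun x => x + a)%R @^-1` A) = lebesgue_cV R n A.
Proof.
elim: n a A => [|n IH] a A mA.
  congr (lebesgue_cV R 0 _); apply/seteqP; split => x /=;
  by rewrite (_ : x + a = x)%R//; apply/matrixP => -[].
have mt m (b : 'cV[R]_m) : measurable_fun setT (fun x : 'cV[R]_m => x + b)%R.
  by apply: measurable_mxD.
rewrite !lebesgue_cVE.
set st := fun z => _.
pose a1 := (a : 'cV[R]_(1 + n)) ord0 ord0; pose a2 := dsubmx (a : 'cV[R]_(1 + n)).
have aE : a = st (a1, a2).
  rewrite /st /= -[LHS](@vsubmxK _ 1 n); apply: (f_equal (@col_mx _ 1 n 1 ^~ a2)).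
  by apply/matrixP => i j; rewrite !ord1 !mxE eqxx mulr1n; congr (a _ _); exact/val_inj.
pose tr (z : measurableTypeR R * 'cV[R]_n) : measurableTypeR R * 'cV[R]_n :=
  (z.1 + a1, z.2 + a2)%R.
have mtr : measurable_fun setT tr.
  apply: measurable_fun_pair; first by apply: measurable_funD => //; exact: measurable_fst.
  by apply: measurable_mxD => //; exact: measurable_snd.
have stD z : (st z + a)%R = st (tr z).
  case: z => x v; rewrite {1}aE /st /tr /=.
  apply: etrans (@add_col_mx _ 1 n 1 _ _ _ _) _; congr col_mx.
  by apply/matrixP => i j; rewrite !ord1 !mxE !eqxx !mulr1n.
have -> : st @^-1` ((fun x => (x + a)%R) @^-1` A) = tr @^-1` (st @^-1` A).
  by apply/seteqP; split => z; rewrite /preimage /mkset stD.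
have mA' : measurable (st @^-1` A).
  by apply: measurable_preimage => //; exact: measurable_stack.
have [t tE] := measure_pushforward (@lebesgue_measure R \x lebesgue_cV R n) mtr.
rewrite -[LHS]tE; apply/esym.
apply: (@product_measure_unique _ _ _ _ _ (@lebesgue_measure R) (lebesgue_cV R n) t) => //.
move=> {A mA mA'} A B mA mB; rewrite tE.
have -> : tr @^-1` (A `*` B) =
    ((fun x : R => x + a1)%R @^-1` A) `*` ((fun x => x + a2)%R @^-1` B) by [].
have mA1 : @measurable _ (measurableTypeR R) (+%R^~ a1 @^-1` A).
  apply: (@measurable_preimage _ _ (measurableTypeR R) (measurableTypeR R)) => //.
  exact: (@measurable_funD _ (measurableTypeR R) R setT id (cst a1)).
have mB2 : measurable ((fun x => x + a2)%R @^-1` B).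
  by apply: measurable_preimage => //; exact: mt.
apply: etrans (product_measure1E _ _ mA1 mB2) _.
by rewrite IH//; congr (_ * _); exact: lebesgue_measure_translate.
Qed.

Lemma ge0_integral_translate n (a : 'cV[R]_n) (h : 'cV[R]_n -> \bar R) :
  measurable_fun setT h -> (forall x, 0 <= h x) ->
  \int[lebesgue_cV R n]_x h (x + a)%R = \int[lebesgue_cV R n]_x h x.
Proof.
move=> mh h0.
have mt : measurable_fun setT (fun x : 'cV[R]_n => x + a)%R by exact: measurable_mxD.
transitivity (\int[pushforward (lebesgue_cV R n) (fun x => x + a)%R]_x h x).
  by apply/esym; rewrite (ge0_integral_pushforward mt).
by apply: eq_measure_integral => A mA _; exact: lebesgue_cV_translate.
Qed.

Lemma cV_box_measurable n (c : 'cV[R]_n) (e : R) :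
  measurable [set x : 'cV[R]_n | forall i, `|c i ord0 - x i ord0| < e]%R.
Proof.
rewrite (_ : [set _ | _] = \bigcap_(i in [set: 'I_n])
    [set x : 'cV[R]_n | `|c i ord0 - x i ord0| < e]%R); last first.
  by apply/seteqP; split => x /= h i; [move=> _; exact: h|exact: h].
apply: fin_bigcap_measurable => // i _.
rewrite (_ : [set _ | _] = (fun x : 'cV[R]_n => x i ord0) @^-1`
    `](c i ord0 - e)%R, (c i ord0 + e)%R[%classic); last first.
  by apply/seteqP; split => x /=; rewrite in_itv /= distrC ltr_distl.
by apply: measurable_preimage; [exact: measurable_mx_coord|exact: measurable_itv].
Qed.

Lemma lebesgue_cV_box_gt0 n (c : 'cV[R]_n) (e : R) : (0 < e)%R ->
  0 < lebesgue_cV R n [set x : 'cV[R]_n | forall i, `|c i ord0 - x i ord0| < e]%R.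
Proof.
move=> e0; elim: n c => [|n IH] c.
  by rewrite /= diracE mem_set ?lte01// => -[].
rewrite lebesgue_cVE; set c' := dsubmx (c : 'cV[R]_(1 + n)).
set B := _ @^-1` _.
have -> : B = (`](c ord0 ord0 - e)%R, (c ord0 ord0 + e)%R[%classic : set (measurableTypeR R)) `*`
   [set x : 'cV[R]_n | forall i, `|c' i ord0 - x i ord0| < e]%R.
  apply/seteqP; split => [[x v]|[x v] []] /=; rewrite in_itv /=.
    move=> h; split.
      have := h ord0; rewrite (_ : ord0 = @lshift 1 n ord0 :> 'I_n.+1); last exact/val_inj.
      rewrite [X in (`|_ - X| < _)%R -> _](_ : _ = x); last first.
        by apply: etrans (@col_mxEu _ 1 n _ _ _ _ _) _; rewrite mxE.
      by rewrite distrC ltr_distl.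
    move=> i; have := h (@rshift 1 n i).
    rewrite [X in (`|_ - X| < _)%R -> _](_ : _ = v i ord0); last first.
      exact: (@col_mxEd _ 1 n _ _ _ _ _).
    by rewrite /c' mxE.
  move=> xc h i; case: (@split_ordP 1 n i) => k ->.
    rewrite [X in (`|_ - X| < _)%R](_ : _ = x); last first.
      by apply: etrans (@col_mxEu _ 1 n _ _ _ _ _) _; rewrite !ord1 mxE.
    rewrite distrC ltr_distl (_ : @lshift 1 n k = ord0)//; apply/val_inj => /=.
    by case: k => -[].
  rewrite [X in (`|_ - X| < _)%R](_ : _ = v k ord0); last first.
    exact: (@col_mxEd _ 1 n _ _ _ _ _).
  by have := h k; rewrite /c' mxE.
rewrite product_measure1E//; last exact: cV_box_measurable.
apply: mule_gt0; last exact: IH.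
have : 0 < lebesgue_measure (`](c ord0 ord0 - e)%R, (c ord0 ord0 + e)%R[%classic : set R).
  rewrite lebesgue_measure_itv /= lte_fin ifT; last by lra.
  by rewrite -EFinD lte_fin; lra.
exact.
Qed.

End lebesgue_translation.

(** * Gaussian laws *)

(** A measure of total mass 1, as an element of the type of probabilities. *)
Lemma probability_of_measure {d : measure_display} {T : measurableType d}
    {R : realType} (m : {measure set T -> \bar R}) :
  m setT = 1%E -> exists g : probability T R, forall A, g A = m A.
Proof.
move=> m1; pose nu := fun A => m A.
have nu0 : nu set0 = 0%E by exact: measure0.
have nu_ge0 A : (0 <= nu A)%E by exact: measure_ge0.
have nu_sigma : semi_sigma_additive nu by exact: measure_semi_sigma_additive.
pose M := isMeasure.Build _ _ _ nu nu0 nu_ge0 nu_sigma.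
pose M' : {measure set T -> \bar R} := HB.pack nu M.
have nu1 : M' setT = 1%E by [].
pose N := Measure_isProbability.Build _ _ _ M' nu1.
pose g : probability T R := HB.pack nu M N.
by exists g.
Qed.

Section gaussian_measure.
Local Open Scope ereal_scope.
Context {R : realType}.

(** A probability measure with the centred Gaussian density of covariance A. *)
Definition is_gaussian n (A : 'M[R]_n) (g : probability 'cV[R]_n R) :=
  forall h : 'cV[R]_n -> \bar R, measurable_fun setT h -> (forall x, 0 <= h x) ->
    \int[g]_x h x = \int[lebesgue_cV R n]_x ((gaussian_pdf A x)%:E * h x).

(** The normalizing constant of the Gaussian density. *)
Definition gaussian_const n (A : 'M[R]_n) : R :=
  (Num.sqrt ((2 * pi) ^+ n * \det A))^-1.

(** The Gaussian density without its normalizing constant. *)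
Definition gauss_exp n (A : 'M[R]_n) (x : 'cV[R]_n) : R :=
  expR (- (mnorm2 A x / 2)).

Lemma gaussian_pdfE n (A : 'M[R]_n) x :
  gaussian_pdf A x = (gaussian_const A * gauss_exp A x)%R.
Proof. by []. Qed.

Lemma gaussian_pdf_ge0 n (A : 'M[R]_n) x : (0 <= gaussian_pdf A x)%R.
Proof. by rewrite gaussian_pdfE mulr_ge0 ?invr_ge0 ?sqrtr_ge0 ?expR_ge0. Qed.

Lemma measurable_gauss_exp {d} {T : measurableType d} n (A : 'M[R]_n)
    (f : T -> 'cV[R]_n) :
  measurable_fun setT f -> measurable_fun setT (fun x => gauss_exp A (f x)).
Proof. exact: measurable_expR_mnorm2. Qed.

Lemma gauss_exp_gt0 n (A : 'M[R]_n) x : (0 < gauss_exp A x)%R.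
Proof. exact: expR_gt0. Qed.

Lemma gauss_exp_le1 n (A : 'M[R]_n) x : spd A -> (gauss_exp A x <= 1)%R.
Proof.
by move=> As; rewrite /gauss_exp -expR0 ler_expR oppr_le0 divr_ge0// mnorm2_ge0.
Qed.

Lemma measurable_gauss_expV {d} {T : measurableType d} n (A : 'M[R]_n)
    (f : T -> 'cV[R]_n) :
  measurable_fun setT f -> measurable_fun setT (fun x => (gauss_exp A (f x))^-1)%R.
Proof.
move=> mf; apply: measurable_fun_gt0V; first exact: measurable_gauss_exp.
by move=> x; exact: gauss_exp_gt0.
Qed.

Lemma measurable_gaussian_pdf n (A : 'M[R]_n) : measurable_fun setT (gaussian_pdf A).
Proof. by apply: measurable_funM => //; exact: measurable_gauss_exp. Qed.

(** That the Gaussian density has total mass 1 is a hypothesis here: it holds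
    whenever some random vector has the Gaussian law. *)
Lemma exists_gaussian n (A : 'M[R]_n) : gaussian A setT = 1 ->
  exists g : probability 'cV[R]_n R,
    is_gaussian A g /\ forall B, measurable B -> g B = gaussian A B.
Proof.
move=> A1.
have [m mI] := is_integral_density (lebesgue_cV R n)
  (measurable_gaussian_pdf A) (gaussian_pdf_ge0 A).
have mE B : measurable B -> m B = gaussian A B.
  move=> mB; transitivity (\int[m]_x (\1_B x)%:E).
    by rewrite integral_indic// setIT.
  rewrite -mI//; last by apply/measurable_EFinP; exact: measurable_indic.
  rewrite /gaussian [RHS]integral_mkcond; apply: eq_integral => x _.
  by rewrite patchE indicE; case: ifPn => _; rewrite ?mule1 ?mule0.
have m1 : m setT = 1 by rewrite mE.
have [g gE] := probability_of_measure m1.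
exists g; split; last by move=> B mB; rewrite gE mE.
move=> h mh h0; rewrite mI//; apply: eq_measure_integral => B mB _.
exact: gE.
Qed.

Lemma is_gaussian_const_gt0 n (A : 'M[R]_n) g : is_gaussian A g ->
  (0 < gaussian_const A)%R.
Proof.
move=> gA; rewrite lt0r invr_ge0 sqrtr_ge0 andbT; apply/eqP => c0.
have := gA (cst 1) (measurable_cst _) (fun=> lee01).
rewrite integral_cst// mul1e [X in X = _ -> _]probability_setT.
under eq_integral do rewrite gaussian_pdfE c0 mul0r mul0e.
by rewrite integral0 => /eqP; rewrite onee_eq0.
Qed.

(** Averaging the observation likelihood over the noise of the signal gives the
    predictive likelihood and a Gaussian posterior. *)
Lemma gaussian_update d p (H : 'M[R]_(p, d)) (Sigma : 'M[R]_d) (Gamma : 'M[R]_p)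
    (gS gC : probability 'cV[R]_d R) :
  spd Sigma -> spd Gamma ->
  is_gaussian Sigma gS -> is_gaussian (post_cov H Sigma Gamma) gC ->
  exists2 c : R, (0 < c)%R &
    forall (a : 'cV[R]_d) (y : 'cV[R]_p) (f : 'cV[R]_d -> \bar R),
      measurable_fun setT f -> (forall x, 0 <= f x) ->
    \int[gS]_x ((gauss_exp Gamma (y - H *m (a + x)))%:E * f (a + x)%R) =
    (c * gauss_exp (innov_cov H Sigma Gamma) (y - H *m a))%:E *
    \int[gC]_x f ((1%:M - kalman_gain H Sigma Gamma *m H) *m a
                  + kalman_gain H Sigma Gamma *m y + x)%R.
Proof.
move=> Ss Gs gSE gCE.
have cS := is_gaussian_const_gt0 gSE; have cC := is_gaussian_const_gt0 gCE.
set K := kalman_gain _ _ _; set C := post_cov _ _ _ in gCE cC *.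
set S := innov_cov _ _ _.
exists (gaussian_const Sigma / gaussian_const C)%R; first by rewrite divr_gt0.
move=> a y f mf f0; set b : 'cV[R]_d := ((_ *m a) + _)%R.
have mT (z : 'cV[R]_d) : measurable_fun setT (fun x : 'cV[R]_d => z + x)%R.
  exact: measurable_mxD.
have mfT (z : 'cV[R]_d) : measurable_fun setT (fun x : 'cV[R]_d => f (z + x)%R).
  exact: (measurableT_comp mf (mT z)).
have mgT (z : 'cV[R]_d) : measurable_fun setT (fun x : 'cV[R]_d => gauss_exp Gamma (y - H *m (z + x))%R).
  apply: measurable_gauss_exp; apply: measurable_mxD => //.
  by apply: measurable_mxN; apply: measurable_mxM => //; exact: mT.
have mg : measurable_fun setT (fun x : 'cV[R]_d => gauss_exp Gamma (y - H *m x)%R).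
  apply: measurable_gauss_exp; apply: measurable_mxD => //.
  by apply: measurable_mxN; exact: measurable_mxM.
have mB (z : 'cV[R]_d) : measurable_fun setT (fun x : 'cV[R]_d => x - z)%R.
  exact: measurable_mxD.
have mpB : measurable_fun setT (fun x : 'cV[R]_d => gaussian_pdf Sigma (x - a)%R).
  exact: (measurableT_comp (measurable_gaussian_pdf Sigma) (mB a)).
rewrite gSE; first last.
- by move=> x; rewrite mule_ge0// lee_fin expR_ge0.
- by apply: emeasurable_funM => //; exact/measurable_EFinP.
rewrite gCE//.
transitivity (\int[lebesgue_cV R d]_x ((gaussian_pdf Sigma (x - a)%R)%:E *
    ((gauss_exp Gamma (y - H *m x)%R)%:E * f x))).
  rewrite -[RHS](ge0_integral_translate a); first last.
  - by move=> x; rewrite !mule_ge0// lee_fin ?gaussian_pdf_ge0 ?expR_ge0.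
  - apply: emeasurable_funM.
      by apply/measurable_EFinP; exact: mpB.
    by apply: emeasurable_funM => //; exact/measurable_EFinP.
  by apply: eq_integral => x _; rewrite addrK (addrC x a).
set k := (_ * gauss_exp S _)%R.
have k0 : (0 <= k)%R by rewrite mulr_ge0 ?expR_ge0// ltW// divr_gt0.
have mpC : measurable_fun setT (fun x : 'cV[R]_d => (gaussian_pdf C x)%:E * f (b + x)%R).
  by apply: emeasurable_funM => //; apply/measurable_EFinP; exact: measurable_gaussian_pdf.
have pC0 x : 0 <= (gaussian_pdf C x)%:E * f (b + x)%R.
  by rewrite mule_ge0// lee_fin gaussian_pdf_ge0.
transitivity (\int[lebesgue_cV R d]_x (k%:E * ((gaussian_pdf C x)%:E * f (b + x)%R))); last first.
  by rewrite ge0_integralZl.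
rewrite -[RHS](ge0_integral_translate (- b)); first last.
- by move=> x; rewrite mule_ge0// lee_fin.
- exact: emeasurable_funM.
apply: eq_integral => x _.
rewrite (addrC b) subrK !muleA -!EFinM; congr (_%:E * _); rewrite /k.
rewrite !gaussian_pdfE.
have EE : (gauss_exp Sigma (x - a) * gauss_exp Gamma (y - H *m x) =
           gauss_exp S (y - H *m a) * gauss_exp C (x - b))%R.
  rewrite /gauss_exp -!expRD; congr expR; rewrite -!opprD -!mulrDl; congr (- (_ / 2))%R.
  exact: complete_square.
rewrite -[LHS]mulrA EE.
have : gaussian_const C != 0%R by rewrite gt_eqF.
move: (gaussian_const Sigma) (gaussian_const C) => s c c0.
by field.
Qed.

(** The Cameron-Martin formula for a translated Gaussian law. *)
Lemma gaussian_translate n (A : 'M[R]_n) (g : probability 'cV[R]_n R)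
    (a : 'cV[R]_n) (f : 'cV[R]_n -> \bar R) :
  is_gaussian A g -> measurable_fun setT f -> (forall x, 0 <= f x) ->
  \int[g]_x f (a + x)%R =
  \int[g]_x ((gauss_exp A (x - a) / gauss_exp A x)%:E * f x).
Proof.
move=> gA mf f0.
have mT (z : 'cV[R]_n) : measurable_fun setT (fun x : 'cV[R]_n => z + x)%R.
  exact: measurable_mxD.
have mB (z : 'cV[R]_n) : measurable_fun setT (fun x : 'cV[R]_n => x - z)%R.
  exact: measurable_mxD.
have q0 x : (0 <= gauss_exp A (x - a) / gauss_exp A x)%R.
  by rewrite divr_ge0 ?expR_ge0.
have mq : measurable_fun setT (fun x : 'cV[R]_n => gauss_exp A (x - a) / gauss_exp A x)%R.
  by apply: measurable_funM; [exact: measurable_gauss_exp|exact: measurable_gauss_expV].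
have mfT : measurable_fun setT (fun x : 'cV[R]_n => f (a + x)%R).
  exact: (measurableT_comp mf (mT a)).
rewrite gA// gA//; first last.
- by move=> x; rewrite mule_ge0// lee_fin.
- by apply: emeasurable_funM => //; exact/measurable_EFinP.
rewrite -[RHS](ge0_integral_translate a); first last.
- by move=> x; rewrite !mule_ge0// lee_fin// gaussian_pdf_ge0.
- apply: emeasurable_funM; first by apply/measurable_EFinP; exact: measurable_gaussian_pdf.
  by apply: emeasurable_funM => //; exact/measurable_EFinP.
apply: eq_integral => x _.
rewrite addrK (addrC a) muleA -EFinM; congr (_%:E * _).
have e0 : gauss_exp A (x + a) != 0%R by rewrite gt_eqF// expR_gt0.
by rewrite !gaussian_pdfE; field.
Qed.

(** A Gaussian law charges every box, its density being positive. *)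
Lemma gaussian_box_gt0 n (A : 'M[R]_n) g (c : 'cV[R]_n) (e : R) :
  is_gaussian A g -> (0 < e)%R ->
  0 < g [set x : 'cV[R]_n | forall i, `|c i ord0 - x i ord0| < e]%R.
Proof.
move=> gA e0; set B := [set _ | _].
have mB : measurable B by exact: cV_box_measurable.
have cA := is_gaussian_const_gt0 gA.
rewrite lt0e measure_ge0 andbT; apply/eqP => gB0.
have : \int[g]_x (\1_B x)%:E = 0 by rewrite -[RHS]gB0 integral_indic// setIT.
rewrite gA//; last by apply/measurable_EFinP; exact: measurable_indic.
have mpdf : measurable_fun setT (fun x => (gaussian_pdf A x)%:E * (\1_B x)%:E).
  by apply: emeasurable_funM; apply/measurable_EFinP; [exact: measurable_gaussian_pdf|exact: measurable_indic].
move=> I0.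
have : \int[lebesgue_cV R n]_x `|(gaussian_pdf A x)%:E * (\1_B x)%:E| = 0.
  rewrite -[RHS]I0; apply: eq_integral => x _; rewrite gee0_abs// mule_ge0// lee_fin//.
  exact: gaussian_pdf_ge0.
move/(ae_eq_integral_abs (lebesgue_cV R n) measurableT mpdf).
move=> [N [mN N0 sN]].
have := lebesgue_cV_box_gt0 c e0; rewrite -/B.
rewrite (_ : lebesgue_cV R n B = 0) ?ltxx//; apply/eqP.
rewrite -measure_le0 -N0 le_measure ?inE// => x Bx; apply: sN => /=.
move=> /(_ Logic.I) /eqP; rewrite indicE mem_set// mule1 eqe gt_eqF//.
by rewrite gaussian_pdfE mulr_gt0 ?expR_gt0.
Qed.

End gaussian_measure.

(** * Conditional independence *)

Lemma prod_if1 (R : comPzRingType) N n (a : nat -> R) : (n < N)%N ->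
  \prod_(i < N) (if (i : nat) == n then a i else 1) = a n.
Proof.
move=> nN; rewrite (bigD1 (Ordinal nN))//= eqxx big1 ?mulr1// => i ni.
by rewrite ifN.
Qed.

Lemma prod_if2 (R : comPzRingType) N n m (a : nat -> R) :
  (n < N)%N -> (m < N)%N -> n != m ->
  \prod_(i < N) (if ((i : nat) == n) || ((i : nat) == m) then a i else 1) = a n * a m.
Proof.
move=> nN mN nm; rewrite (bigD1 (Ordinal nN))//= eqxx; congr (_ * _).
rewrite (bigD1 (Ordinal mN))/=; last by rewrite -val_eqE /= eq_sym.
by rewrite eqxx orbT big1 ?mulr1// => i /andP[ni mi]; rewrite ifN// negb_or ni mi.
Qed.

Lemma measurable_prod_cond {d : measure_display} {T : measurableType d}
    {R : realType} (I : eqType) (s : seq I) (Q : pred I) (h : I -> T -> R) :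
  (forall i, Q i -> measurable_fun setT (h i)) ->
  measurable_fun setT (fun x => \prod_(i <- s | Q i) h i x).
Proof.
move=> mh; under eq_fun do rewrite big_mkcond.
apply: (measurable_prod (h := fun i x => if Q i then h i x else 1)) => i _.
by case: (boolP (Q i)) => [/mh//|_]; exact: measurable_cst.
Qed.

Section pi_lambda_independence.
Local Open Scope ereal_scope.
Context {d : measure_display} {W : measurableType d} {R : realType}
  (P : probability W R).

(** Independence from a fixed event extends from a pi-system to the
    sigma-algebra that it generates. *)
Lemma indep_sigma (G : set (set W)) (F : set W) (p : R) :
  setI_closed G -> G setT -> G `<=` measurable -> measurable F -> (0 <= p)%R ->
  (forall E, G E -> P (E `&` F) = P E * p%:E) ->
  forall E, <<s G >> E -> P (E `&` F) = P E * p%:E.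
Proof.
move=> GI GT mG mF p0 GF E GE.
suff : mrestr P mF E = mscale (NngNum p0) P E.
  by rewrite /mrestr /mscale /= => ->; rewrite muleC.
apply: (g_sigma_algebra_measure_unique G mG (fun=> setT)) => //.
- by rewrite bigcup_const//; exists 0%N.
- by move=> A GA; transitivity (P A * p%:E); [exact: GF|rewrite muleC].
- move=> _; apply: (@le_lt_trans _ _ (P (setT `&` F))) => //.
  by rewrite setTI; apply: (le_lt_trans (probability_le1 P mF)); rewrite ltry.
Qed.

End pi_lambda_independence.

Section conditional_products.
Local Open Scope ereal_scope.
Context {d d' : measure_display} {W : measurableType d} {T : measurableType d'}
  {R : realType} (P : probability W R).

(** If, given some past, the V_n are independent with the random law kap, then
    the product rule for events extends to products of functions. Here kap maps
    a nonnegative function to its integral, as a function of the randomness. *)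
Lemma cond_product (N : nat) (V : nat -> W -> T)
    (kap : (T -> \bar R) -> W -> \bar R) (g : W -> R) (Mg : R) :
  (forall n, (n < N)%N -> measurable_fun setT (V n)) ->
  measurable_fun setT g -> (forall w, 0 <= g w <= Mg)%R ->
  (forall (wt : W -> R) (M : R), measurable_fun setT wt ->
     (forall w, 0 <= wt w <= M)%R ->
     is_integral (fun h => \int[P]_w ((wt w)%:E * kap h w))) ->
  (forall A : nat -> set T, (forall n, measurable (A n)) ->
     \int[P]_w (g w * \prod_(n < N) \1_(A n) (V n w))%:E =
     \int[P]_w ((g w)%:E * \prod_(n < N) kap (fun x => (\1_(A n) x)%:E) w)) ->
  (forall A, measurable A -> exists r : W -> R, exists M' : R,
     [/\ measurable_fun setT r, (forall w, 0 <= r w <= M')%R &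
         forall w, kap (fun x => (\1_A x)%:E) w = (r w)%:E]) ->
  forall f : nat -> T -> R,
    (forall n, measurable_fun setT (f n)) -> (forall n x, 0 <= f n x)%R ->
    (forall n, exists r : W -> R, exists M' : R,
       [/\ measurable_fun setT r, (forall w, 0 <= r w <= M')%R &
           forall w, kap (EFin \o f n) w = (r w)%:E]) ->
  \int[P]_w (g w * \prod_(n < N) f n (V n w))%:E =
  \int[P]_w ((g w)%:E * \prod_(n < N) kap (EFin \o f n) w).
Proof.
move=> mV mg g0 Kint Kind Kfin f.
pose adm (f : nat -> T -> R) := [/\ (forall n, measurable_fun setT (f n)),
  (forall n x, 0 <= f n x)%R & (forall n, exists r : W -> R, exists M' : R,
       [/\ measurable_fun setT r, (forall w, 0 <= r w <= M')%R &
           forall w, kap (EFin \o f n) w = (r w)%:E])].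
pose upd (f : nat -> T -> R) m h := fun k => if k == m then h else f k.
have adm_upd f' m A : adm f' -> measurable A -> adm (upd f' m (\1_A)).
  move=> [mf f0 fr] mA; split=> k; rewrite /upd; case: ifP => // _.
  exact: Kfin.
(* The functions are replaced by indicators one index at a time. *)
have S m : forall f, adm f ->
    (forall k, (m <= k)%N -> exists2 A, measurable A & f k = \1_A) ->
    \int[P]_w (g w * \prod_(n < N) f n (V n w))%:E =
    \int[P]_w ((g w)%:E * \prod_(n < N) kap (EFin \o f n) w).
  elim: m => [|m IH] {}f fadm fA.
    have /choice[A AE] : forall k, exists A, measurable A /\ f k = \1_A.
      by move=> k; have [A mA fE] := fA k (leq0n k); exists A.
    have mA n : measurable (A n) by have [] := AE n.
    transitivity (\int[P]_w (g w * \prod_(n < N) \1_(A n) (V n w))%:E).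
      apply: eq_integral => w _; congr (g w * _)%:E; apply: eq_bigr => n _.
      by have [_ ->] := AE n.
    rewrite Kind//; apply: eq_integral => w _; congr (_ * _).
    by apply: eq_bigr => n _; have [_ ->] := AE n.
  have upd_ind A : measurable A -> forall k, (m <= k)%N ->
      exists2 B, measurable B & upd f m (\1_A) k = \1_B.
    move=> mA k mk; rewrite /upd; case: eqP => [_|/eqP km]; first by exists A.
    by apply: fA; rewrite ltn_neqAle eq_sym km.
  have [Nm|mN] := leqP N m.
    have := IH _ (adm_upd _ m _ fadm measurableT) (upd_ind _ measurableT).
    have updE n : (n < N)%N -> upd f m (\1_setT) n = f n.
      by move=> nN; rewrite /upd ltn_eqF// (leq_trans nN).
    under eq_integral => w _ do under eq_bigr => n _ do rewrite updE//.
    by under [in X in _ = X -> _]eq_integral => w _ do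
      under eq_bigr => n _ do rewrite updE//.
  have [mf f0 /choice[r /choice[M fr]]] := fadm.
  pose mo := Ordinal mN.
  pose rest w := (\prod_(n < N | n != mo) f n (V n w))%R.
  pose rrest w := (\prod_(n < N | n != mo) r n w)%R.
  pose I h := \int[P]_w ((g w * rest w)%:E * h (V m w)).
  pose J h := \int[P]_w ((g w * rrest w)%:E * kap h w).
  have splitI h : \int[P]_w (g w * \prod_(n < N) upd f m h n (V n w))%:E = I (EFin \o h).
    apply: eq_integral => w _; rewrite (bigD1 mo)//= /upd eqxx -EFinM; congr _%:E.
    rewrite -mulrA; congr (_ * _)%R; rewrite mulrC; congr (_ * _)%R.
    by apply: eq_bigr => n nm; rewrite ifN.
  have splitJ h : \int[P]_w ((g w)%:E * \prod_(n < N) kap (EFin \o upd f m h n) w) =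
      J (EFin \o h).
    apply: eq_integral => w _; rewrite (bigD1 mo)//= /upd eqxx muleCA muleC; congr (_ * _).
    rewrite EFinM; congr (_ * _); rewrite /rrest -prodEFin.
    apply: eq_bigr => n nm; rewrite ifN//.
    by have [_ _ ->] := fr n.
  have fE : f = upd f m (f m) by apply/funext => k; rewrite /upd; case: eqP => [->|].
  rewrite [in LHS]fE [in RHS]fE splitI splitJ.
  have rest0 w : (0 <= rest w)%R by apply: prodr_ge0.
  have mrest : measurable_fun setT rest.
    apply: measurable_prod_cond => n _; exact: (measurableT_comp (mf n) (mV n (ltn_ord n))).
  have rr n w : (0 <= r n w <= M n)%R by have [_ + _] := fr n; exact.
  have rrest0 w : (0 <= rrest w)%R.
    by apply: prodr_ge0 => n _; have /andP[] := rr n w.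
  have mrrest : measurable_fun setT rrest.
    by apply: measurable_prod_cond => n _; have [] := fr n.
  apply: is_integral_ext.
  - apply: is_integral_weighted; [exact: mV|exact: measurable_funM|].
    by move=> w; rewrite mulr_ge0//; have /andP[] := g0 w.
  - apply: (Kint _ (Mg * \prod_(n < N | n != mo) M n)%R); first exact: measurable_funM.
    move=> w; have /andP[gw0 gw] := g0 w; rewrite mulr_ge0//= ler_pM//.
    by apply: ler_prod => n _; exact: rr.
  - move=> A mA; rewrite -[LHS](splitI (\1_A)) -[RHS](splitJ (\1_A)).
    by apply: IH; [exact: adm_upd|exact: upd_ind].
  - exact/measurable_EFinP.
  - by move=> x; rewrite lee_fin.
move=> mf f0 fr.
pose f' k := if (k < N)%N then f k else \1_setT.
have f'E n : (n < N)%N -> f' n = f n by rewrite /f' => ->.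
have := S N f'.
under eq_integral => w _ do under eq_bigr => n _ do rewrite f'E//.
under [in X in _ -> _ -> _ = X]eq_integral => w _ do
  under eq_bigr => n _ do rewrite f'E//.
apply.
- split=> k; rewrite /f'; case: ifP => // _.
  exact: Kfin.
- by move=> k Nk; exists setT => //; rewrite /f' ltnNge Nk.
Qed.

End conditional_products.

(** * Mean square estimates for bounded random variables *)

Section bounded_rv.
Context {d : measure_display} {W : measurableType d} {R : realType}
  (P : probability W R).

(** Bounded measurable functions, whose expectations are all finite. *)
Definition bounded_rv (X : W -> R) :=
  measurable_fun setT X /\ exists M, forall w, `|X w| <= M.

Local Notation Ex X := (Rintegral P setT X).
Implicit Types X Y A B : W -> R.

Lemma bounded_rv_integrable X : bounded_rv X -> P.-integrable setT (EFin \o X).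
Proof.
move=> [mX [M XM]]; apply: measurable_bounded_integrable => //.
  by apply: (le_lt_trans (probability_le1 P measurableT)); rewrite ltry.
by exists M; split; [exact: num_real|move=> x Mx w _; exact: le_trans (XM w) (ltW Mx)].
Qed.

Lemma bounded_rv_cst k : bounded_rv (cst k).
Proof. by split; [exact: measurable_cst|exists `|k|]. Qed.

Lemma bounded_rvD X Y : bounded_rv X -> bounded_rv Y ->
  bounded_rv (fun w => X w + Y w).
Proof.
move=> [mX [M XM]] [mY [M' YM]]; split; first exact: measurable_funD.
by exists (M + M') => w; apply: (le_trans (ler_normD _ _)); rewrite lerD.
Qed.

Lemma bounded_rvM X Y : bounded_rv X -> bounded_rv Y ->
  bounded_rv (fun w => X w * Y w).
Proof.
move=> [mX [M XM]] [mY [M' YM]]; split; first exact: measurable_funM.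
by exists (M * M') => w; rewrite normrM ler_pM.
Qed.

Lemma bounded_rvN X : bounded_rv X -> bounded_rv (fun w => - X w).
Proof.
move=> [mX [M XM]]; split; first exact: measurableT_comp.
by exists M => w; rewrite normrN.
Qed.

Lemma bounded_rvZ k X : bounded_rv X -> bounded_rv (fun w => k * X w).
Proof. by apply: bounded_rvM; exact: bounded_rv_cst. Qed.

Lemma bounded_rvB X Y : bounded_rv X -> bounded_rv Y ->
  bounded_rv (fun w => X w - Y w).
Proof. by move=> bX bY; apply: bounded_rvD => //; exact: bounded_rvN. Qed.

Lemma bounded_rv_sum N (X : nat -> W -> R) : 
  (forall n, (n < N)%N -> bounded_rv (X n)) ->
  bounded_rv (fun w => \sum_(n < N) X n w).
Proof.
elim: N => [|N IH] bX.
  by under eq_fun do rewrite big_ord0; exact: bounded_rv_cst.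
under eq_fun do rewrite big_ord_recr /=.
apply: bounded_rvD; last exact: bX.
by apply: IH => n nN; apply: bX; rewrite ltnW.
Qed.

Lemma bounded_rv01 X : measurable_fun setT X -> (forall w, 0 <= X w <= 1) ->
  bounded_rv X.
Proof.
by move=> mX X01; split=> //; exists 1 => w; have /andP[X0 X1] := X01 w; rewrite ger0_norm.
Qed.

Lemma ExE X : bounded_rv X -> (Ex X)%:E = (\int[P]_w (X w)%:E)%E.
Proof.
by move=> /bounded_rv_integrable bX; rewrite /Rintegral fineK//; exact: integrable_fin_num.
Qed.

Lemma ExD X Y : bounded_rv X -> bounded_rv Y ->
  Ex (fun w => X w + Y w) = Ex X + Ex Y.
Proof. by move=> bX bY; rewrite RintegralD//; exact: bounded_rv_integrable. Qed.

Lemma ExB X Y : bounded_rv X -> bounded_rv Y ->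
  Ex (fun w => X w - Y w) = Ex X - Ex Y.
Proof. by move=> bX bY; rewrite RintegralB//; exact: bounded_rv_integrable. Qed.

Lemma ExZ k X : bounded_rv X -> Ex (fun w => k * X w) = k * Ex X.
Proof. by move=> bX; rewrite RintegralZl//; exact: bounded_rv_integrable. Qed.

Lemma Ex_cst k : Ex (cst k) = k.
Proof. by rewrite Rintegral_cst// [X in fine X](probability_setT P) mulr1. Qed.

Lemma Ex_sum N (X : nat -> W -> R) : (forall n, (n < N)%N -> bounded_rv (X n)) ->
  Ex (fun w => \sum_(n < N) X n w) = \sum_(n < N) Ex (X n).
Proof.
elim: N => [|N IH] bX.
  by rewrite big_ord0; under eq_Rintegral do rewrite big_ord0; rewrite Ex_cst.
have bX' n : (n < N)%N -> bounded_rv (X n) by move=> nN; apply: bX; rewrite ltnW.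
under eq_Rintegral do rewrite big_ord_recr /=.
rewrite ExD; [|exact: bounded_rv_sum|exact: bX].
by rewrite IH// big_ord_recr.
Qed.

Lemma Ex_le X Y : bounded_rv X -> bounded_rv Y -> (forall w, X w <= Y w) ->
  Ex X <= Ex Y.
Proof. by move=> bX bY XY; apply: le_Rintegral => //; exact: bounded_rv_integrable. Qed.

(** Minkowski's inequality in mean square. *)
Lemma Ex_sqrD_le A B (a b : R) : bounded_rv A -> bounded_rv B -> 0 < a -> 0 < b ->
  Ex (fun w => A w ^+ 2) <= a ^+ 2 -> Ex (fun w => B w ^+ 2) <= b ^+ 2 ->
  Ex (fun w => (A w + B w) ^+ 2) <= (a + b) ^+ 2.
Proof.
move=> bA bB a0 b0 Aa Bb.
have bA2 : bounded_rv (fun w => A w ^+ 2) by exact: bounded_rvM.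
have bB2 : bounded_rv (fun w => B w ^+ 2) by exact: bounded_rvM.
have bAB2 : bounded_rv (fun w => (A w + B w) ^+ 2).
  by apply: bounded_rvM; exact: bounded_rvD.
apply: (@le_trans _ _ (Ex (fun w => (1 + b / a) * A w ^+ 2 + (1 + a / b) * B w ^+ 2))).
  apply: Ex_le => // [|w]; first by apply: bounded_rvD; exact: bounded_rvZ.
  rewrite -subr_ge0.
  have -> : (1 + b / a) * A w ^+ 2 + (1 + a / b) * B w ^+ 2 - (A w + B w) ^+ 2 =
      (b * A w - a * B w) ^+ 2 / (a * b).
    by field; rewrite !gt_eqF.
  by rewrite divr_ge0 ?sqr_ge0// ltW// mulr_gt0.
rewrite ExD ?ExZ//; try exact: bounded_rvZ.
have -> : (a + b) ^+ 2 = (1 + b / a) * a ^+ 2 + (1 + a / b) * b ^+ 2.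
  by field; rewrite !gt_eqF.
by apply: lerD; apply: ler_wpM2l => //; rewrite addr_ge0// divr_ge0// ltW.
Qed.

(** The mean square error of an empirical mean of conditionally independent
    variables with conditional mean Phi; the conditional independence enters
    through second moments only. *)
Lemma sampling_error N (X : nat -> W -> R) (Phi : W -> R) : (0 < N)%N ->
  (forall n, (n < N)%N -> measurable_fun setT (X n)) ->
  (forall n w, (n < N)%N -> 0 <= X n w <= 1) ->
  measurable_fun setT Phi -> (forall w, 0 <= Phi w <= 1) ->
  (forall n, (n < N)%N -> Ex (X n) = Ex Phi) ->
  (forall n, (n < N)%N -> Ex (fun w => Phi w * X n w) = Ex (fun w => Phi w ^+ 2)) ->
  (forall n m, (n < N)%N -> (m < N)%N -> n != m ->
     Ex (fun w => X n w * X m w) = Ex (fun w => Phi w ^+ 2)) ->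
  Ex (fun w => (N%:R^-1 * \sum_(n < N) X n w - Phi w) ^+ 2) <= (4 * N%:R)^-1.
Proof.
move=> N0 mX X01 mPhi Phi01 EX EXP EXX.
have bX n : (n < N)%N -> bounded_rv (X n).
  by move=> nN; apply: bounded_rv01 => [|w]; [exact: mX|exact: X01].
have bP : bounded_rv Phi by exact: bounded_rv01.
have bP2 : bounded_rv (fun w => Phi w ^+ 2) by exact: bounded_rvM.
have bXX n m : (n < N)%N -> (m < N)%N -> bounded_rv (fun w => X n w * X m w).
  by move=> nN mN; apply: bounded_rvM; exact: bX.
have bPX n : (n < N)%N -> bounded_rv (fun w => Phi w * X n w).
  by move=> nN; apply: bounded_rvM => //; exact: bX.
pose D n w := X n w - Phi w.
have N0' : N%:R != 0 :> R by rewrite pnatr_eq0 -lt0n.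
(* The error is the mean of the D n, whose cross terms have expectation 0. *)
have E0 w : (N%:R^-1 * \sum_(n < N) X n w - Phi w) ^+ 2 =
    N%:R^-1 ^+ 2 * \sum_(n < N) \sum_(m < N) (D n w * D m w).
  rewrite -big_distrlr /= -expr2 -exprMn; congr (_ ^+ 2).
  rewrite /D big_split /= mulrDr; congr (_ + _).
  by rewrite sumr_const card_ord -[- _ *+ _]mulr_natl mulrA mulVf// mul1r.
under eq_Rintegral do rewrite E0.
have bD n : (n < N)%N -> bounded_rv (D n) by move=> nN; apply: bounded_rvB => //; exact: bX.
have bDD n m : (n < N)%N -> (m < N)%N -> bounded_rv (fun w => D n w * D m w).
  by move=> nN mN; apply: bounded_rvM; exact: bD.
have EDD n m : (n < N)%N -> (m < N)%N ->
    Ex (fun w => D n w * D m w) = Ex (fun w => X n w * X m w) - Ex (fun w => Phi w ^+ 2).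
  move=> nN mN.
  have -> : (fun w => D n w * D m w) = (fun w => X n w * X m w - Phi w * X n w
      - Phi w * X m w + Phi w ^+ 2).
    by apply/funext => w; rewrite /D; ring.
  rewrite ExD//; last first.
    by apply: bounded_rvB; [apply: bounded_rvB; [exact: bXX|exact: bPX]|exact: bPX].
  rewrite ExB; [|by apply: bounded_rvB; [exact: bXX|exact: bPX]|exact: bPX].
  by rewrite ExB; [|exact: bXX|exact: bPX]; rewrite !EXP//; ring.
have EDD0 n m : (n < N)%N -> (m < N)%N -> n != m -> Ex (fun w => D n w * D m w) = 0.
  by move=> nN mN nm; rewrite EDD// EXX// subrr.
(* The conditional variance: X ^+ 2 <= X and Phi - Phi ^+ 2 <= 1 / 4. *)
have EDn n : (n < N)%N -> Ex (fun w => D n w * D n w) <= 4^-1.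
  move=> nN; rewrite EDD//.
  apply: (@le_trans _ _ (Ex Phi - Ex (fun w => Phi w ^+ 2))).
    rewrite lerD2r -(EX n nN); apply: Ex_le; [exact: bXX|exact: bX|move=> w].
    by have /andP[x0 x1] := X01 n w nN; rewrite -[leRHS]mulr1 ler_wpM2l.
  rewrite -ExB// -[leRHS](Ex_cst 4^-1); apply: Ex_le => [||w].
  - exact: bounded_rvB.
  - exact: bounded_rv_cst.
  - by rewrite /cst -subr_ge0 (_ : _ - _ = (Phi w - 2^-1) ^+ 2) ?sqr_ge0//; field.
rewrite ExZ; last first.
  apply: (@bounded_rv_sum N (fun n w => \sum_(m < N) (D n w * D m w))) => n nN.
  by apply: (@bounded_rv_sum N (fun m w => D n w * D m w)) => m mN; exact: bDD.
rewrite (@Ex_sum N (fun n w => \sum_(m < N) (D n w * D m w))); last first.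
  by move=> n nN; apply: (@bounded_rv_sum N (fun m w => D n w * D m w)) => m mN; exact: bDD.
have -> : (4 * N%:R)^-1 = N%:R^-1 ^+ 2 * \sum_(n < N) 4^-1 :> R.
  by rewrite sumr_const card_ord -mulr_natl; field.
rewrite ler_wpM2l ?exprn_ge0 ?invr_ge0//; apply: ler_sum => n _.
rewrite (@Ex_sum N (fun m w => D n w * D m w)); last by move=> m mN; exact: bDD.
rewrite (bigD1 n)//= big1 ?addr0; first exact: EDn.
by move=> m nm; apply: EDD0 => //; rewrite eq_sym.
Qed.

End bounded_rv.

(** * The signal and the observation noise *)

Section generated_measurability.
Context {d d' : measure_display} {W : measurableType d} {T : measurableType d'}.

(** Measurability with respect to the sigma-algebra generated by G. *)
Definition measurable_wrt (G : set (set W)) (f : W -> T) :=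
  @measurable_fun _ _ (g_sigma_algebraType G) T setT f.

Lemma measurable_wrt_preimage G f A : measurable_wrt G f -> measurable A ->
  <<s G >> (f @^-1` A).
Proof. by move=> mf mA; have := mf measurableT A mA; rewrite setTI. Qed.

Lemma measurable_wrtP G f :
  (forall A, measurable A -> <<s G >> (f @^-1` A)) -> measurable_wrt G f.
Proof. by move=> mf _ A mA; rewrite setTI; exact: mf. Qed.

End generated_measurability.

Section signal.
Context {R : realType} {d p : nat} (psi : 'cV[R]_d -> 'cV[R]_d)
  (H : 'M[R]_(p, d)) (Sigma : 'M[R]_d) (Gamma : 'M[R]_p)
  (mu0 : probability 'cV[R]_d R)
  {dW : measure_display} {W : measurableType dW} (P : probability W R)
  (u xi : nat -> {RV P >-> 'cV[R]_d}) (y eta : nat -> {RV P >-> 'cV[R]_p}).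
Hypothesis psi_meas : measurable_fun setT psi.
Hypothesis model : is_model psi H Sigma Gamma mu0 u xi y eta.

Lemma gaussian_xi_total : gaussian Sigma setT = 1%E.
Proof. by rewrite -(model_xi model 0 measurableT) preimage_setT probability_setT. Qed.

Lemma gaussian_eta_total : gaussian Gamma setT = 1%E.
Proof. by rewrite -(model_eta model 0 measurableT) preimage_setT probability_setT. Qed.

(** The events on the inputs of the signal up to time m form a pi-system; so do
    those on the first m observation noises. *)
Definition signal_events (m : nat) : set (set W) :=
  [set E | exists A B, [/\ measurable A, forall k : nat, measurable (B k) &
     E = u 0%N @^-1` A `&` \bigcap_(k < m) (xi k @^-1` B k)]].

Definition noise_events (m : nat) : set (set W) :=
  [set E | exists2 C, forall k : nat, measurable (C k) &
     E = \bigcap_(k < m) (eta k.+1 @^-1` C k)].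

Lemma bigcap_preimage_measurable {d' : measure_display} {T : measurableType d'}
    (X : nat -> {RV P >-> T}) (m : nat) (B : nat -> set T) :
  (forall k, measurable (B k)) -> measurable (\bigcap_(k < m) (X k @^-1` B k)).
Proof.
move=> mB; apply: bigcap_measurableType => k _.
by rewrite -[X in measurable X]setTI; exact: measurable_funP.
Qed.

Lemma signal_events_measurable m : signal_events m `<=` measurable.
Proof.
move=> _ [A [B [mA mB ->]]]; apply: measurableI.
  by rewrite -[X in measurable X]setTI; exact: measurable_funP.
exact: bigcap_preimage_measurable.
Qed.

Lemma noise_events_measurable m : noise_events m `<=` measurable.
Proof.
move=> _ [C mC ->].
exact: (bigcap_preimage_measurable (fun k => eta k.+1)).
Qed.

Lemma signal_eventsI m : setI_closed (signal_events m).
Proof.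
move=> _ _ [A [B [mA mB ->]]] [A' [B' [mA' mB' ->]]].
exists (A `&` A'), (fun k => B k `&` B' k); split.
- exact: measurableI.
- by move=> k; exact: measurableI.
- by rewrite preimage_setI setIACA -bigcapI.
Qed.

Lemma noise_eventsI m : setI_closed (noise_events m).
Proof.
move=> _ _ [C mC ->] [C' mC' ->]; exists (fun k => C k `&` C' k).
  by move=> k; exact: measurableI.
by rewrite -bigcapI.
Qed.

Lemma signal_eventsT m : signal_events m setT.
Proof.
exists setT, (fun=> setT); split => //.
by apply/seteqP; split.
Qed.

Lemma noise_eventsT m : noise_events m setT.
Proof. by exists (fun=> setT) => //; apply/seteqP; split. Qed.

Lemma init_wrt m : measurable_wrt (signal_events m) (u 0%N).
Proof.
apply: measurable_wrtP => A mA; apply: sub_sigma_algebra.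
exists A, (fun=> setT); split => //.
by apply/seteqP; split => // w [].
Qed.

Lemma xi_wrt m j : (j < m)%N -> measurable_wrt (signal_events m) (xi j).
Proof.
move=> jm; apply: measurable_wrtP => A mA; apply: sub_sigma_algebra.
exists setT, (fun k => if k == j then A else setT); split => //.
  by move=> k; case: ifP.
apply/seteqP; split => [w wA|w [_ /(_ j jm)]] /=; last by rewrite eqxx.
by split => // k _ /=; case: eqP => // ->.
Qed.

Lemma eta_wrt m j : (j < m)%N -> measurable_wrt (noise_events m) (eta j.+1).
Proof.
move=> jm; apply: measurable_wrtP => A mA; apply: sub_sigma_algebra.
exists (fun k => if k == j then A else setT).
  by move=> k; case: ifP.
apply/seteqP; split => [w wA|w /(_ j jm)] /=; last by rewrite eqxx.
by move=> k _ /=; case: eqP => // ->.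
Qed.

(** The signal is a function of its inputs. *)
Lemma signal_wrt m k : (k <= m)%N -> measurable_wrt (signal_events m) (u k).
Proof.
elim: k => [|k IH] km; first exact: init_wrt.
rewrite /measurable_wrt (_ : (u k.+1 : W -> _) = fun w => psi (u k w) + xi k w).
  apply: measurable_mxD; last exact: xi_wrt.
  by apply: (measurableT_comp psi_meas); apply: IH; exact: ltnW.
by apply/funext => w; exact: (model_signal model).
Qed.

Lemma signal_events_prob m A (B : nat -> set 'cV[R]_d) :
  measurable A -> (forall k, measurable (B k)) ->
  P (u 0%N @^-1` A `&` \bigcap_(k < m) (xi k @^-1` B k)) =
  (P (u 0%N @^-1` A) * \prod_(k < m) P (xi k @^-1` B k))%E.
Proof.
move=> mA mB.
have := model_indep model m mA mB (fun=> measurableT).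
rewrite (_ : \bigcap_(k < m) (eta k.+1 @^-1` setT) = setT) ?setIT; last first.
  by apply/seteqP; split.
by move=> ->; rewrite [X in (_ * X)%E]big1 ?mule1// => k _; rewrite preimage_setT probability_setT.
Qed.

(** The signal up to time k is independent of the next noise. *)
Lemma signal_xi_indep k E B : <<s signal_events k >> E -> measurable B ->
  P (E `&` xi k @^-1` B) = (P E * P (xi k @^-1` B))%E.
Proof.
move=> sE mB.
have mxB : measurable (xi k @^-1` B).
  by rewrite -[X in measurable X]setTI; exact: measurable_funP.
rewrite -(fineK (fin_num_measure P _ mxB)).
apply: (indep_sigma (@signal_eventsI k)) sE => //.
- exact: signal_eventsT.
- exact: signal_events_measurable.
- by rewrite fine_ge0.
move=> _ [A [B' [mA mB' ->]]]; rewrite fineK ?fin_num_measure//.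
pose B'' j := if j == k then B else B' j.
have mB'' j : measurable (B'' j) by rewrite /B''; case: ifP.
rewrite signal_events_prob//.
have -> : u 0%N @^-1` A `&` \bigcap_(j < k) xi j @^-1` B' j `&` xi k @^-1` B =
   u 0%N @^-1` A `&` \bigcap_(j < k.+1) xi j @^-1` B'' j.
  apply/seteqP; split => [w [[wA wB'] wB]|w [wA wB]].
    split => // j /=; rewrite ltnS leq_eqVlt /B'' => /orP[/eqP ->|jk].
      by rewrite eqxx.
    by rewrite ltn_eqF//; exact: wB'.
  split; last by have := wB k (ltnSn k); rewrite /B'' eqxx.
  split => // j /= jk; have := wB j (ltnW jk : (j < k.+1)%N).
  by rewrite /B'' ltn_eqF.
rewrite signal_events_prob// big_ord_recr /= {2}/B'' eqxx muleA; congr (_ * _ * _)%E.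
by apply: eq_bigr => j _; rewrite /B'' ltn_eqF.
Qed.

(** The signal is independent of the observation noise. *)
Lemma signal_eta_indep m E F : <<s signal_events m >> E -> <<s noise_events m >> F ->
  P (E `&` F) = (P E * P F)%E.
Proof.
move=> sE sF.
have mF : measurable F.
  by apply: (smallest_sub _ (@noise_events_measurable m) sF); exact: sigma_algebra_measurable.
rewrite -(fineK (fin_num_measure P _ mF)).
apply: (indep_sigma (@signal_eventsI m)) sE => //.
- exact: signal_eventsT.
- exact: signal_events_measurable.
- by rewrite fine_ge0.
move=> {}E GE; have mE := signal_events_measurable GE.
rewrite fineK ?fin_num_measure// setIC muleC -[X in (_ * X)%E](fineK (fin_num_measure P _ mE)).
apply: (indep_sigma (@noise_eventsI m)) sF => //.
- exact: noise_eventsT.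
- exact: noise_events_measurable.
- by rewrite fine_ge0.
move=> _ [C mC ->]; rewrite fineK ?fin_num_measure//.
move: GE => [A [B [mA mB ->]]].
rewrite setIC (model_indep model)// muleC.
have ABE := signal_events_prob m mA mB.
apply: etrans (congr1 (mule _) (esym ABE)) _; congr (_ * _)%E.
have := model_indep model m measurableT (fun=> measurableT) mC.
rewrite preimage_setT setTI (_ : \bigcap_(k < m) (xi k @^-1` setT) = setT) ?setTI; last first.
  by apply/seteqP; split.
move=> ->; rewrite probability_setT mul1e [X in _ = (X * _)%E]big1 ?mul1e//.
Qed.

End signal.

(** * The unnormalized filter *)

Section bayes.
Local Open Scope ereal_scope.
Context {R : realType} {d p : nat} (psi : 'cV[R]_d -> 'cV[R]_d)
  (H : 'M[R]_(p, d)) (Sigma : 'M[R]_d) (Gamma : 'M[R]_p)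
  (mu0 : probability 'cV[R]_d R)
  {dW : measure_display} {W : measurableType dW} (P : probability W R)
  (u xi : nat -> {RV P >-> 'cV[R]_d}) (y eta : nat -> {RV P >-> 'cV[R]_p}).

(** The likelihood, relative to Lebesgue measure and up to a constant, of the
    observations z 0, ..., z (k - 1) given the signal u 1, ..., u k. *)
Definition likelihood (z : nat -> 'cV[R]_p) (k : nat) (w : W) : R :=
  (\prod_(j < k) gauss_exp Gamma (z j - H *m u j.+1 w))%R.

(** The unnormalized filter at time k, by the Kallianpur-Striebel formula. *)
Definition unnorm_filter (z : nat -> 'cV[R]_p) (k : nat)
    (h : 'cV[R]_d -> \bar R) : \bar R :=
  \int[P]_w ((likelihood z k w)%:E * h (u k w)).

Lemma likelihood_gt0 z k w : (0 < likelihood z k w)%R.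
Proof. by apply: prodr_gt0 => j _; exact: gauss_exp_gt0. Qed.

Lemma likelihood_ge0 z k w : (0 <= likelihood z k w)%R.
Proof. exact/ltW/likelihood_gt0. Qed.

Lemma likelihood_le1 z k w : spd Gamma -> (likelihood z k w <= 1)%R.
Proof.
move=> Gs; apply: prodr_ile1 => j _.
by rewrite (ltW (gauss_exp_gt0 _ _)) gauss_exp_le1.
Qed.

Lemma measurable_likelihood {d' : measure_display} {T : measurableType d'}
    (k : nat) (z : T -> nat -> 'cV[R]_p) (s : T -> nat -> 'cV[R]_d) :
  (forall j, (j < k)%N -> measurable_fun setT (z ^~ j)) ->
  (forall j, (j < k)%N -> measurable_fun setT (s ^~ j.+1)) ->
  measurable_fun setT
    (fun t => \prod_(j < k) gauss_exp Gamma (z t j - H *m s t j.+1))%R.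
Proof.
move=> mz ms; apply: measurable_prod_cond => j _.
apply: measurable_gauss_exp; apply: measurable_mxD; first exact: mz.
by apply: measurable_mxN; apply: measurable_mxM => //; exact: ms.
Qed.

Hypothesis psi_meas : measurable_fun setT psi.
Hypothesis model : is_model psi H Sigma Gamma mu0 u xi y eta.

Lemma measurable_likelihood_rv z k : measurable_fun setT (likelihood z k).
Proof.
apply: (measurable_likelihood (z := fun=> z) (s := fun w j => u j w)) => j _.
  exact: measurable_cst.
exact: measurable_funP.
Qed.

Lemma likelihood_wrt z k :
  measurable_wrt (signal_events u xi k) (likelihood z k).
Proof.
apply: (@measurable_likelihood _ (g_sigma_algebraType (signal_events u xi k))
  k (fun=> z) (fun w j => u j w)) => j jk.
  exact: measurable_cst.
exact: (signal_wrt psi_meas model).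
Qed.

(** One step of the filter: reweight by the predictive likelihood of the next
    observation, then move by the optimal Gaussian proposal. *)
Lemma unnorm_filterS (gC : probability 'cV[R]_d R) :
  spd Sigma -> spd Gamma -> is_gaussian (post_cov H Sigma Gamma) gC ->
  exists2 c : R, (0 < c)%R &
    forall z k (h : 'cV[R]_d -> \bar R),
      measurable_fun setT h -> (forall x, 0 <= h x) ->
    unnorm_filter z k.+1 h =
    c%:E * unnorm_filter z k (fun v =>
      (gauss_exp (innov_cov H Sigma Gamma) (z k - H *m psi v))%:E *
      \int[gC]_x h ((1%:M - kalman_gain H Sigma Gamma *m H) *m psi v
                    + kalman_gain H Sigma Gamma *m z k + x)%R).
Proof.
move=> Ss Gs gCE.
have [gS [gSE gSx]] := exists_gaussian (gaussian_xi_total model).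
have [c c0 upd] := gaussian_update Ss Gs gSE gCE.
exists c => // z k h mh h0.
pose X w := (u k w, likelihood z k w).
have mX : measurable_fun setT X.
  by apply: measurable_fun_pair; [exact: measurable_funP|exact: measurable_likelihood_rv].
(* The absolute value makes F nonnegative; the likelihood is positive anyway. *)
pose F (t : ('cV[R]_d * R) * 'cV[R]_d) : \bar R :=
  `|t.1.2|%:E * ((gauss_exp Gamma (z k - H *m (psi t.1.1 + t.2)%R))%:E * h (psi t.1.1 + t.2)%R).
have mv : measurable_fun setT (fun t : ('cV[R]_d * R) * 'cV[R]_d => psi t.1.1 + t.2)%R.
  apply: measurable_mxD; last exact: measurable_snd.
  apply: (measurableT_comp psi_meas).
  by apply: (measurableT_comp measurable_fst); exact: measurable_fst.
have mF : measurable_fun setT F.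
  apply: emeasurable_funM.
    apply/measurable_EFinP; apply: measurableT_comp => //.
    by apply: (measurableT_comp measurable_snd); exact: measurable_fst.
  apply: emeasurable_funM; last exact: (measurableT_comp mh mv).
  apply/measurable_EFinP; apply: measurable_gauss_exp; apply: measurable_mxD => //.
  by apply: measurable_mxN; exact: measurable_mxM.
have F0 t : 0 <= F t.
  by rewrite /F !mule_ge0// lee_fin// ltW// gauss_exp_gt0.
transitivity (\int[P]_w F (X w, xi k w)).
  apply: eq_integral => w _; rewrite /F /X /= ger0_norm ?likelihood_ge0//.
  rewrite {1}/likelihood big_ord_recr /= -(model_signal model) EFinM muleA.
  by [].
rewrite (@integral_indep _ _ _ _ _ _ _ P X (xi k) gS)//; last first.
  move=> A B mA mB; rewrite gSx// -(model_xi model k mB).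
  apply: (signal_xi_indep model) => //.
  apply: measurable_wrt_preimage mA.
  apply: measurable_fun_pair; first exact: (signal_wrt psi_meas model).
  exact: likelihood_wrt.
pose S := innov_cov H Sigma Gamma.
pose G v := (gauss_exp S (z k - H *m psi v))%:E *
      \int[gC]_x h ((1%:M - kalman_gain H Sigma Gamma *m H) *m psi v
                    + kalman_gain H Sigma Gamma *m z k + x)%R.
have FE w : \int[gS]_x F (X w, x) = c%:E * ((likelihood z k w)%:E * G (u k w)).
  rewrite /F /X /= ger0_norm ?likelihood_ge0// ge0_integralZl ?lee_fin ?likelihood_ge0//; first last.
  - by move=> x _; rewrite mule_ge0// lee_fin ltW// gauss_exp_gt0.
  - apply: emeasurable_funM.
      apply/measurable_EFinP; apply: measurable_gauss_exp; apply: measurable_mxD => //.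
      by apply: measurable_mxN; apply: measurable_mxM => //; exact: measurable_mxD.
    by apply: (measurableT_comp mh); exact: measurable_mxD.
  by rewrite upd// EFinM -[X in _ * X = _]muleA [LHS]muleCA.
under eq_integral do rewrite FE.
rewrite ge0_integralZl//; last by rewrite lee_fin ltW.
- apply: emeasurable_funM; first by apply/measurable_EFinP; exact: measurable_likelihood_rv.
  apply: (@measurableT_comp _ _ _ _ _ _ G _ (u k)); last exact: measurable_funP.
  apply: emeasurable_funM.
    apply/measurable_EFinP; apply: measurable_gauss_exp; apply: measurable_mxD => //.
    by apply: measurable_mxN; exact: measurable_mxM.
  apply: (@measurable_fun_fubini_tonelli_F _ _ _ _ R gC (fun t : 'cV[R]_d * 'cV[R]_d => h ((1%:M - kalman_gain H Sigma Gamma *m H) *m psi t.1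
                    + kalman_gain H Sigma Gamma *m z k + t.2)%R)) => //.
  apply: (measurableT_comp mh); apply: measurable_mxD; last exact: measurable_snd.
  apply: measurable_mxD => //; apply: measurable_mxM => //.
  by apply: (measurableT_comp psi_meas); exact: measurable_fst.
- move=> w _; rewrite mule_ge0 ?lee_fin ?likelihood_ge0// mule_ge0//.
    by rewrite lee_fin ltW// gauss_exp_gt0.
  exact: integral_ge0.
Qed.

End bayes.

(** * The Kallianpur-Striebel formula *)

Lemma integral_indic_preimage {d d' : measure_display} {W : measurableType d}
    {T : measurableType d'} {R : realType} (m : {measure set W -> \bar R})
    (f : W -> T) (A : set T) : measurable_fun setT f -> measurable A ->
  (\int[m]_w (\1_A (f w))%:E)%E = m (f @^-1` A).
Proof.
move=> mf mA; transitivity (\int[m]_w (\1_(f @^-1` A) w)%:E)%E => //.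
by rewrite integral_indic ?setIT//; exact: measurable_preimage.
Qed.

(** The product rule for events extends to expectations of products. This is
    [cond_product] with a law that does not depend on the randomness. *)
Lemma iid_product {d d' : measure_display} {W : measurableType d}
    {T : measurableType d'} {R : realType} (P : probability W R)
    (m : probability T R) (N : nat) (V : nat -> W -> T) :
  (forall n, (n < N)%N -> measurable_fun setT (V n)) ->
  (forall A : nat -> set T, (forall n, measurable (A n)) ->
     P (\bigcap_(n < N) (V n @^-1` A n)) = (\prod_(n < N) m (A n))%E) ->
  forall (f : nat -> T -> R) (r : nat -> R),
    (forall n, measurable_fun setT (f n)) -> (forall n x, 0 <= f n x) ->
    (forall n, (\int[m]_x (f n x)%:E)%E = (r n)%:E) ->
  (\int[P]_w (\prod_(n < N) f n (V n w))%:E)%E = (\prod_(n < N) r n)%:E.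
Proof.
move=> mV VE f r mf f0 fr.
have m1 (A : set T) : measurable A -> (\int[m]_x (\1_A x)%:E)%E = (fine (m A))%:E.
  by move=> mA; rewrite integral_indic// setIT fineK// fin_num_measure.
have r0 n : 0 <= r n.
  by rewrite -lee_fin -fr; apply: integral_ge0 => x _; rewrite lee_fin.
transitivity (\int[P]_w ((cst 1 w)%:E *
    \prod_(n < N) (\int[m]_x (EFin \o f n) x)))%E; last first.
  under eq_integral => w _ do
    rewrite mul1e (eq_bigr (fun n : 'I_N => (r n)%:E) (fun n _ => fr n)) prodEFin.
  by rewrite integral_cst// [X in (_ * X)%E](probability_setT P) mule1.
transitivity (\int[P]_w (cst 1 w * \prod_(n < N) f n (V n w))%:E)%E.
  by apply: eq_integral => w _; rewrite mul1r.
apply: (@cond_product _ _ W T R P N V (fun h _ => \int[m]_x h x)%E (cst 1) 1) => //.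
- by move=> w; rewrite /cst ler01 lexx.
- move=> wt M mwt wt0.
  have wt0' w : 0 <= wt w by have /andP[] := wt0 w.
  have bwt : bounded_rv wt.
    split=> //; exists M => w; have /andP[wt0w wtM] := wt0 w.
    by rewrite ger0_norm.
  have k0 : 0 <= Rintegral P setT wt by apply: Rintegral_ge0 => w _.
  have [m' mE] := is_integralZ k0 (is_integral_measure m).
  exists m' => h mh h0; rewrite -mE// ge0_integralZr//.
  + by rewrite ExE.
  + exact/measurable_EFinP.
  + by move=> w _; rewrite lee_fin.
  + exact: integral_ge0.
- move=> A mA.
  transitivity (P (\bigcap_(n < N) (V n @^-1` A n))); last first.
    rewrite VE//; under eq_integral do rewrite mul1e.
    rewrite integral_cst// [X in (_ * X)%E](probability_setT P) mule1.
    by apply: eq_bigr => n _; rewrite integral_indic// setIT.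
  transitivity (\int[P]_w (\1_(\bigcap_(n < N) (V n @^-1` A n)) w)%:E)%E; last first.
    rewrite integral_indic ?setIT// bigcap_mkord; apply: bigsetI_measurable => n _.
    by apply: measurable_preimage; [exact: mV|exact: mA].
  apply: eq_integral => w _; rewrite mul1r bigcap_mkord; congr _%:E.
  elim/big_ind2 : _ => [|x X x' X' -> ->|n _]; first by rewrite indicT.
  + by rewrite indicI.
  + by rewrite /= !indicE; congr (_%:R); apply/idP/idP; rewrite !inE.
- move=> A mA; exists (cst (fine (m A))), (fine (m A)); split.
  + exact: measurable_cst.
  + by move=> w; rewrite /= lexx fine_ge0.
  + by move=> w; rewrite m1.
- move=> n; exists (cst (r n)), (r n); split => //.
  + by move=> w; rewrite /= lexx r0.
  + by move=> w; rewrite -fr.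
Qed.

Section kallianpur_striebel.
Local Open Scope ereal_scope.
Context {R : realType} {d p : nat} (psi : 'cV[R]_d -> 'cV[R]_d)
  (H : 'M[R]_(p, d)) (Sigma : 'M[R]_d) (Gamma : 'M[R]_p)
  (mu0 : probability 'cV[R]_d R)
  {dW : measure_display} {W : measurableType dW} (P : probability W R)
  (u xi : nat -> {RV P >-> 'cV[R]_d}) (y eta : nat -> {RV P >-> 'cV[R]_p}).
Variable K : nat.

(** The columns of a matrix as a sequence, continued by 0. *)
Definition col_seq (Y : 'M[R]_(p, K)) (j : nat) : 'cV[R]_p :=
  if insub j is Some i then col (i : 'I_K) Y else 0%R.

Lemma col_seqE (Y : 'M[R]_(p, K)) (j : 'I_K) : col_seq Y j = col j Y.
Proof. by rewrite /col_seq valK. Qed.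

(** The observation noises and the signal up to time K, time j + 1 being in
    column j. *)
Definition noise_matrix (w : W) : 'M[R]_(p, K) :=
  (\matrix_(i, j) eta j.+1 w i ord0)%R.

Definition signal_matrix (w : W) : 'M[R]_(d, K) :=
  (\matrix_(i, j) u j.+1 w i ord0)%R.

Lemma col_noise_matrix j w : col j (noise_matrix w) = eta j.+1 w.
Proof. by apply/matrixP => i k; rewrite mxE mxE (ord1 k). Qed.

Lemma col_signal_matrix j w : col j (signal_matrix w) = u j.+1 w.
Proof. by apply/matrixP => i k; rewrite mxE mxE (ord1 k). Qed.

Lemma measurable_noise_matrix : measurable_fun setT noise_matrix.
Proof.
apply: measurable_mxP => i j; under eq_fun do rewrite mxE.
by apply: measurable_coord; exact: measurable_funP.
Qed.

Lemma measurable_signal_matrix : measurable_fun setT signal_matrix.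
Proof.
apply: measurable_mxP => i j; under eq_fun do rewrite mxE.
by apply: measurable_coord; exact: measurable_funP.
Qed.

(** The density of the law of a + E relative to the law of E, the columns of E
    being independent centred Gaussian with covariance Gamma. *)
Definition shift_density (a M : 'M[R]_(p, K)) : R :=
  (\prod_(j < K) (gauss_exp Gamma (col j M - col j a) / gauss_exp Gamma (col j M)))%R.

Lemma shift_density_ge0 a M : (0 <= shift_density a M)%R.
Proof. by apply: prodr_ge0 => j _; rewrite divr_ge0// ltW// gauss_exp_gt0. Qed.

Lemma measurable_shift_density {d' : measure_display} {T : measurableType d'}
    (a M : T -> 'M[R]_(p, K)) :
  measurable_fun setT a -> measurable_fun setT M ->
  measurable_fun setT (fun t => shift_density (a t) (M t)).
Proof.
move=> ma mM; apply: measurable_prod_cond => j _; apply: measurable_funM.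
  apply: measurable_gauss_exp; apply: measurable_mxD; first exact: measurable_col.
  by apply: measurable_mxN; exact: measurable_col.
by apply: measurable_gauss_expV; exact: measurable_col.
Qed.

(** The products of K events on the columns: a pi-system that generates the
    sigma-algebra of matrices. *)
Definition col_rectangles : set (set 'M[R]_(p, K)) :=
  [set E | exists2 C : nat -> set 'cV[R]_p, forall j, measurable (C j) &
     E = [set M | forall j : 'I_K, C j (col j M)]].

Lemma col_rectangles_measurable : col_rectangles `<=` measurable.
Proof.
move=> _ [C mC ->].
rewrite (_ : [set M | _] = \bigcap_(j in [set: 'I_K]) (col j @^-1` C j)); last first.
  by apply/seteqP; split => M /= h j; [move=> _; exact: h|exact: h].
apply: fin_bigcap_measurable => // j _.
by apply: measurable_preimage; [exact: measurable_col|exact: mC].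
Qed.

Lemma measurable_col_rectangles : @measurable _ 'M[R]_(p, K) = <<s col_rectangles >>.
Proof.
apply/seteqP; split; last first.
  apply: smallest_sub; first exact: sigma_algebra_measurable.
  exact: col_rectangles_measurable.
apply: smallest_sub; first exact: smallest_sigma_algebra.
move=> _ [i [j [B mB ->]]]; apply: sub_sigma_algebra.
exists (fun k : nat => if k == j :> nat then (fun v : 'cV[R]_p => v i ord0) @^-1` B else setT).
  move=> k; case: ifP => // _.
  by apply: measurable_preimage => //; exact: measurable_mx_coord.
apply/seteqP; split => M /=.
  by move=> MB k; case: eqP => // /val_inj ->; rewrite /= mxE.
by move=> /(_ j); rewrite eqxx /= mxE.
Qed.

Lemma col_rectanglesI : setI_closed col_rectangles.
Proof.
move=> _ _ [C mC ->] [C' mC' ->]; exists (fun j => C j `&` C' j).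
  by move=> j; exact: measurableI.
apply/seteqP; split => M /=; first by move=> [h h'] j; split.
by move=> h; split => j; have [] := h j.
Qed.

Hypothesis psi_meas : measurable_fun setT psi.
Hypothesis model : is_model psi H Sigma Gamma mu0 u xi y eta.

Lemma obs_matrixE w : obs_matrix y K w = (H *m signal_matrix w + noise_matrix w)%R.
Proof.
apply/matrixP => i j; rewrite !mxE (model_obs model) !mxE; congr (_ + _)%R.
by apply: eq_bigr => k _; rewrite !mxE.
Qed.

(** The observation noises are independent with the law gG. *)
Lemma noise_indep gG : (forall B, measurable B -> gG B = gaussian Gamma B) ->
  forall (m : nat) (C : nat -> set 'cV[R]_p), (forall k, measurable (C k)) ->
  P (\bigcap_(k < m) (eta k.+1 @^-1` C k)) = \prod_(k < m) gG (C k).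
Proof.
move=> gGE m C mC.
have := model_indep model m measurableT (fun=> measurableT) mC.
rewrite preimage_setT setTI (_ : \bigcap_(k < m) (xi k @^-1` setT) = setT) ?setTI; last first.
  by apply/seteqP; split.
move=> ->; rewrite probability_setT mul1e [X in X * _]big1 ?mul1e//.
by apply: eq_bigr => k _; rewrite gGE// (model_eta model).
Qed.

(** The Cameron-Martin formula for the matrix of noises, tested first on products
    of events, where it reduces to one column at a time. *)
Lemma noise_matrix_shift (a : 'M[R]_(p, K)) (B : set 'M[R]_(p, K)) :
  measurable B ->
  \int[P]_w (\1_B (a + noise_matrix w)%R)%:E =
  \int[P]_w (shift_density a (noise_matrix w) * \1_B (noise_matrix w))%:E.
Proof.
move=> mB.
have [gG [gGG gGE]] := exists_gaussian (gaussian_eta_total model).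
have mN := measurable_noise_matrix.
have ma : measurable_fun setT (fun w => a + noise_matrix w)%R by exact: measurable_mxD.
have [m1 m1E] := measure_pushforward P ma.
have md : measurable_fun setT (fun w => shift_density a (noise_matrix w)).
  exact: measurable_shift_density.
have [m2 m2E] := is_integral_weighted P mN md (fun w => shift_density_ge0 a (noise_matrix w)).
have m1int A : measurable A -> m1 A = \int[P]_w (\1_A (a + noise_matrix w)%R)%:E.
  move=> mA; by rewrite m1E integral_indic_preimage.
have m2int A : measurable A ->
    m2 A = \int[P]_w (shift_density a (noise_matrix w) * \1_A (noise_matrix w))%:E.
  move=> mA; have := m2E (fun M => (\1_A M)%:E).
  rewrite integral_indic// setIT => <-//.
  by apply/measurable_EFinP; exact: measurable_indic.
rewrite -m1int// -m2int//.
apply: (measure_unique col_rectangles (fun=> setT)) => //.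
- exact: measurable_col_rectangles.
- exact: col_rectanglesI.
- by move=> _; exists (fun=> setT) => //; apply/seteqP; split.
- by rewrite bigcup_const//; exists 0%N.
- move=> _ [C mC ->]; set E := [set M | _].
  have mE : measurable E by apply: col_rectangles_measurable; exists C.
  pose aj j := col_seq a j.
  have mt j : measurable_fun setT (fun x : 'cV[R]_p => aj j + x)%R by exact: measurable_mxD.
  transitivity (\prod_(j < K) gG ((fun x => aj j + x)%R @^-1` C j)).
    rewrite m1E -(noise_indep gGE K (C := fun j => (fun x => aj j + x)%R @^-1` C j)); last first.
      by move=> j; exact: measurable_preimage.
    congr (P _); apply/seteqP; split => w /=.
      move=> h j jK; have := h (Ordinal jK).
      by rewrite linearD /= col_noise_matrix /aj (col_seqE a (Ordinal jK)).
    by move=> h j; rewrite linearD /= col_noise_matrix -col_seqE; exact: (h j (ltn_ord j)).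
  rewrite m2int//.
  pose f j (x : 'cV[R]_p) := (gauss_exp Gamma (x - aj j) / gauss_exp Gamma x * \1_(C j) x)%R.
  have f0 j x : (0 <= f j x)%R by rewrite mulr_ge0// divr_ge0// ltW// gauss_exp_gt0.
  have mf j : measurable_fun setT (f j).
    apply: measurable_funM; last exact: measurable_indic.
    apply: measurable_funM; last exact: measurable_gauss_expV.
    by apply: measurable_gauss_exp; exact: measurable_mxD.
  have fint j : \int[gG]_x (f j x)%:E = gG ((fun x => aj j + x)%R @^-1` C j).
    transitivity (\int[gG]_x (\1_(C j) (aj j + x)%R)%:E).
      rewrite (gaussian_translate (f := fun x => (\1_(C j) x)%:E) (aj j) gGG).
      - by apply: eq_integral => x _; rewrite EFinM.
      - by apply/measurable_EFinP; exact: measurable_indic.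
      - by move=> x; rewrite lee_fin.
    exact: integral_indic_preimage.
  pose r j := fine (gG ((fun x => aj j + x)%R @^-1` C j)).
  have rE j : gG ((fun x => aj j + x)%R @^-1` C j) = (r j)%:E.
    by rewrite fineK// fin_num_measure//; exact: measurable_preimage.
  under eq_bigr do rewrite rE; rewrite prodEFin.
  rewrite -(@iid_product _ _ W _ R P gG K (fun j => eta j.+1) _ _ f r)//.
  + apply: eq_integral => w _; congr _%:E.
    rewrite /f big_split /=; congr (_ * _)%R.
      by apply: eq_bigr => j _; rewrite /aj col_seqE col_noise_matrix.
    rewrite indicE; case: (boolP (noise_matrix w \in E)).
      rewrite inE => wE; rewrite big1// => j _.
      by rewrite indicE mem_set//; have := wE j; rewrite col_noise_matrix.
    move=> wE; rewrite mulr0n; apply/eqP/prodf_eq0.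
    have /existsNP[j jC] : ~ (forall j : 'I_K, C j (eta j.+1 w)).
      by move=> h; case/negP: wE; rewrite inE => j; rewrite col_noise_matrix.
    by exists j => //; rewrite indicE memNset.
  + by move=> A mA; exact: noise_indep.
  + by move=> j; rewrite fint rE.
- move=> _; rewrite m1E; apply: (le_lt_trans (probability_le1 P _)); last by rewrite ltry.
  exact: measurable_preimage.
Qed.

End kallianpur_striebel.

Section posterior.
Local Open Scope ereal_scope.
Context {R : realType} {d p : nat} (psi : 'cV[R]_d -> 'cV[R]_d)
  (H : 'M[R]_(p, d)) (Sigma : 'M[R]_d) (Gamma : 'M[R]_p)
  (mu0 : probability 'cV[R]_d R)
  {dW : measure_display} {W : measurableType dW} (P : probability W R)
  (u xi : nat -> {RV P >-> 'cV[R]_d}) (y eta : nat -> {RV P >-> 'cV[R]_p}).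
Variable K : nat.
Hypothesis psi_meas : measurable_fun setT psi.
Hypothesis model : is_model psi H Sigma Gamma mu0 u xi y eta.
Hypothesis Gamma_spd : spd Gamma.

Local Notation Z Y h := (unnorm_filter H Gamma u (col_seq Y) K h).
Local Notation ind A := (fun x => (\1_A x)%:E).
Local Notation E_ := (@noise_matrix R p dW W P eta K).
Local Notation lik := (likelihood H Gamma u).

Lemma unnorm_filter_ge0 z k (h : 'cV[R]_d -> \bar R) : (forall x, 0 <= h x) ->
  0 <= unnorm_filter H Gamma u z k h.
Proof.
move=> h0; apply: integral_ge0 => w _; rewrite mule_ge0// lee_fin.
exact: likelihood_ge0.
Qed.

Lemma unnorm_filter_le1 z k (h : 'cV[R]_d -> \bar R) :
  measurable_fun setT h -> (forall x, 0 <= h x <= 1) ->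
  unnorm_filter H Gamma u z k h <= 1.
Proof.
move=> mh h01; rewrite -[leRHS](probability_setT P) -[leRHS]mul1e -integral_cst//.
have h0 x : 0 <= h x by have /andP[] := h01 x.
apply: ge0_le_integral => //.
- by move=> w _; rewrite mule_ge0// lee_fin likelihood_ge0.
- apply: emeasurable_funM.
    by apply/measurable_EFinP; exact: measurable_likelihood_rv.
  by apply: (measurableT_comp mh); exact: measurable_funP.
- move=> w _; rewrite -[leRHS]mule1; apply: lee_pmul => //.
  + by rewrite lee_fin likelihood_ge0.
  + by rewrite lee_fin likelihood_le1.
  + by have /andP[] := h01 (u k w).
Qed.

Lemma unnorm_filter_fin z k (h : 'cV[R]_d -> \bar R) :
  measurable_fun setT h -> (forall x, 0 <= h x <= 1) ->
  unnorm_filter H Gamma u z k h \is a fin_num.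
Proof.
move=> mh h01; rewrite ge0_fin_numE.
  by apply: le_lt_trans (unnorm_filter_le1 z k mh h01) _; rewrite ltry.
by apply: unnorm_filter_ge0 => x; have /andP[] := h01 x.
Qed.

Lemma unnorm_filter_gt0 z k : 0 < unnorm_filter H Gamma u z k (cst 1).
Proof.
rewrite lt0e unnorm_filter_ge0// andbT; apply/eqP => Z0.
have ml : measurable_fun setT (fun w => (lik z k w)%:E * cst 1 (u k w)).
  apply: emeasurable_funM => //.
  by apply/measurable_EFinP; exact: measurable_likelihood_rv.
have : \int[P]_w `|(lik z k w)%:E * cst 1 (u k w)| = 0.
  rewrite -[RHS]Z0; apply: eq_integral => w _.
  by rewrite gee0_abs// mule_ge0// lee_fin likelihood_ge0.
move/(ae_eq_integral_abs P measurableT ml) => [N [mN N0 sN]].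
have : P setT <= P N.
  apply: le_measure; rewrite ?inE// => w _; apply: sN => /= /(_ Logic.I)/eqP.
  by rewrite mule1 eqe gt_eqF// likelihood_gt0.
by rewrite N0 probability_setT leNgt lte01.
Qed.

Lemma measurable_unnorm_filter (h : 'cV[R]_d -> \bar R) :
  measurable_fun setT h -> (forall x, 0 <= h x) ->
  measurable_fun setT (fun Y : 'M[R]_(p, K) => Z Y h).
Proof.
move=> mh h0.
apply: (@measurable_fun_fubini_tonelli_F _ _ _ _ R P
  (fun t : 'M[R]_(p, K) * W => (lik (col_seq t.1) K t.2)%:E * h (u K t.2))) => //.
- apply: emeasurable_funM.
    apply/measurable_EFinP.
    apply: (@measurable_likelihood _ _ _ H Gamma _ _ K (fun t : 'M[R]_(p, K) * W => col_seq t.1)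
       (fun t j => u j t.2)) => j jK.
      under eq_fun => t do rewrite (col_seqE t.1 (Ordinal jK)).
      by apply: measurable_col; exact: measurable_fst.
    by apply: (measurableT_comp _ measurable_snd); exact: measurable_funP.
  apply: (measurableT_comp mh).
  by apply: (measurableT_comp _ measurable_snd); exact: measurable_funP.
- by move=> t; rewrite mule_ge0// lee_fin likelihood_ge0.
Qed.

(** The reciprocal of the density of the noise, up to a constant. *)
Definition noise_weight (M : 'M[R]_(p, K)) : R :=
  (\prod_(j < K) (gauss_exp Gamma (col j M))^-1)%R.

Lemma noise_weight_gt0 M : (0 < noise_weight M)%R.
Proof. by apply: prodr_gt0 => j _; rewrite invr_gt0 gauss_exp_gt0. Qed.

Lemma measurable_noise_weight : measurable_fun setT noise_weight.
Proof.
apply: measurable_prod_cond => j _; apply: measurable_gauss_expV.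
exact: measurable_col.
Qed.

(** The density of the observations splits into a factor of the noise and the
    likelihood of the signal. *)
Lemma shift_density_signal (M : 'M[R]_(p, K)) w :
  shift_density Gamma (H *m signal_matrix u K w) M =
  (noise_weight M * lik (col_seq M) K w)%R.
Proof.
rewrite /shift_density /noise_weight /likelihood -big_split /=.
apply: eq_bigr => j _; rewrite mulrC col_seqE; congr (_ * gauss_exp _ (_ - _))%R.
by rewrite -(col_signal_matrix u j); apply/matrixP => a b; rewrite !mxE;
  apply: eq_bigr => c _; rewrite !mxE.
Qed.

(** The Kallianpur-Striebel formula: the joint law of the state and of the
    observations has the unnormalized filter as its density relative to a
    weighted law of the noise. *)
Lemma kallianpur_striebel (A : set 'cV[R]_d) (B : set 'M[R]_(p, K)) :
  measurable A -> measurable B ->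
  P (u K @^-1` A `&` obs_matrix y K @^-1` B) =
  \int[P]_w ((\1_B (E_ w) * noise_weight (E_ w))%:E * Z (E_ w) (ind A)).
Proof.
move=> mA mB.
have mE : measurable_fun setT E_ := @measurable_noise_matrix _ _ _ _ P eta K.
have mS : measurable_fun setT (signal_matrix u K) := @measurable_signal_matrix _ _ _ _ P u K.
have mHS : measurable_fun setT (fun w => H *m signal_matrix u K w)%R.
  exact: measurable_mxM.
have mO : measurable_fun setT (obs_matrix y K).
  by rewrite (_ : obs_matrix y K = fun w => H *m signal_matrix u K w + E_ w)%R;
    [exact: measurable_mxD|apply/funext => w; exact: (obs_matrixE K model)].
pose X w := (signal_matrix u K w, u K w).
have mX : measurable_fun setT X by apply: measurable_fun_pair => //; exact: measurable_funP.
pose F (t : ('M[R]_(d, K) * 'cV[R]_d) * 'M[R]_(p, K)) : \bar R :=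
  (\1_A t.1.2 * \1_B (H *m t.1.1 + t.2)%R)%:E.
have mF : measurable_fun setT F.
  apply/measurable_EFinP; apply: measurable_funM.
    apply: (@measurableT_comp _ _ _ _ _ _ (\1_A : _ -> R)); first exact: measurable_indic.
    by apply: (measurableT_comp measurable_snd); exact: measurable_fst.
  apply: (@measurableT_comp _ _ _ _ _ _ (\1_B : _ -> R)); first exact: measurable_indic.
  apply: measurable_mxD; last exact: measurable_snd.
  apply: measurable_mxM => //.
  by apply: (measurableT_comp measurable_fst); exact: measurable_fst.
have F0 t : 0 <= F t by rewrite lee_fin mulr_ge0.
pose Em : {mfun W >-> 'M[R]_(p, K)} := mfun_Sub (mem_set mE).
transitivity (\int[P]_w F (X w, E_ w)).
  transitivity (\int[P]_w (\1_(u K @^-1` A `&` obs_matrix y K @^-1` B) w)%:E).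
    rewrite integral_indic ?setIT//; apply: measurableI.
      by apply: measurable_preimage => //; exact: measurable_funP.
    exact: measurable_preimage.
  apply: eq_integral => w _; rewrite indicI /F /X /= -(obs_matrixE K model).
  by rewrite /= !indicE; congr ((_%:R * _%:R)%:E); apply/idP/idP; rewrite !inE.
rewrite (@integral_indep _ _ _ _ _ _ _ P X E_ (distribution P Em))//; last first.
  move=> A' B' mA' mB'; rewrite /distribution /pushforward /=.
  apply: (signal_eta_indep model (m := K)).
    apply: measurable_wrt_preimage mA'; apply: measurable_fun_pair.
      apply: measurable_mxP => i j; under eq_fun do rewrite mxE.
      by apply: measurable_coord; exact: (signal_wrt psi_meas model).
    exact: (signal_wrt psi_meas model).
  apply: measurable_wrt_preimage mB'.
  apply: measurable_mxP => i j; under eq_fun do rewrite mxE.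
  apply: (@measurable_coord _ _ (g_sigma_algebraType (noise_events eta K))).
  exact: eta_wrt.
(* Two independent copies of the randomness: the first carries the signal, the
   second the noise. *)
pose G (t : W * W) : \bar R :=
  ((\1_B (E_ t.2) * noise_weight (E_ t.2))%:E * ((lik (col_seq (E_ t.2)) K t.1)%:E * (\1_A (u K t.1))%:E)).
have mE2 : measurable_fun setT (fun t : W * W => E_ t.2).
  exact: (measurableT_comp mE measurable_snd).
have mG : measurable_fun setT G.
  apply: emeasurable_funM.
    apply/measurable_EFinP; apply: measurable_funM.
      by apply: (@measurableT_comp _ _ _ _ _ _ (\1_B : _ -> R)); first exact: measurable_indic.
    by apply: (measurableT_comp measurable_noise_weight).
  apply: emeasurable_funM; apply/measurable_EFinP.
    apply: (@measurable_likelihood _ _ _ H Gamma _ _ K (fun t : W * W => col_seq (E_ t.2))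
       (fun t j => u j t.1)) => j jK.
      under eq_fun => t do rewrite (col_seqE (E_ t.2) (Ordinal jK)).
      exact: measurable_col.
    by apply: (measurableT_comp _ measurable_fst); exact: measurable_funP.
  apply: (@measurableT_comp _ _ _ _ _ _ (\1_A : _ -> R)); first exact: measurable_indic.
  by apply: (measurableT_comp _ measurable_fst); exact: measurable_funP.
have G0 t : 0 <= G t.
  rewrite /G !mule_ge0// lee_fin ?likelihood_ge0//.
  by rewrite mulr_ge0// ltW// noise_weight_gt0.
transitivity (\int[P]_w \int[P]_w' G (w, w')).
  apply: eq_integral => w _.
  rewrite ge0_integral_distribution//; last first.
    by apply: (measurableT_comp mF); exact: measurable_fun_pair.
  transitivity ((\1_A (u K w))%:E * \int[P]_w' (\1_B (H *m signal_matrix u K w + E_ w')%R)%:E).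
    rewrite -[RHS]ge0_integralZl//; apply/measurable_EFinP.
    apply: (@measurableT_comp _ _ _ _ _ _ (\1_B : _ -> R)); first exact: measurable_indic.
    exact: measurable_mxD.
  rewrite (noise_matrix_shift model)// -[LHS]ge0_integralZl//.
  - apply: eq_integral => w' _; rewrite /G /= shift_density_signal -!EFinM; congr _%:E.
    by ring.
  - apply/measurable_EFinP; apply: measurable_funM.
      by apply: measurable_shift_density => //; exact: measurable_cst.
    by apply: (@measurableT_comp _ _ _ _ _ _ (\1_B : _ -> R)); first exact: measurable_indic.
  - by move=> w' _; rewrite lee_fin mulr_ge0// shift_density_ge0.
rewrite -[LHS](fubini_tonelli1 (m1 := P) (m2 := P) G mG G0) (fubini_tonelli2 (m1 := P) (m2 := P) G mG G0).
apply: eq_integral => w _; rewrite /fubini_G /G /= ge0_integralZl//.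
- apply: emeasurable_funM; apply/measurable_EFinP; first exact: measurable_likelihood_rv.
  apply: (@measurableT_comp _ _ _ _ _ _ (\1_A : _ -> R)); first exact: measurable_indic.
  exact: measurable_funP.
- by move=> w' _; rewrite mule_ge0// lee_fin ?likelihood_ge0.
- by rewrite lee_fin mulr_ge0// ltW// noise_weight_gt0.
Qed.

End posterior.

(** * Bayes' formula for a conditional law *)

Section posterior_version.
Local Open Scope ereal_scope.
Context {R : realType} {d p : nat} (psi : 'cV[R]_d -> 'cV[R]_d)
  (H : 'M[R]_(p, d)) (Sigma : 'M[R]_d) (Gamma : 'M[R]_p)
  (mu0 : probability 'cV[R]_d R)
  {dW : measure_display} {W : measurableType dW} (P : probability W R)
  (u xi : nat -> {RV P >-> 'cV[R]_d}) (y eta : nat -> {RV P >-> 'cV[R]_p}).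
Variable K : nat.
Hypothesis psi_meas : measurable_fun setT psi.
Hypothesis model : is_model psi H Sigma Gamma mu0 u xi y eta.
Hypothesis Gamma_spd : spd Gamma.

Local Notation Z Y h := (unnorm_filter H Gamma u (col_seq Y) K h).
Local Notation ind A := (fun x => (\1_A x)%:E).
Local Notation E_ := (@noise_matrix R p dW W P eta K).

(** The probability of A under the filter given by Bayes' formula. *)
Definition bayes_filter (Y : 'M[R]_(p, K)) (A : set 'cV[R]_d) : R :=
  (fine (Z Y (ind A)) / fine (Z Y (cst 1%E)))%R.

Lemma ind01 (A : set 'cV[R]_d) x : 0 <= (\1_A x : R)%:E <= 1.
Proof. by rewrite !lee_fin indicE ler0n lern1 leq_b1. Qed.

Lemma measurable_ind (A : set 'cV[R]_d) : measurable A ->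
  measurable_fun setT (fun x => (\1_A x : R)%:E).
Proof. by move=> mA; apply/measurable_EFinP; exact: measurable_indic. Qed.

Lemma unnorm_ind_fin (Y : 'M[R]_(p, K)) (A : set 'cV[R]_d) : measurable A -> Z Y (ind A) \is a fin_num.
Proof.
move=> mA; apply: unnorm_filter_fin => //; first exact: measurable_ind.
exact: ind01.
Qed.

Lemma unnorm_1_fin z k : unnorm_filter H Gamma u z k (cst 1%E) \is a fin_num.
Proof. by apply: unnorm_filter_fin => // x /=; rewrite lexx lee01. Qed.

Lemma fine_unnorm_1_gt0 z k : (0 < fine (unnorm_filter H Gamma u z k (cst 1%E)))%R.
Proof.
rewrite fine_gt0// unnorm_filter_gt0 -ge0_fin_numE ?unnorm_1_fin//.
exact: unnorm_filter_ge0.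
Qed.

Lemma unnorm_ind_ge0 (Y : 'M[R]_(p, K)) (A : set 'cV[R]_d) : 0 <= Z Y (ind A).
Proof. by apply: unnorm_filter_ge0 => x; have /andP[] := ind01 A x. Qed.

Lemma bayes_filter_ge0 Y A : (0 <= bayes_filter Y A)%R.
Proof.
rewrite divr_ge0//; last exact/ltW/fine_unnorm_1_gt0.
by rewrite fine_ge0// unnorm_ind_ge0.
Qed.

Lemma measurable_bayes_filter A : measurable A ->
  measurable_fun setT (bayes_filter ^~ A).
Proof.
move=> mA; apply: measurable_funM.
  apply: measurableT_comp => //; apply: measurable_unnorm_filter.
    exact: measurable_ind.
  by move=> x; have /andP[] := ind01 A x.
apply: measurable_fun_gt0V; last by move=> Y; exact: fine_unnorm_1_gt0.
by apply: measurableT_comp => //; exact: measurable_unnorm_filter.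
Qed.

Lemma measurable_obs_matrix : measurable_fun setT (obs_matrix y K).
Proof.
apply: measurable_mxP => i j; under eq_fun do rewrite mxE.
by apply: measurable_coord; exact: measurable_funP.
Qed.

(** The law of the observations has a positive density relative to that of the
    noise. *)
Lemma integral_obs (G : 'M[R]_(p, K) -> \bar R) :
  measurable_fun setT G -> (forall Y, 0 <= G Y) ->
  \int[P]_w G (obs_matrix y K w) =
  \int[P]_w ((noise_weight Gamma (E_ w) * fine (Z (E_ w) (cst 1%E)))%:E * G (E_ w)).
Proof.
have mE : measurable_fun setT E_ := @measurable_noise_matrix _ _ _ _ P eta K.
pose dens w := (noise_weight Gamma (E_ w) * fine (Z (E_ w) (cst 1%E)))%R.
have mdens : measurable_fun setT dens.
  apply: measurable_funM.
    exact: (measurableT_comp (@measurable_noise_weight _ _ Gamma K)).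
  apply: measurableT_comp => //.
  apply: (@measurableT_comp _ _ _ _ _ _ (fun Y => Z Y (cst 1%E))) => //.
  exact: measurable_unnorm_filter.
have dens0 w : (0 <= dens w)%R.
  by rewrite mulr_ge0// ltW// ?noise_weight_gt0 ?fine_unnorm_1_gt0.
move=> mG G0.
apply: (@is_integral_ext _ _ _ (fun G => \int[P]_w G (obs_matrix y K w))
  (fun G => \int[P]_w ((dens w)%:E * G (E_ w)))) => //.
- have [m mI] := is_integral_pushforward measurable_obs_matrix (is_integral_measure P).
  by exists m => h mh h0; rewrite -mI.
- exact: is_integral_weighted.
- move=> B mB; rewrite (integral_indic_preimage P measurable_obs_matrix mB).
  have := kallianpur_striebel psi_meas model measurableT mB.
  rewrite preimage_setT setTI => KS; apply: (etrans KS); apply: eq_integral => w _.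
  have -> : ind (setT : set 'cV[R]_d) = cst 1%E :> ('cV[R]_d -> \bar R).
    by apply/funext => x; rewrite indicT.
  rewrite -{1}(fineK (unnorm_1_fin _ _)) -!EFinM /dens; congr _%:E.
  by ring.
Qed.

Variable mu : R.-pker 'M[R]_(p, K) ~> 'cV[R]_d.
Hypothesis mu_cond : is_cond_law P (u K) (obs_matrix y K) mu.

Let Om : {mfun W >-> 'M[R]_(p, K)} := mfun_Sub (mem_set measurable_obs_matrix).

(** For each event, a conditional law agrees with Bayes' formula for almost
    every value of the observations. *)
Lemma cond_law_bayes A : measurable A ->
  {ae distribution P Om, forall Y, mu Y A = (bayes_filter Y A)%:E}.
Proof.
move=> mA.
have mmu : measurable_fun setT (mu ^~ A) by exact: measurable_kernel.
have mbay : measurable_fun setT (fun Y => (bayes_filter Y A)%:E).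
  by apply/measurable_EFinP; exact: measurable_bayes_filter.
have : ae_eq (distribution P Om) setT (mu ^~ A) (fun Y => (bayes_filter Y A)%:E).
  apply: integral_ae_eq => //.
    apply/integrableP; split => //.
    apply: (@le_lt_trans _ _ (\int[distribution P Om]_Y (cst 1%E Y))); last first.
      by rewrite integral_cst// mul1e [X in X < _]probability_setT ltry.
    apply: ge0_le_integral => //; first exact: measurableT_comp.
    move=> Y _; rewrite gee0_abs//; apply: le_trans _ (sprob_kernel_le1 mu Y).
    by apply: le_measure; rewrite ?inE.
  move=> B _ mB.
  have mE : measurable_fun setT E_ := @measurable_noise_matrix _ _ _ _ P eta K.
  rewrite !(ge0_integral_pushforward measurable_obs_matrix)//; first last.
  - exact: measurable_funTS.
  - by move=> Y _; rewrite lee_fin bayes_filter_ge0.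
  - exact: measurable_funTS.
  transitivity (P (u K @^-1` A `&` obs_matrix y K @^-1` B)).
    by rewrite mu_cond.
  rewrite (kallianpur_striebel psi_meas model mA mB).
  rewrite integral_mkcond.
  transitivity (\int[P]_w ((\1_B (obs_matrix y K w))%:E * (bayes_filter (obs_matrix y K w) A)%:E)); last first.
    apply: eq_integral => w _; rewrite patchE /= indicE.
    rewrite (_ : (w \in _) = (obs_matrix y K w \in B)); last by apply/idP/idP; rewrite !inE.
    by case: ifP => _; rewrite ?mul1e ?mul0e.
  rewrite (integral_obs (G := fun Y => (\1_B Y)%:E * (bayes_filter Y A)%:E)); first last.
  - by move=> Y; rewrite mule_ge0// lee_fin// bayes_filter_ge0.
  - by apply: emeasurable_funM => //; apply/measurable_EFinP; exact: measurable_indic.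
  apply: eq_integral => w _.
  rewrite -(fineK (unnorm_ind_fin (E_ w) mA)) -!EFinM; congr _%:E.
  have Z0 : fine (Z (E_ w) (cst 1%E)) != 0%R by rewrite gt_eqF// fine_unnorm_1_gt0.
  by rewrite /bayes_filter; field.
move=> [N [mN N0 sN]]; exists N; split => // Y h; apply: sN => /= h'; apply: h.
exact: h'.
Qed.

End posterior_version.

(** * Agreement for almost every value of the observations *)

(** The rational lower orthants form a countable pi-system that generates the
    sigma-algebra of column vectors. *)
Section rational_orthants.
Context {R : realType} (n : nat).

(** The lower orthant with vertex q. *)
Definition orthant (q : {ffun 'I_n -> rat}) : set 'cV[R]_n :=
  [set x | forall i, x i ord0 < ratr (q i)].

Definition orthants : set (set 'cV[R]_n) := range orthant.

Lemma orthantsI : setI_closed orthants.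
Proof.
move=> _ _ [q _ <-] [q' _ <-]; exists [ffun i => Num.min (q i) (q' i)] => //.
apply/seteqP; split => x /=.
  move=> h; split => i; have := h i; rewrite ffunE => xq; apply: (lt_le_trans xq);
    by rewrite ler_rat ge_min lexx ?orbT.
move=> [h h'] i; rewrite ffunE.
by have [_|_] := leP (q i) (q' i); [exact: h|exact: h'].
Qed.

Lemma orthant_measurable q : measurable (orthant q).
Proof.
rewrite (_ : orthant q = \bigcap_(i in [set: 'I_n])
    ((fun x : 'cV[R]_n => x i ord0) @^-1` `]-oo, ratr (q i)[%classic)).
  apply: fin_bigcap_measurable => // i _.
  by apply: measurable_preimage; [exact: measurable_mx_coord|exact: measurable_itv].
apply/seteqP; split => x /= h i; first by move=> _; rewrite /= in_itv /=.
by have := h i Logic.I; rewrite /= in_itv.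
Qed.

Lemma measurable_orthants : @measurable _ 'cV[R]_n = <<s orthants>>.
Proof.
apply/seteqP; split; last first.
  apply: smallest_sub; first exact: sigma_algebra_measurable.
  by move=> _ [q _ <-]; exact: orthant_measurable.
apply: smallest_sub; first exact: smallest_sigma_algebra.
move=> _ [i [j [B mB ->]]].
have : @measurable_fun _ _ (g_sigma_algebraType orthants) R setT
    (fun x : 'cV[R]_n => x i j).
  apply: (@measurability _ _ (g_sigma_algebraType orthants) R setT
    (fun x : 'cV[R]_n => x i j) (@RGenInftyO.G R)).
    exact: RGenInftyO.measurableE.
  move=> _ [_ [r ->] <-]; rewrite setTI.
  rewrite (_ : _ @^-1` _ = \bigcup_(q in [set q : {ffun 'I_n -> rat} | ratr (q i) <= r]) orthant q).
    rewrite bigcup_mkcond; apply: countable_bigcupT_measurable.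
      exact: countableP.
    move=> q; case: ifP => _; last exact: measurable0.
    by apply: sub_sigma_algebra; exists q.
  apply/seteqP; split => x /=; rewrite in_itv /= (ord1 j).
    (* The vertex is below r in coordinate i and above x in all of them. *)
    move=> xr; have above k : exists q : rat, x k ord0 < ratr q /\ (k = i -> ratr q <= r).
      have [ki|ki] := eqVneq k i.
        rewrite ki; have [q] := rat_in_itvoo xr.
        by rewrite in_itv /= => /andP[xq qr]; exists q; split => // _; exact: ltW.
      have /rat_in_itvoo[q] : x k ord0 < x k ord0 + 1 by rewrite ltrDl.
      rewrite in_itv /= => /andP[xq _]; exists q; split => // ki'.
      by rewrite ki' eqxx in ki.
    have [q qE] := choice above.
    exists (finfun q) => /=; first by rewrite ffunE; have [_] := qE i; exact.
    by move=> k; rewrite ffunE; have [] := qE k.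
  by move=> [q /= qr xq]; exact: lt_le_trans (xq i) qr.
by move=> /(_ measurableT B mB); rewrite setTI.
Qed.

Lemma eq_measure_orthants (m m' : {measure set 'cV[R]_n -> \bar R}) :
  (m setT < +oo)%E -> (forall q, m (orthant q) = m' (orthant q)) ->
  forall A, measurable A -> m A = m' A.
Proof.
move=> moo mE A mA.
apply: (measure_unique orthants (fun k => orthant [ffun=> k%:R])) => //.
- exact: measurable_orthants.
- exact: orthantsI.
- by move=> k; exists [ffun=> k%:R].
- apply/seteqP; split => // x _.
  exists (\max_(i < n) (Num.trunc `|x i ord0|).+1)%N => // i; rewrite ffunE ratr_nat.
  apply: (le_lt_trans (ler_norm _)); apply: (lt_le_trans (truncnS_gt _)).
  by rewrite ler_nat; exact: (@leq_bigmax _ (fun i : 'I_n => (Num.trunc `|x i ord0|).+1) i).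
- by move=> _ [q _ <-].
- move=> k; apply: le_lt_trans moo; apply: le_measure; rewrite ?inE//.
  exact: orthant_measurable.
Qed.

End rational_orthants.

Section posterior_measure.
Local Open Scope ereal_scope.
Context {R : realType} {d p : nat} (psi : 'cV[R]_d -> 'cV[R]_d)
  (H : 'M[R]_(p, d)) (Sigma : 'M[R]_d) (Gamma : 'M[R]_p)
  (mu0 : probability 'cV[R]_d R)
  {dW : measure_display} {W : measurableType dW} (P : probability W R)
  (u xi : nat -> {RV P >-> 'cV[R]_d}) (y eta : nat -> {RV P >-> 'cV[R]_p}).
Variable K : nat.
Hypothesis psi_meas : measurable_fun setT psi.
Hypothesis model : is_model psi H Sigma Gamma mu0 u xi y eta.
Hypothesis Gamma_spd : spd Gamma.

Lemma bayes_filter_measure (Y : 'M[R]_(p, K)) :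
  exists m : {measure set 'cV[R]_d -> \bar R},
    (forall A, measurable A -> m A = (bayes_filter H Gamma u Y A)%:E) /\
    forall h : 'cV[R]_d -> \bar R, measurable_fun setT h -> (forall x, 0 <= h x) ->
      \int[m]_x h x = ((fine (unnorm_filter H Gamma u (col_seq Y) K (cst 1%E)))^-1)%:E
                      * unnorm_filter H Gamma u (col_seq Y) K h.
Proof.
have Z0 := fine_unnorm_1_gt0 (P := P) H u Gamma_spd (col_seq Y) K.
have iZ0 : (0 <= (fine (unnorm_filter H Gamma u (col_seq Y) K (cst 1%E)))^-1)%R.
  by rewrite invr_ge0 ltW.
have [m mI] := is_integralZ iZ0 (is_integral_weighted P (@measurable_funPT _ _ _ _ (u K))
  (measurable_likelihood_rv H Gamma u (col_seq Y) K)
  (fun w => likelihood_ge0 H Gamma u (col_seq Y) K w)).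
exists m; split; last by move=> h mh h0; rewrite -mI.
move=> A mA; have := mI (fun x => (\1_A x)%:E) (measurable_ind mA).
rewrite integral_indic// setIT => <-; last first.
  by move=> x; have /andP[] := ind01 (R := R) A x.
rewrite /bayes_filter EFinM muleC; congr (_ * _).
by rewrite fineK//; exact: unnorm_ind_fin.
Qed.

(** A conditional law is Bayes' filter, as a measure, for almost every value of
    the observations. *)
Lemma cond_law_bayes_ae (mu : R.-pker 'M[R]_(p, K) ~> 'cV[R]_d) :
  is_cond_law P (u K) (obs_matrix y K) mu ->
  {ae P, forall w A, measurable A ->
    mu (obs_matrix y K w) A = (bayes_filter H Gamma u (obs_matrix y K w) A)%:E}.
Proof.
move=> mu_cond.
(* An enumeration of the rational vertices, padded by 0. *)
pose q k := odflt [ffun=> 0%R] (unpickle k : option {ffun 'I_d -> rat}).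
have := ae_foralln (fun k => cond_law_bayes psi_meas model Gamma_spd mu_cond
  (orthant_measurable (R := R) (q k))).
move=> [N [mN N0 sN]].
exists (obs_matrix y K @^-1` N); split => //.
  apply: measurable_preimage mN; exact: measurable_obs_matrix.
move=> w; apply: contra_notP => /= wN A mA.
have muq (r : {ffun 'I_d -> rat}) :
    mu (obs_matrix y K w) (orthant r) = (bayes_filter H Gamma u (obs_matrix y K w) (orthant r))%:E.
  have : forall k, mu (obs_matrix y K w) (orthant (q k)) =
      (bayes_filter H Gamma u (obs_matrix y K w) (orthant (q k)))%:E.
    by apply: contra_notP wN => h; apply: sN.
  by move=> /(_ (pickle r)); rewrite /q pickleK.
have [m [mE _]] := bayes_filter_measure (obs_matrix y K w).
rewrite -mE//; apply: eq_measure_orthants => //.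
  by apply: le_lt_trans (sprob_kernel_le1 mu _) _; rewrite ltry.
by move=> r; rewrite mE ?muq//; exact: orthant_measurable.
Qed.

End posterior_measure.

(** * Agreement for continuous versions *)

Section matrix_convergence.
Context {R : realType}.

Lemma cvg_seq_sum I (r : seq I) (f : I -> nat -> R) (l : I -> R) :
  (forall i, f i n @[n --> \oo] --> l i) ->
  \sum_(i <- r) f i n @[n --> \oo] --> \sum_(i <- r) l i.
Proof.
move=> fl; elim: r => [|a r IH].
  by under eq_fun do rewrite big_nil; rewrite big_nil; exact: cvg_cst.
by under eq_fun do rewrite big_cons; rewrite big_cons; apply: cvgD; [exact: fl|exact: IH].
Qed.

Lemma cvg_seq_prod I (r : seq I) (f : I -> nat -> R) (l : I -> R) :
  (forall i, f i n @[n --> \oo] --> l i) ->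
  \prod_(i <- r) f i n @[n --> \oo] --> \prod_(i <- r) l i.
Proof.
move=> fl; elim: r => [|a r IH].
  by under eq_fun do rewrite big_nil; rewrite big_nil; exact: cvg_cst.
by under eq_fun do rewrite big_cons; rewrite big_cons; apply: cvgM; [exact: fl|exact: IH].
Qed.

Lemma cvg_gauss_exp n (A : 'M[R]_n) (x : nat -> 'cV[R]_n) (l : 'cV[R]_n) :
  (forall i, x k i ord0 @[k --> \oo] --> l i ord0) ->
  gauss_exp A (x k) @[k --> \oo] --> gauss_exp A l.
Proof.
move=> xl; rewrite /gauss_exp; apply: continuous_cvg; first exact: continuous_expR.
apply: cvgN; apply: cvgMl; rewrite /mnorm2.
under eq_fun do rewrite mxE; rewrite mxE.
apply: cvg_seq_sum => j; apply: cvgM; last exact: xl.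
under eq_fun do rewrite mxE; rewrite mxE.
apply: cvg_seq_sum => i; apply: cvgMl.
by under eq_fun do rewrite mxE; rewrite mxE; exact: xl.
Qed.

End matrix_convergence.

Section continuous_posterior.
Local Open Scope ereal_scope.
Context {R : realType} {d p : nat} (psi : 'cV[R]_d -> 'cV[R]_d)
  (H : 'M[R]_(p, d)) (Sigma : 'M[R]_d) (Gamma : 'M[R]_p)
  (mu0 : probability 'cV[R]_d R)
  {dW : measure_display} {W : measurableType dW} (P : probability W R)
  (u xi : nat -> {RV P >-> 'cV[R]_d}) (y eta : nat -> {RV P >-> 'cV[R]_p}).
Variable K : nat.
Hypothesis psi_meas : measurable_fun setT psi.
Hypothesis model : is_model psi H Sigma Gamma mu0 u xi y eta.
Hypothesis Gamma_spd : spd Gamma.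

Local Notation Z Y h := (unnorm_filter H Gamma u (col_seq Y) K h).
Local Notation ind A := (fun x => (\1_A x)%:E).
Local Notation E_ := (@noise_matrix R p dW W P eta K).

(** The unnormalized filter is sequentially continuous in the observations. *)
Lemma cvg_unnorm_filter (Y : nat -> 'M[R]_(p, K)) (L : 'M[R]_(p, K))
    (h : 'cV[R]_d -> R) :
  (forall i j, Y n i j @[n --> \oo] --> L i j) ->
  measurable_fun setT h -> (forall x, 0 <= h x <= 1)%R ->
  fine (Z (Y n) (EFin \o h)) @[n --> \oo] --> fine (Z L (EFin \o h)).
Proof.
move=> YL mh h01.
have mlik M : measurable_fun setT (fun w => (likelihood H Gamma u M K w)%:E * (h (u K w))%:E).
  apply: emeasurable_funM; apply/measurable_EFinP; first exact: measurable_likelihood_rv.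
  by apply: (measurableT_comp mh); exact: measurable_funP.
have := @dominated_convergence _ _ R P setT measurableT
  (fun n w => (likelihood H Gamma u (col_seq (Y n)) K w)%:E * (h (u K w))%:E)
  (fun w => (likelihood H Gamma u (col_seq L) K w)%:E * (h (u K w))%:E)
  (cst 1).
case => //.
- apply: aeW => w _.
  rewrite -EFinM; under eq_fun do rewrite -EFinM.
  apply: cvg_EFin; first exact: nearW.
  apply: cvgMl; rewrite /likelihood.
  apply: cvg_seq_prod => j.
  apply: cvg_gauss_exp => i; rewrite !mxE; under eq_fun do rewrite !mxE.
  apply: cvgB; last exact: cvg_cst.
  by rewrite col_seqE !mxE; under eq_fun do rewrite col_seqE !mxE; exact: YL.
- apply/integrableP; split; first exact: measurable_cst.
  under eq_integral do rewrite /= normr1.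
  by rewrite integral_cst// mul1e [X in X < _](probability_setT P) ltry.
- apply: aeW => w n _.
  have /andP[h0 h1] := h01 (u K w).
  rewrite -EFinM /= lee_fin ger0_norm ?mulr_ge0 ?likelihood_ge0//.
  by rewrite mulr_ile1 ?likelihood_ge0 ?likelihood_le1.
move=> _ _ cv; apply: fine_cvg; move: cv.
rewrite fineK//; apply: unnorm_filter_fin => //.
exact/measurable_EFinP.
Qed.

Lemma cvg_bayes_filter (Y : nat -> 'M[R]_(p, K)) (L : 'M[R]_(p, K)) A :
  (forall i j, Y n i j @[n --> \oo] --> L i j) -> measurable A ->
  bayes_filter H Gamma u (Y n) A @[n --> \oo] --> bayes_filter H Gamma u L A.
Proof.
move=> YL mA; rewrite /bayes_filter; apply: cvgM.
  apply: (cvg_unnorm_filter (h := \1_A)) => //.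
  by move=> x; rewrite indicE ler0n lern1 leq_b1.
apply: cvgV; first by rewrite gt_eqF// fine_unnorm_1_gt0.
apply: (cvg_unnorm_filter (h := cst 1%R)) => //.
by move=> x /=; rewrite ler01 lexx.
Qed.

(** The open box of centre Y and half-width e. *)
Definition mx_box (Y : 'M[R]_(p, K)) (e : R) : set 'M[R]_(p, K) :=
  [set M | forall i j, `|Y i j - M i j| < e]%R.

Lemma mx_box_rectangle Y e : mx_box Y e =
  [set M | forall j : 'I_K, [set x : 'cV[R]_p |
     forall i, `|col_seq Y j i ord0 - x i ord0| < e]%R (col j M)].
Proof.
apply/seteqP; split => M /= h.
  by move=> j i; have := h i j; rewrite col_seqE !mxE.
by move=> i j; have := h j i; rewrite col_seqE !mxE.
Qed.

Lemma mx_box_measurable Y e : measurable (mx_box Y e).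
Proof.
rewrite mx_box_rectangle; apply: col_rectangles_measurable.
by exists (fun j => [set x : 'cV[R]_p | forall i, `|col_seq Y j i ord0 - x i ord0| < e]%R) => // j;
  exact: cV_box_measurable.
Qed.

Lemma noise_box_gt0 Y (e : R) : (0 < e)%R -> 0 < P (E_ @^-1` mx_box Y e).
Proof.
move=> e0.
have [gG [gGG gGE]] := exists_gaussian (gaussian_eta_total model).
pose C j := [set x : 'cV[R]_p | forall i, `|col_seq Y j i ord0 - x i ord0| < e]%R.
have -> : E_ @^-1` mx_box Y e = \bigcap_(k < K) (eta k.+1 @^-1` C k).
  rewrite mx_box_rectangle; apply/seteqP; split => w /= h.
    by move=> j jK; have := h (Ordinal jK); rewrite col_noise_matrix.
  by move=> j; rewrite col_noise_matrix; exact: (h j (ltn_ord j)).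
rewrite (noise_indep model gGE); last by move=> k; exact: cV_box_measurable.
have gfin j : gG (C j) = (fine (gG (C j)))%:E.
  by rewrite fineK// fin_num_measure//; exact: cV_box_measurable.
under eq_bigr do rewrite gfin.
rewrite prodEFin lte_fin; apply: prodr_gt0 => j _.
rewrite -lte_fin -gfin; exact: (gaussian_box_gt0 (col_seq Y j) gGG e0).
Qed.

(** The law of the observations charges every box. *)
Lemma obs_box_gt0 Y (e : R) : (0 < e)%R -> 0 < P (obs_matrix y K @^-1` mx_box Y e).
Proof.
move=> e0; have mB := mx_box_measurable Y e.
rewrite lt0e measure_ge0 andbT; apply/eqP => PB0.
have mE : measurable_fun setT E_ := @measurable_noise_matrix _ _ _ _ P eta K.
have mo : measurable_fun setT (obs_matrix y K) := @measurable_obs_matrix _ _ _ _ P y K.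
pose G w : \bar R := ((noise_weight Gamma (E_ w) * fine (Z (E_ w) (cst 1%E)))%:E * (\1_(mx_box Y e) (E_ w))%:E).
have G0 w : 0 <= G w.
  by rewrite mule_ge0// lee_fin mulr_ge0// ltW// ?noise_weight_gt0 ?fine_unnorm_1_gt0.
have mG : measurable_fun setT G.
  apply: emeasurable_funM; apply/measurable_EFinP.
    apply: measurable_funM.
      exact: (measurableT_comp (@measurable_noise_weight _ _ Gamma K)).
    apply: measurableT_comp => //.
    apply: (@measurableT_comp _ _ _ _ _ _ (fun Y => Z Y (cst 1%E))) => //.
    exact: measurable_unnorm_filter.
  by apply: (@measurableT_comp _ _ _ _ _ _ (\1_(mx_box Y e) : _ -> R)) => //; exact: measurable_indic.
have : \int[P]_w `|G w| = 0.
  under eq_integral do rewrite gee0_abs//.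
  rewrite /G -(integral_obs psi_meas model Gamma_spd (G := fun M => (\1_(mx_box Y e) M)%:E)).
  - by rewrite integral_indic_preimage.
  - by apply/measurable_EFinP; exact: measurable_indic.
  - by move=> M; rewrite lee_fin.
move/(ae_eq_integral_abs P measurableT mG) => [N [mN N0 sN]].
have := noise_box_gt0 Y e0; rewrite ltNge => /negP; apply.
rewrite -N0; apply: le_measure; rewrite ?inE//; first exact: measurable_preimage.
move=> w wB; apply: sN => /= /(_ Logic.I)/eqP.
rewrite /G indicE mem_set// mule1 eqe gt_eqF//.
by rewrite mulr_gt0 ?noise_weight_gt0 ?fine_unnorm_1_gt0.
Qed.

(** A version of the conditional law that is continuous in the observations is
    Bayes' filter everywhere. *)
Lemma cond_law_bayes_continuous (mu : R.-pker 'M[R]_(p, K) ~> 'cV[R]_d) :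
  is_cond_law P (u K) (obs_matrix y K) mu -> continuous_version mu ->
  forall Y A, measurable A -> mu Y A = (bayes_filter H Gamma u Y A)%:E.
Proof.
move=> mu_cond mu_cont Y A mA.
have [N [mN N0 sN]] := cond_law_bayes psi_meas model Gamma_spd mu_cond mA.
have near_pt n : exists M, mx_box Y n.+1%:R^-1 M /\ mu M A = (bayes_filter H Gamma u M A)%:E.
  apply: contrapT => /forallNP h.
  have := @obs_box_gt0 Y n.+1%:R^-1; rewrite invr_gt0 ltr0Sn => /(_ isT).
  rewrite ltNge => /negP; apply; rewrite -N0.
  apply: le_measure; rewrite ?inE//.
  - by apply: measurable_preimage; [exact: measurable_obs_matrix|exact: mx_box_measurable].
  - by apply: measurable_preimage mN; exact: measurable_obs_matrix.
  - by move=> w wB; apply: sN => /= e; apply: (h (obs_matrix y K w)).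
(* Points of agreement that converge to Y. *)
have [M ME] := choice near_pt.
have ML i j : M n i j @[n --> \oo] --> Y i j.
  apply/cvgrPdist_lt => e e0; near=> n.
  have [+ _] := ME n => /(_ i j) /lt_trans; apply.
  by near: n; exact: (near_infty_natSinv_lt (PosNum e0)).
have cvM : M n @[n --> \oo] --> Y.
  apply/cvg_ballP => e e0; near=> n; split=> // i j.
  have [+ _] := ME n => /(_ i j) /lt_trans; apply.
  by near: n; exact: (near_infty_natSinv_lt (PosNum e0)).
have cv1 : mu (M n) A @[n --> \oo] --> mu Y A.
  exact: (cvg_comp _ _ cvM (mu_cont A mA Y)).
have cv2 : mu (M n) A @[n --> \oo] --> (bayes_filter H Gamma u Y A)%:E.
  rewrite (_ : (fun n => mu (M n) A) = fun n => (bayes_filter H Gamma u (M n) A)%:E).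
    by apply: cvg_EFin; [exact: nearW|exact: cvg_bayes_filter].
  by apply/funext => n; have [] := ME n.
exact: cvg_unique cv1 cv2.
Unshelve. all: by end_near.
Qed.

End continuous_posterior.

(** * One step of the particle filter *)

Section particle_filter.
Local Open Scope ereal_scope.
Context {R : realType} {d p : nat} (psi : 'cV[R]_d -> 'cV[R]_d)
  (H : 'M[R]_(p, d)) (Sigma : 'M[R]_d) (Gamma : 'M[R]_p)
  (mu0 : probability 'cV[R]_d R)
  {dW : measure_display} {W : measurableType dW} (P : probability W R)
  (N K : nat) (Y : 'M[R]_(p, K))
  (v vt zeta : nat -> nat -> {RV P >-> 'cV[R]_d}).
Hypothesis psi_meas : measurable_fun setT psi.
Hypothesis N_gt0 : (0 < N)%N.
Hypothesis run : is_gopf psi H Sigma Gamma mu0 N Y v vt zeta.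

(** The events that generate the history of the algorithm. *)
Definition history_events (k l : nat) : set (set W) :=
  [set E | exists n A, [/\ (n < N)%N, measurable A &
        [\/ E = v 0%N n @^-1` A,
            exists2 j, (j < k)%N & E = vt j n @^-1` A |
            exists2 j, (j < l)%N & E = zeta j n @^-1` A]]].

Lemma history_events_measurable k l : history_events k l `<=` measurable.
Proof.
by move=> _ [n [A [_ mA [->|[j _ ->]|[j _ ->]]]]];
  apply: measurable_preimage => //; exact: measurable_funP.
Qed.

Lemma sigma_history_measurable k l : <<s history_events k l >> `<=` measurable.
Proof.
apply: smallest_sub; first exact: sigma_algebra_measurable.
exact: history_events_measurable.
Qed.

Lemma particle0_wrt k l n : (n < N)%N -> measurable_wrt (history_events k l) (v 0%N n).
Proof.
move=> nN; apply: measurable_wrtP => A mA; apply: sub_sigma_algebra.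
by exists n, A; split => //; constructor.
Qed.

Lemma resampled_wrt k l j n : (n < N)%N -> (j < k)%N ->
  measurable_wrt (history_events k l) (vt j n).
Proof.
move=> nN jk; apply: measurable_wrtP => A mA; apply: sub_sigma_algebra.
by exists n, A; split => //; constructor 2; exists j.
Qed.

Lemma noise_wrt k l j n : (n < N)%N -> (j < l)%N ->
  measurable_wrt (history_events k l) (zeta j n).
Proof.
move=> nN jk; apply: measurable_wrtP => A mA; apply: sub_sigma_algebra.
by exists n, A; split => //; constructor 3; exists j.
Qed.

(** The mean of the optimal proposal from the position x. *)
Definition proposal_mean (z : 'cV[R]_p) (x : 'cV[R]_d) : 'cV[R]_d :=
  ((1%:M - kalman_gain H Sigma Gamma *m H) *m psi x
   + kalman_gain H Sigma Gamma *m z)%R.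

Lemma measurable_proposal_mean {d' : measure_display} {T : measurableType d'}
    z (f : T -> 'cV[R]_d) :
  measurable_fun setT f -> measurable_fun setT (fun t => proposal_mean z (f t)).
Proof.
move=> mf; apply: measurable_mxD => //; apply: measurable_mxM => //.
exact: measurableT_comp.
Qed.

(** The particles at time j are functions of the first j rounds. *)
Lemma particle_wrt j k l n : (n < N)%N -> (j <= K)%N -> (j <= k)%N -> (j <= l)%N ->
  measurable_wrt (history_events k l) (v j n).
Proof.
case: j => [|j] nN jK jk jl; first exact: particle0_wrt.
rewrite /measurable_wrt (_ : (v j.+1 n : W -> _) =
    fun w => proposal_mean (col (Ordinal jK) Y) (vt j n w) + zeta j n w)%R; last first.
  by apply/funext => w; rewrite (gopf_move run (Ordinal jK)).
apply: measurable_mxD; last exact: noise_wrt.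
by apply: measurable_proposal_mean; exact: resampled_wrt.
Qed.

(** The noise of the algorithm has the Gaussian law with covariance C, which
    therefore has total mass 1; one particle and one step are needed. *)
Lemma gaussian_post_cov_total : (0 < K)%N -> gaussian (post_cov H Sigma Gamma) setT = 1.
Proof.
move=> K0.
have := gopf_noise run (k := Ordinal K0) (E := setT) (A := fun=> setT) _ (fun=> measurableT).
move=> /(_ (@measurableT _ (g_sigma_algebraType (history_events 1 0)))).
rewrite (_ : \bigcap_(n < N) _ = setT) ?setIT; last by apply/seteqP; split.
rewrite probability_setT mul1e.
have g0 : 0 <= gaussian (post_cov H Sigma Gamma) setT.
  by apply: integral_ge0 => x _; rewrite lee_fin gaussian_pdf_ge0.
move: (gaussian _ _) g0 => [r| |]//.
  move=> r0; rewrite prodEFin prodr_const card_ord => -[] /esym/eqP.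
  by rewrite pexpr_eq1// => /eqP ->.
(* An infinite mass has an infinite N-th power, which is not 1. *)
move=> _; case: N N_gt0 => // n _.
rewrite big_ord_recl gt0_mulye//.
by apply: (big_ind (fun x => 0 < x)) => // a b; exact: mule_gt0.
Qed.

Lemma weight_ge0 z x n : (0 <= weight psi H Sigma Gamma N z x n)%R.
Proof. by rewrite divr_ge0 ?expR_ge0// sumr_ge0// => i _; exact: expR_ge0. Qed.

Lemma weight_sum_gt0 z (x : nat -> 'cV[R]_d) :
  (0 < \sum_(m < N) weight_star psi H Sigma Gamma z (x m))%R.
Proof.
case: N N_gt0 => // n _; rewrite big_ord_recl ltr_pwDl ?expR_gt0//.
by apply: sumr_ge0 => i _; exact: expR_ge0.
Qed.

Lemma weight_sum1 z x : (\sum_(m < N) weight psi H Sigma Gamma N z x m = 1)%R.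
Proof. by rewrite -mulr_suml divff// gt_eqF// weight_sum_gt0. Qed.

Lemma measurable_weight {d' : measure_display} {T : measurableType d'}
    z (x : nat -> T -> 'cV[R]_d) n : (n < N)%N ->
  (forall m, (m < N)%N -> measurable_fun setT (x m)) ->
  measurable_fun setT (fun t => weight psi H Sigma Gamma N z (fun i => x i t) n).
Proof.
move=> nN mx.
have mws m : (m < N)%N ->
    measurable_fun setT (fun t => weight_star psi H Sigma Gamma z (x m t)).
  move=> mN; apply: measurable_expR_mnorm2; apply: measurable_mxD => //.
  apply: measurable_mxN; apply: measurable_mxM => //.
  by apply: (measurableT_comp psi_meas); exact: mx.
apply: measurable_funM; first exact: mws.
apply: measurable_fun_gt0V; last by move=> t; exact: (weight_sum_gt0 z (x ^~ t)).
by apply: (@measurable_sum _ _ R setT _ _ (fun (m : 'I_N) t => weight_star psi H Sigma Gamma z (x m t))) => m;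
  exact: mws.
Qed.

Section step.
Variable k : 'I_K.

Let z := col k Y.
Let wgt m w := weight psi H Sigma Gamma N z (fun i => v k i w) m.

Let mwgt m : (m < N)%N -> measurable_fun setT (wgt m).
Proof.
by move=> mN; apply: (measurable_weight z (x := fun i => v k i)).
Qed.

(** The weighted empirical mean of f over the particles at time k. *)
Definition weighted_mean (f : 'cV[R]_d -> R) (w : W) : R :=
  (\sum_(m < N) wgt m w * f (v k m w))%R.

Lemma measurable_weighted_mean f :
  measurable_fun setT f -> measurable_fun setT (weighted_mean f).
Proof.
move=> mf; apply: (@measurable_sum _ _ R setT _ _ (fun (m : 'I_N) w => wgt m w * f (v k m w))%R) => m.
apply: measurable_funM; first exact: mwgt.
by apply: measurableT_comp => //; exact: measurable_funP.
Qed.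

Lemma weighted_mean_wrt f : measurable_fun setT f ->
  measurable_wrt (history_events k k) (weighted_mean f).
Proof.
move=> mf; apply: (@measurable_sum _ (g_sigma_algebraType (history_events k k)) R setT _ _
  (fun (m : 'I_N) w => wgt m w * f (v k m w))%R) => m.
have kK := ltnW (ltn_ord k).
apply: measurable_funM.
  apply: (measurable_weight (T := g_sigma_algebraType (history_events k k)) z
    (x := fun i => v k i)) => // i iN.
  exact: particle_wrt.
by apply: (measurableT_comp mf); exact: particle_wrt.
Qed.

Lemma weighted_mean01 f w : (forall x, 0 <= f x <= 1)%R ->
  (0 <= weighted_mean f w <= 1)%R.
Proof.
move=> f01; rewrite sumr_ge0/=; last first.
  by move=> m _; rewrite mulr_ge0 ?weight_ge0//; have /andP[] := f01 (v k m w).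
rewrite -[leRHS](weight_sum1 z (fun i => v k i w)); apply: ler_sum => m _.
by rewrite ler_piMr ?weight_ge0//; have /andP[] := f01 (v k m w).
Qed.

(** Given the past, the resampled particles are independent with the weighted
    empirical law: the rule for events extends to products of functions. *)
Lemma resample_integral (g : W -> R) (f : nat -> 'cV[R]_d -> R) :
  measurable_wrt (history_events k k) g -> (forall w, 0 <= g w <= 1)%R ->
  (forall n, measurable_fun setT (f n)) -> (forall n x, 0 <= f n x <= 1)%R ->
  \int[P]_w (g w * \prod_(n < N) f n (vt k n w))%:E =
  \int[P]_w (g w * \prod_(n < N) weighted_mean (f n) w)%:E.
Proof.
move=> gwrt g01 mf f01.
have mid : @measurable_fun _ _ W (g_sigma_algebraType (history_events k k)) setT id.
  by move=> _ A sA; rewrite setTI; exact: sigma_history_measurable sA.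
have mg : measurable_fun setT g.
  by move=> _ A mA; rewrite setTI; apply: (@sigma_history_measurable k k); exact: measurable_wrt_preimage gwrt mA.
(* Integration against the weighted empirical law. *)
pose kap (h : 'cV[R]_d -> \bar R) w := \sum_(m < N) (wgt m w)%:E * h (v k m w).
have kapE h w : kap (EFin \o h) w = (weighted_mean h w)%:E.
  by rewrite /kap /weighted_mean -sumEFin; apply: eq_bigr => m _; rewrite EFinM.
have fin01 (h : 'cV[R]_d -> R) : measurable_fun setT h -> (forall x, 0 <= h x <= 1)%R ->
    exists r : W -> R, exists M' : R, [/\ measurable_fun setT r,
      (forall w, 0 <= r w <= M')%R & forall w, kap (EFin \o h) w = (r w)%:E].
  move=> mh h01; exists (weighted_mean h), 1%R; split.
  - exact: measurable_weighted_mean.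
  - by move=> w; exact: weighted_mean01.
  - exact: kapE.
have i01 (A : set 'cV[R]_d) x : (0 <= (\1_A x : R) <= 1)%R.
  by rewrite indicE ler0n lern1 leq_b1.
transitivity (\int[P]_w ((g w)%:E * \prod_(n < N) kap (EFin \o f n) w)); last first.
  apply: eq_integral => w _; rewrite EFinM -prodEFin; congr (_ * _).
  by apply: eq_bigr => n _; exact: kapE.
apply: (@cond_product _ _ W _ R P N (fun n => vt k n) kap g 1) => //.
- move=> wt M mwt wt0.
  have wt0' w : (0 <= wt w)%R by have /andP[] := wt0 w.
  pose J m (h : 'cV[R]_d -> \bar R) := \int[P]_w (((wt w * (if (m < N)%N then wgt m w else 0))%R)%:E * h (v k m w)).
  have [m' mE] : is_integral (fun h => \sum_(m < N) J m h).
    apply: is_integral_sum => m; apply: is_integral_weighted.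
    - exact: measurable_funP.
    - by case: (boolP (m < N)%N) => mN; apply: measurable_funM => //; exact: mwgt.
    - by move=> w; rewrite mulr_ge0//; case: ifP => // _; exact: weight_ge0.
  exists m' => h mh h0; rewrite -mE//.
  rewrite -ge0_integral_sum//.
  + apply: eq_integral => w _; rewrite /kap ge0_sume_distrr; last first.
      by move=> m _; rewrite mule_ge0// lee_fin weight_ge0.
    by apply: eq_bigr => m _; rewrite ltn_ord EFinM muleA.
  + move=> m; rewrite ltn_ord; apply: emeasurable_funM.
      by apply/measurable_EFinP; apply: measurable_funM => //; exact: mwgt.
    by apply: (measurableT_comp mh); exact: measurable_funP.
  + by move=> m w _; rewrite mule_ge0// lee_fin mulr_ge0//; case: ifP => // _; exact: weight_ge0.
- move=> A mA.
  (* Both sides are integrals in g over the sigma-algebra of the past, on whose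
     events they agree by the resampling rule. *)
  pose I (G : g_sigma_algebraType (history_events k k) -> \bar R) :=
    \int[P]_w ((\prod_(n < N) \1_(A n) (vt k n w))%:E * G w).
  pose J (G : g_sigma_algebraType (history_events k k) -> \bar R) :=
    \int[P]_w ((\prod_(n < N) weighted_mean (\1_(A n)) w)%:E * G w).
  have p0 w : (0 <= \prod_(n < N) (\1_(A n) (vt k n w) : R))%R.
    by apply: prodr_ge0 => n _.
  have q0 w : (0 <= \prod_(n < N) weighted_mean (\1_(A n)) w)%R.
    by apply: prodr_ge0 => n _; have /andP[] := @weighted_mean01 (\1_(A n)) w (i01 (A n)).
  have mp : measurable_fun setT (fun w => \prod_(n < N) \1_(A n) (vt k n w) : R)%R.
    apply: measurable_prod_cond => n _.
    apply: (@measurableT_comp _ _ _ _ _ _ (\1_(A n) : _ -> R)); first exact: measurable_indic.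
    exact: measurable_funP.
  have mq : measurable_fun setT (fun w => \prod_(n < N) weighted_mean (\1_(A n)) w)%R.
    by apply: measurable_prod_cond => n _; apply: measurable_weighted_mean; exact: measurable_indic.
  transitivity (I (EFin \o g)).
    by apply: eq_integral => w _; rewrite EFinM muleC.
  transitivity (J (EFin \o g)); last first.
    apply: eq_integral => w _; rewrite muleC; congr (_ * _).
    by rewrite -prodEFin; apply: eq_bigr => n _; rewrite -kapE.
  apply: (@is_integral_ext _ (g_sigma_algebraType (history_events k k)) R I J).
  + exact: (is_integral_weighted P mid mp p0).
  + exact: (is_integral_weighted P mid mq q0).
  + move=> E sE; have mE : @measurable _ W E := @sigma_history_measurable k k E sE.
    transitivity (P (E `&` \bigcap_(n < N) (vt k n @^-1` A n))).
      have mEA : @measurable _ W (E `&` \bigcap_(n < N) (vt k n @^-1` A n)).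
        apply: measurableI => //; rewrite bigcap_mkord; apply: bigsetI_measurable => n _.
        by apply: measurable_preimage; [exact: measurable_funP|exact: mA].
      transitivity (\int[P]_w (\1_(E `&` \bigcap_(n < N) (vt k n @^-1` A n)) w)%:E); last first.
        by rewrite integral_indic// setIT.
      apply: eq_integral => w _; rewrite indicI -EFinM mulrC bigcap_mkord; congr ((_ * _)%:E).
      elim/big_ind2 : _ => [|x X x' X' -> ->|n _]; first by rewrite indicT.
      * by rewrite indicI.
      * by rewrite /= !indicE; congr (_%:R); apply/idP/idP; rewrite !inE.
    rewrite (gopf_resample run (k := k) sE mA) integral_mkcond.
    apply: eq_integral => w _; rewrite patchE indicE.
    by case: ifP => _; rewrite ?mule1 ?mule0.
  + exact/measurable_EFinP.
  + by move=> w; rewrite lee_fin; have /andP[] := g01 w.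
- by move=> A mA; apply: fin01; [exact: measurable_indic|exact: i01].
- by move=> n x; have /andP[] := f01 n x.
- by move=> n; apply: fin01; [exact: mf|exact: f01].
Qed.

End step.

End particle_filter.

Section filter_step.
Local Open Scope ereal_scope.
Context {R : realType} {d p : nat} (psi : 'cV[R]_d -> 'cV[R]_d)
  (H : 'M[R]_(p, d)) (Sigma : 'M[R]_d) (Gamma : 'M[R]_p)
  (mu0 : probability 'cV[R]_d R)
  {dW : measure_display} {W : measurableType dW} (P : probability W R)
  (N K : nat) (Y : 'M[R]_(p, K))
  (v vt zeta : nat -> nat -> {RV P >-> 'cV[R]_d}).
Hypothesis psi_meas : measurable_fun setT psi.
Hypothesis N_gt0 : (0 < N)%N.
Hypothesis run : is_gopf psi H Sigma Gamma mu0 N Y v vt zeta.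
Variable gC : probability 'cV[R]_d R.
Hypothesis gCE : forall B, measurable B -> gC B = gaussian (post_cov H Sigma Gamma) B.
Variable k : 'I_K.

Local Notation hist := (history_events N v vt zeta).

(** The noise of one round is independent of the past and of the resampling. *)
Lemma noise_prob E n B : <<s hist k.+1 k >> E -> (n < N)%N -> measurable B ->
  P (E `&` zeta k n @^-1` B) = P E * gC B.
Proof.
move=> sE nN mB; pose A i := if i == n then B else setT.
have mA i : measurable (A i) by rewrite /A; case: ifP.
have := gopf_noise run sE mA.
rewrite (_ : \bigcap_(i < N) (zeta k i @^-1` A i) = zeta k n @^-1` B); last first.
  apply/seteqP; split => w /=; first by move=> /(_ n nN); rewrite /A eqxx.
  by move=> wB i _; rewrite /A /=; case: eqP => [->|].
move=> ->; congr (_ * _).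
rewrite (bigD1 (Ordinal nN))//= big1 ?mule1.
  by rewrite /A eqxx gCE.
by move=> i ni; rewrite /A ifN// -gCE// probability_setT.
Qed.

Lemma noise_prob2 E n m B B' : <<s hist k.+1 k >> E -> (n < N)%N -> (m < N)%N ->
  n != m -> measurable B -> measurable B' ->
  P (E `&` zeta k n @^-1` B `&` zeta k m @^-1` B') = P E * gC B * gC B'.
Proof.
move=> sE nN mN nm mB mB'.
pose A i := if i == n then B else if i == m then B' else setT.
have mA i : measurable (A i) by rewrite /A; case: ifP => // _; case: ifP.
have := gopf_noise run sE mA.
rewrite (_ : E `&` \bigcap_(i < N) (zeta k i @^-1` A i) =
    E `&` zeta k n @^-1` B `&` zeta k m @^-1` B'); last first.
  rewrite -setIA; congr (_ `&` _); apply/seteqP; split => w /=.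
    move=> h; have := h n nN; have := h m mN.
    by rewrite /A !eqxx (eq_sym m) (negbTE nm).
  move=> [wB wB'] i _; rewrite /A /=; case: eqP => [->//|_].
  by case: eqP => [->|].
move=> ->; rewrite -muleA; congr (_ * _).
rewrite (bigD1 (Ordinal nN))//= (bigD1 (Ordinal mN))/=; last by rewrite -val_eqE /= eq_sym.
rewrite big1 ?mule1.
  by rewrite /A !eqxx (eq_sym m) (negbTE nm) !gCE.
move=> i /andP[ni mi]; rewrite /A ifN// ifN// -gCE// probability_setT//.
Qed.

Section integrals.
Context {d' : measure_display} {T : measurableType d'} (U : W -> T).
Hypothesis Uwrt : measurable_wrt (hist k.+1 k) U.

Let mU : measurable_fun setT U.
Proof.
move=> _ A mA; rewrite setTI.
apply: (@sigma_history_measurable _ _ _ _ _ N v vt zeta k.+1 k).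
exact: measurable_wrt_preimage Uwrt mA.
Qed.

(** Given the past and the resampling, one noise can be integrated out, and so
    can two noises of distinct particles. *)
Lemma noise_integral n (F : T * 'cV[R]_d -> \bar R) : (n < N)%N ->
  measurable_fun setT F -> (forall t, 0 <= F t) ->
  \int[P]_w F (U w, zeta k n w) = \int[P]_w \int[gC]_x F (U w, x).
Proof.
move=> nN mF F0; apply: integral_indep => // A B mA mB.
by apply: noise_prob => //; exact: measurable_wrt_preimage Uwrt mA.
Qed.

Lemma noise_integral2 n m (F : (T * 'cV[R]_d) * 'cV[R]_d -> \bar R) :
  (n < N)%N -> (m < N)%N -> n != m ->
  measurable_fun setT F -> (forall t, 0 <= F t) ->
  \int[P]_w F ((U w, zeta k n w), zeta k m w) =
  \int[P]_w \int[gC]_x \int[gC]_x' F ((U w, x), x').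
Proof.
move=> nN mN nm mF F0.
pose V w := (U w, zeta k n w).
have mV : measurable_fun setT V by apply: measurable_fun_pair => //; exact: measurable_funP.
rewrite (@integral_indep _ _ _ _ _ _ R P V (zeta k m) gC)//.
- rewrite (noise_integral (F := fun t => \int[gC]_x F (t, x)))//.
  + exact: (measurable_fun_fubini_tonelli_F (m2 := gC) F mF F0).
  + by move=> t; exact: integral_ge0.
- move=> C B mC mB.
  have mzB : measurable (zeta k m @^-1` B) by apply: measurable_preimage => //; exact: measurable_funP.
  have [m1 m1E] := measure_pushforward (mrestr P mzB) mV.
  have [m2 m2E] := measure_pushforward P mV.
  pose m3 : {measure set (T * 'cV[R]_d) -> \bar R} := mscale (NngNum (fine_ge0 (measure_ge0 gC B))) m2.
  have gB : (fine (gC B))%:E = gC B by rewrite fineK// fin_num_measure.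
  have m3E C' : m3 C' = gC B * m2 C' by rewrite -gB.
  transitivity (m1 C); first by rewrite m1E.
  transitivity (m3 C); last by rewrite m3E m2E muleC.
  apply: eq_measure_rectangles => //.
    rewrite m1E; apply: (@le_lt_trans _ _ (P setT)); last by rewrite probability_setT ltry.
    apply: le_measure; rewrite ?inE//; apply: measurableI => //.
    exact: measurable_preimage.
  move=> A A' mA mA'; rewrite m1E m3E m2E muleC.
  transitivity (P (U @^-1` A `&` zeta k n @^-1` A' `&` zeta k m @^-1` B)) => //.
  have sA := measurable_wrt_preimage Uwrt mA.
  by rewrite noise_prob2// -(noise_prob sA nN mA').
Qed.

End integrals.

Local Notation z := (col k Y).
Local Notation b := (proposal_mean psi H Sigma Gamma z).

(** The action of the optimal proposal kernel on functions. *)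
Definition proposal (h : 'cV[R]_d -> R) (x : 'cV[R]_d) : R :=
  (\int[gC]_e h (b x + e))%R.

Variable h : 'cV[R]_d -> R.
Hypothesis mh : measurable_fun setT h.
Hypothesis h01 : forall x, (0 <= h x <= 1)%R.

Let h0 x : (0 <= h x)%R. Proof. by have /andP[] := h01 x. Qed.

Lemma proposalE x : (proposal h x)%:E = \int[gC]_e (h (b x + e)%R)%:E.
Proof.
rewrite /proposal ExE//; apply: bounded_rv01 => // .
by apply: (measurableT_comp mh); exact: measurable_mxD.
Qed.

Lemma proposal01 x : (0 <= proposal h x <= 1)%R.
Proof.
have bh : bounded_rv (fun e => h (b x + e)%R).
  by apply: bounded_rv01 => //; apply: (measurableT_comp mh); exact: measurable_mxD.
rewrite Rintegral_ge0//= -[leRHS](Ex_cst gC 1); apply: Ex_le => //.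
  exact: bounded_rv_cst.
by move=> e; have /andP[] := h01 (b x + e)%R.
Qed.

Lemma measurable_proposal : measurable_fun setT (proposal h).
Proof.
apply: measurableT_comp => //.
apply: (measurable_fun_fubini_tonelli_F (m2 := gC) (fun t : 'cV[R]_d * 'cV[R]_d => (h (b t.1 + t.2)%R)%:E)).
  apply/measurable_EFinP; apply: (measurableT_comp mh); apply: measurable_mxD; last exact: measurable_snd.
  by apply: measurable_proposal_mean => //; exact: measurable_fst.
by move=> t; rewrite lee_fin.
Qed.

Let X n w := h (v k.+1 n w).
Let Phi := weighted_mean psi H Sigma Gamma N Y v k (proposal h).

Let XE n w : (n < N)%N -> X n w = h (b (vt k n w) + zeta k n w)%R.
Proof. by move=> nN; rewrite /X (gopf_move run k w nN). Qed.

Let Phi01 w : (0 <= Phi w <= 1)%R.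
Proof. by apply: weighted_mean01 => // x; exact: proposal01. Qed.

Let mPhi : measurable_fun setT Phi.
Proof. by apply: measurable_weighted_mean => //; exact: measurable_proposal. Qed.

Let T01 x : (0 <= proposal h x <= 1)%R := proposal01 x.

(** The mean of a new particle, weighted by a function of the past. *)
Let resample1 (g : W -> R) n : (n < N)%N ->
  measurable_wrt (hist k k) g -> (forall w, 0 <= g w <= 1)%R ->
  \int[P]_w (g w * X n w)%:E = \int[P]_w (g w * Phi w)%:E.
Proof.
move=> nN gwrt g01.
have gwrt' : measurable_wrt (hist k.+1 k) g.
  apply: measurable_wrtP => A mA.
  have := measurable_wrt_preimage gwrt mA; apply: sub_sigma_algebra2.
  move=> E [i [B [iN mB [->|[j jk ->]|[j jk ->]]]]]; exists i, B; split => //.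
  - by constructor.
  - by constructor 2; exists j => //; exact: ltnW.
  - by constructor 3; exists j.
pose U w := (vt k n w, g w).
have Uwrt : measurable_wrt (hist k.+1 k) U.
  by apply: measurable_fun_pair => //; exact: resampled_wrt.
transitivity (\int[P]_w (g w * proposal h (vt k n w))%:E).
  (* The absolute value makes F nonnegative; g is nonnegative anyway. *)
  pose F (t : ('cV[R]_d * R) * 'cV[R]_d) : \bar R := (`|t.1.2| * h (b t.1.1 + t.2))%:E.
  have mF : measurable_fun setT F.
    apply/measurable_EFinP; apply: measurable_funM.
      by apply: measurableT_comp => //; apply: (measurableT_comp measurable_snd); exact: measurable_fst.
    apply: (measurableT_comp mh); apply: measurable_mxD; last exact: measurable_snd.
    by apply: measurable_proposal_mean => //; apply: (measurableT_comp measurable_fst); exact: measurable_fst.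
  have F0 t : 0 <= F t by rewrite lee_fin mulr_ge0.
  transitivity (\int[P]_w F (U w, zeta k n w)).
    apply: eq_integral => w _; rewrite /F /U /= XE// ger0_norm//.
    by have /andP[] := g01 w.
  rewrite (noise_integral Uwrt nN mF F0); apply: eq_integral => w _.
  have g0w : (0 <= g w)%R by have /andP[] := g01 w.
  rewrite /F /U /= ger0_norm// EFinM proposalE -ge0_integralZl//.
  - apply/measurable_EFinP; apply: (measurableT_comp mh); exact: measurable_mxD.
  - by move=> e _; rewrite lee_fin.
pose f i (x : 'cV[R]_d) := if i == n then proposal h x else 1%R.
have fE (a : nat -> R) := prod_if1 a nN.
have wE w : (\prod_(i < N) weighted_mean psi H Sigma Gamma N Y v k (f i) w = Phi w)%R.
  rewrite -(fE (fun=> Phi w)); apply: eq_bigr => i _; rewrite /f; case: eqP => // _.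
  rewrite /weighted_mean; under eq_bigr do rewrite mulr1.
  exact: weight_sum1.
have vE w : (\prod_(i < N) f i (vt k i w) = proposal h (vt k n w))%R.
  by rewrite -(fE (fun i => proposal h (vt k i w))); apply: eq_bigr => i _; rewrite /f; case: eqP.
have mf i : measurable_fun setT (f i).
  by rewrite /f; case: eqP => _; [exact: measurable_proposal|exact: measurable_cst].
have f01 i x : (0 <= f i x <= 1)%R by rewrite /f; case: eqP => _ //; rewrite ler01 lexx.
transitivity (\int[P]_w (g w * \prod_(i < N) f i (vt k i w))%:E).
  by apply: eq_integral => w _; rewrite vE.
rewrite (resample_integral psi_meas N_gt0 run (k := k) gwrt g01 mf f01).
by apply: eq_integral => w _; rewrite wE.
Qed.

(** The second moments of two distinct new particles. *)
Let resample2 n m : (n < N)%N -> (m < N)%N -> n != m ->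
  \int[P]_w (X n w * X m w)%:E = \int[P]_w (Phi w ^+ 2)%:E.
Proof.
move=> nN mN nm.
pose U w := (vt k n w, vt k m w).
have Uwrt : measurable_wrt (hist k.+1 k) U.
  by apply: measurable_fun_pair; exact: resampled_wrt.
transitivity (\int[P]_w (proposal h (vt k n w) * proposal h (vt k m w))%:E).
  pose F (t : (('cV[R]_d * 'cV[R]_d) * 'cV[R]_d) * 'cV[R]_d) : \bar R :=
    (h (b t.1.1.1 + t.1.2) * h (b t.1.1.2 + t.2))%:E.
  have m11 : measurable_fun setT (fun t : (('cV[R]_d * 'cV[R]_d) * 'cV[R]_d) * 'cV[R]_d => t.1.1).
    by apply: (measurableT_comp measurable_fst); exact: measurable_fst.
  have mF : measurable_fun setT F.
    apply/measurable_EFinP; apply: measurable_funM; apply: (measurableT_comp mh); apply: measurable_mxD.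
    - by apply: measurable_proposal_mean => //; exact: (measurableT_comp measurable_fst m11).
    - by apply: (measurableT_comp measurable_snd); exact: measurable_fst.
    - by apply: measurable_proposal_mean => //; exact: (measurableT_comp measurable_snd m11).
    - exact: measurable_snd.
  have F0 t : 0 <= F t by rewrite lee_fin mulr_ge0.
  transitivity (\int[P]_w F ((U w, zeta k n w), zeta k m w)).
    by apply: eq_integral => w _; rewrite /F /U /= !XE.
  rewrite (noise_integral2 Uwrt nN mN nm mF F0); apply: eq_integral => w _.
  rewrite EFinM (proposalE (vt k n w)) muleC -ge0_integralZl//.
  - apply: eq_integral => e _; rewrite muleC proposalE -ge0_integralZl ?lee_fin//.
      apply/measurable_EFinP; apply: (measurableT_comp mh); exact: measurable_mxD.
    by move=> e' _; rewrite lee_fin.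
  - apply/measurable_EFinP; apply: (measurableT_comp mh); exact: measurable_mxD.
  - by move=> e _; rewrite lee_fin.
  - by rewrite lee_fin; have /andP[] := T01 (vt k m w).
pose f i (x : 'cV[R]_d) := if (i == n) || (i == m) then proposal h x else 1%R.
have fE (a : nat -> R) := prod_if2 a nN mN nm.
have wE w : (\prod_(i < N) weighted_mean psi H Sigma Gamma N Y v k (f i) w = Phi w ^+ 2)%R.
  rewrite expr2 -(fE (fun=> Phi w)); apply: eq_bigr => i _; rewrite /f; case: ifP => // _.
  rewrite /weighted_mean; under eq_bigr do rewrite mulr1.
  exact: weight_sum1.
have vE w : (\prod_(i < N) f i (vt k i w) = proposal h (vt k n w) * proposal h (vt k m w))%R.
  by rewrite -(fE (fun i => proposal h (vt k i w))); apply: eq_bigr => i _; rewrite /f; case: ifP.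
have mf i : measurable_fun setT (f i).
  by rewrite /f; case: ((i == n) || (i == m)); [exact: measurable_proposal|exact: measurable_cst].
have f01 i x : (0 <= f i x <= 1)%R by rewrite /f; case: ifP => _ //; rewrite ler01 lexx.
have c01 (w : W) : (0 <= (cst 1 w : R) <= 1)%R by rewrite /= ler01 lexx.
transitivity (\int[P]_w (cst 1 w * \prod_(i < N) f i (vt k i w))%:E).
  by apply: eq_integral => w _; rewrite vE mul1r.
rewrite (resample_integral psi_meas N_gt0 run (k := k) (measurable_cst _) c01 mf f01).
by apply: eq_integral => w _; rewrite wE mul1r.
Qed.

(** The sampling error of one step: conditionally on the past, the new
    particles are independent with the reweighted and propagated law. *)
Lemma step_sampling_error :
  (\int[P]_w ((N%:R^-1 * \sum_(n < N) h (v k.+1 n w) - Phi w) ^+ 2)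
   <= (4 * N%:R)^-1)%R.
Proof.
have mX n : measurable_fun setT (X n) by apply: (measurableT_comp mh); exact: measurable_funP.
have Pwrt : measurable_wrt (hist k k) Phi.
  by apply: (weighted_mean_wrt psi_meas N_gt0 run) => //; exact: measurable_proposal.
apply: (sampling_error (X := X)) => //.
- by move=> n w _; exact: h01.
- move=> n nN; rewrite /Rintegral; congr fine.
  have c01 (w : W) : (0 <= (cst 1 w : R) <= 1)%R by rewrite /= ler01 lexx.
  transitivity (\int[P]_w (cst 1 w * X n w)%:E).
    by apply: eq_integral => w _; rewrite mul1r.
  rewrite (resample1 nN (measurable_cst _) c01).
  by apply: eq_integral => w _; rewrite mul1r.
- move=> n nN; rewrite /Rintegral; congr fine; rewrite (resample1 nN Pwrt Phi01).
  by apply: eq_integral => w _; rewrite expr2.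
- by move=> n m nN mN nm; rewrite /Rintegral; congr fine; exact: resample2.
Qed.

End filter_step.

(** * Error propagation *)

Section kappa_bound.
Context {R : realType}.

(** The quadratic forms are bounded on bounded sets, which makes the supremum in
    kappa a genuine upper bound. *)
Lemma mnorm2_bounded n (B : 'M[R]_n) (M : R) : exists C : R,
  forall x : 'cV[R]_n, (forall i, `|x i ord0| <= M) -> mnorm2 B x <= C.
Proof.
exists (\sum_j (\sum_i M * `|invmx B i j|) * M) => x xM.
rewrite /mnorm2 mxE; apply: ler_sum => j _.
apply: (le_trans (ler_norm _)); rewrite normrM ler_pM// mxE.
apply: (le_trans (ler_norm_sum _ _ _)); apply: ler_sum => i _.
by rewrite normrM mxE ler_wpM2r.
Qed.

Lemma mx_norm_coord m n (A : 'M[R]_(m, n)) i j : `|A i j| <= `|A|.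
Proof.
rewrite -[leRHS]/(mx_norm A) mx_normrE.
exact: (le_bigmax _ (fun ij : 'I_m * 'I_n => `|A ij.1 ij.2|) (i, j)).
Qed.

Lemma mulmx_col_bounded m n (H : 'M[R]_(m, n)) (M : R) : exists C : R,
  forall x : 'cV[R]_n, (forall i, `|x i ord0| <= M) -> forall i, `|(H *m x) i ord0| <= C.
Proof.
exists (\sum_i \sum_j `|H i j| * `|M|) => x xM i; rewrite mxE.
apply: (le_trans (ler_norm_sum _ _ _)).
rewrite (bigD1 i)//= ler_wpDr//.
  by apply: sumr_ge0 => k _; apply: sumr_ge0 => j _; rewrite mulr_ge0.
apply: ler_sum => j _; rewrite normrM ler_wpM2l//.
exact: le_trans (xM j) (ler_norm M).
Qed.

Lemma sup_innov_bound d p (psi : 'cV[R]_d -> 'cV[R]_d) (H : 'M[R]_(p, d))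
    (S : 'M[R]_p) (M : R) : (forall x, `|psi x| <= M) ->
  forall x, mnorm2 S (H *m psi x) <= sup (range (fun v => mnorm2 S (H *m psi v))).
Proof.
move=> psiM x.
have [C HC] := mulmx_col_bounded H M.
have [C' HC'] := mnorm2_bounded S C.
apply: ub_le_sup; last by exists x.
exists C' => _ [v _ <-]; apply: HC'; apply: HC => i.
exact: le_trans (mx_norm_coord _ _ _) (psiM v).
Qed.

Context {d p : nat} (psi : 'cV[R]_d -> 'cV[R]_d)
  (H : 'M[R]_(p, d)) (Sigma : 'M[R]_d) (Gamma : 'M[R]_p) (M : R).
Hypothesis psiM : forall x, `|psi x| <= M.
Hypothesis Sigma_spd : spd Sigma.
Hypothesis Gamma_spd : spd Gamma.

Local Notation S := (innov_cov H Sigma Gamma).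

Lemma kappa_gt0 K (Y : 'M[R]_(p, K)) : 0 < kappa psi H Sigma Gamma Y.
Proof. by rewrite invr_gt0 expR_gt0. Qed.

Lemma kappa_le1 K (Y : 'M[R]_(p, K)) : kappa psi H Sigma Gamma Y <= 1.
Proof.
rewrite invf_le1 ?expR_gt0// -expR0 ler_expR addr_ge0//.
  by apply: bigmax_ge_id.
apply: le_trans (sup_innov_bound H S psiM 0).
by apply: mnorm2_ge0; exact: innov_cov_spd.
Qed.

(** The constant kappa is a lower bound of the weights. *)
Lemma kappa_le_weight K (Y : 'M[R]_(p, K)) (k : 'I_K) x :
  kappa psi H Sigma Gamma Y <= gauss_exp S (col k Y - H *m psi x).
Proof.
rewrite /kappa -expRN ler_expR lerN2.
have h := mnorm2B_le (col k Y) (H *m psi x) (innov_cov_spd H Sigma_spd Gamma_spd).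
apply: (@le_trans _ _ (mnorm2 S (col k Y) + mnorm2 S (H *m psi x))); first by lra.
apply: lerD; last exact: sup_innov_bound.
exact: (le_bigmax _ (fun k : 'I_K => mnorm2 S (col k Y)) k).
Qed.

End kappa_bound.

Section error_propagation.
Context {R : realType} {d p : nat} (psi : 'cV[R]_d -> 'cV[R]_d)
  (H : 'M[R]_(p, d)) (Sigma : 'M[R]_d) (Gamma : 'M[R]_p)
  (mu0 : probability 'cV[R]_d R)
  {dW : measure_display} {W : measurableType dW} (P : probability W R)
  (N K : nat) (Y : 'M[R]_(p, K))
  (v vt zeta : nat -> nat -> {RV P >-> 'cV[R]_d}).
Hypothesis psi_meas : measurable_fun setT psi.
Hypothesis N_gt0 : (0 < N)%N.
Hypothesis run : is_gopf psi H Sigma Gamma mu0 N Y v vt zeta.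
Hypothesis S_spd : spd (innov_cov H Sigma Gamma).
Variable gC : probability 'cV[R]_d R.
Hypothesis gCE : forall B, measurable B -> gC B = gaussian (post_cov H Sigma Gamma) B.

(** Functions with values in the unit interval; they suffice to test the
    distance, every f bounded by 1 being 2 h - 1 for such an h. *)
Definition unit_fun (h : 'cV[R]_d -> R) :=
  measurable_fun setT h /\ forall x, 0 <= h x <= 1.

(** The mean of h over the particles at time k. *)
Definition emp_mean k (h : 'cV[R]_d -> R) (w : W) : R :=
  N%:R^-1 * \sum_(n < N) h (v k n w).

Lemma emp_mean01 k h w : (forall x, 0 <= h x <= 1) -> 0 <= emp_mean k h w <= 1.
Proof.
move=> h01; have N0 : 0 < N%:R :> R by rewrite ltr0n.
rewrite mulr_ge0 ?invr_ge0 ?ler0n//=; last first.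
  by apply: sumr_ge0 => n _; have /andP[] := h01 (v k n w).
rewrite ler_pdivrMl// mulr1 (_ : N%:R = \sum_(n < N) 1); last by rewrite sumr_const card_ord.
by apply: ler_sum => n _; have /andP[] := h01 (v k n w).
Qed.

Lemma bounded_emp_mean k h : unit_fun h -> bounded_rv (emp_mean k h).
Proof.
move=> [mh h01]; apply: bounded_rv01 => [|w]; last exact: emp_mean01.
apply: measurable_funM => //.
apply: (@measurable_sum _ _ R setT _ _ (fun (n : 'I_N) w => h (v k n w))) => n.
by apply: (measurableT_comp mh); exact: measurable_funP.
Qed.

(** The sampling error of the initial particles, which are independent with law
    mu0. *)
Lemma init_sampling_error h : unit_fun h ->
  \int[P]_w ((emp_mean 0%N h w - \int[mu0]_x h x) ^+ 2) <= (4 * N%:R)^-1.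
Proof.
move=> [mh h01].
have h0 x : 0 <= h x by have /andP[] := h01 x.
have bh : bounded_rv h by exact: bounded_rv01.
set m := \int[mu0]_x h x.
have m01 : 0 <= m <= 1.
  rewrite Rintegral_ge0//= -[leRHS](Ex_cst mu0 1); apply: Ex_le => //.
    exact: bounded_rv_cst.
  by move=> x; have /andP[] := h01 x.
have mX n : measurable_fun setT (fun w => h (v 0%N n w)).
  by apply: (measurableT_comp mh); exact: measurable_funP.
have hint : (\int[mu0]_x (h x)%:E)%E = m%:E by rewrite /m ExE.
have prodE (Q : pred nat) :
    (\int[P]_w (\prod_(n < N) (if Q n then h (v 0%N n w) else 1))%:E)%E =
    (\prod_(n < N) (if Q n then m else 1))%:E.
  pose f n x := if Q n then h x else 1.
  rewrite -(@iid_product _ _ W _ R P mu0 N (v 0%N) _ _ f (fun n => if Q n then m else 1)).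
  - by apply: eq_integral => w _; congr _%:E; apply: eq_bigr => n _.
  - by move=> n _; exact: measurable_funP.
  - exact: gopf_init run.
  - by move=> n; rewrite /f; case: (Q n).
  - by move=> n x; rewrite /f; case: (Q n).
  - move=> n; rewrite /f; case: (Q n) => //.
    by rewrite integral_cst// mul1e [LHS](probability_setT mu0).
have EX n : (n < N)%N -> \int[P]_w h (v 0%N n w) = m.
  move=> nN; rewrite /Rintegral -[RHS]/(fine m%:E); congr fine.
  rewrite -[RHS](congr1 EFin (prod_if1 (fun=> m) nN)) -(prodE (fun i => i == n)); apply: eq_integral => w _.
  by rewrite (prod_if1 (fun i => h (v 0%N i w)) nN).
apply: (@sampling_error _ W R P N (fun n w => h (v 0%N n w)) (cst m)) => //.
- by move=> n nN; rewrite EX// Ex_cst.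
- move=> n nN; rewrite [LHS](ExZ P m)//; last exact: bounded_rv01.
  by rewrite EX// -[LHS](Ex_cst P).
- move=> n n' nN nN' nn'.
  transitivity (m * m); last by rewrite -expr2 -[LHS](Ex_cst P).
  rewrite /Rintegral -[RHS]/(fine (m * m)%:E); congr fine.
  rewrite -[RHS](congr1 EFin (prod_if2 (fun=> m) nN nN' nn')).
  rewrite -(prodE (fun i => (i == n) || (i == n'))); apply: eq_integral => w _.
  by rewrite (prod_if2 (fun i => h (v 0%N i w)) nN nN' nn').
Qed.

(** Exact filters [pi k] driven by the same recursion. *)
Variable pi : nat -> ('cV[R]_d -> R) -> R.
Variable kap : R.
Hypothesis kap_gt0 : 0 < kap.
Hypothesis kap_le1 : kap <= 1.
Let g (k : 'I_K) x := gauss_exp (innov_cov H Sigma Gamma) (col k Y - H *m psi x).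
Let prop (k : 'I_K) := proposal psi H Sigma Gamma Y gC k.
Hypothesis kap_le : forall k x, kap <= g k x.
Hypothesis pi0 : forall h, unit_fun h -> pi 0%N h = \int[mu0]_x h x.
Hypothesis piS : forall (k : 'I_K) h, unit_fun h ->
  pi k.+1 h = pi k (fun x => g k x * prop k h x) / pi k (g k).
Hypothesis pi_gt0 : forall k : 'I_K, 0 < pi k (g k).
Hypothesis pi_le : forall (k : 'I_K) h, unit_fun h ->
  0 <= pi k (fun x => g k x * prop k h x) <= pi k (g k).

(** The bound on the distance at time k. *)
Definition error_bound (k : nat) : R :=
  \sum_(j < k.+1) (2 * kap ^- 2) ^+ j / Num.sqrt N%:R.

Lemma error_bound_gt0 k : 0 < error_bound k.
Proof.
have s0 : 0 < Num.sqrt N%:R :> R by rewrite sqrtr_gt0 ltr0n.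
rewrite /error_bound big_ord_recl expr0 ltr_pwDl ?divr_gt0//.
apply: sumr_ge0 => j _; rewrite divr_ge0 ?(ltW s0)// exprn_ge0// mulr_ge0// invr_ge0.
by rewrite exprn_ge0// ltW.
Qed.

Lemma error_boundS k :
  error_bound k.+1 = (Num.sqrt N%:R)^-1 + 2 * kap ^- 2 * error_bound k.
Proof.
rewrite /error_bound big_ord_recl expr0 mul1r; congr (_ + _).
by rewrite mulr_sumr; apply: eq_bigr => j _; rewrite lift0 exprS -!mulrA.
Qed.

Lemma unit_fun_g k : unit_fun (g k).
Proof.
split; last by move=> x; rewrite (ltW (gauss_exp_gt0 _ _)) gauss_exp_le1.
by apply: measurable_gauss_exp; apply: measurable_mxD => //; apply: measurable_mxN; exact: measurable_mxM.
Qed.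

Lemma unit_fun_gprop k h : unit_fun h -> unit_fun (fun x => g k x * prop k h x).
Proof.
move=> [mh h01]; have [mg g01] := unit_fun_g k; split.
  by apply: measurable_funM => //; exact: measurable_proposal.
move=> x; have /andP[g0 g1] := g01 x.
have /andP[p0 p1] : 0 <= prop k h x <= 1 by exact: proposal01.
by rewrite mulr_ge0// mulr_ile1.
Qed.

(** The mean square error of the particle filter. *)
Lemma filter_error k h : (k <= K)%N -> unit_fun h ->
  \int[P]_w ((emp_mean k h w - pi k h) ^+ 2) <= (error_bound k / 2) ^+ 2.
Proof.
have N0 : 0 < N%:R :> R by rewrite ltr0n.
have s0 : 0 < Num.sqrt N%:R :> R by rewrite sqrtr_gt0.
have sE : (4 * N%:R)^-1 = ((Num.sqrt N%:R)^-1 / 2) ^+ 2 :> R.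
  rewrite -{1}[N%:R](@sqr_sqrtr R) ?ler0n//.
  by field; rewrite gt_eqF.
elim: k h => [|k IH] h kK hu.
  rewrite pi0// /error_bound big_ord1 expr0 mul1r -sE.
  exact: init_sampling_error.
pose ko := Ordinal kK.
have {}IH h' : unit_fun h' ->
    \int[P]_w ((emp_mean k h' w - pi k h') ^+ 2) <= (error_bound k / 2) ^+ 2.
  by move=> h'u; apply: IH => //; exact: ltnW.
have [mh h01] := hu.
set gp := fun x => g ko x * prop ko h x.
have gpu : unit_fun gp by exact: unit_fun_gprop.
have gu := unit_fun_g ko.
pose a w := emp_mean k gp w; pose b w := emp_mean k (g ko) w.
pose c := pi k gp; pose e := pi k (g ko).
pose Phi := weighted_mean psi H Sigma Gamma N Y v ko (prop ko h).
have ba : bounded_rv a by exact: bounded_emp_mean.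
have bb : bounded_rv b by exact: bounded_emp_mean.
have kapb w : kap <= b w.
  rewrite /b /emp_mean ler_pdivlMl//.
  rewrite (_ : N%:R * kap = \sum_(n < N) kap); last by rewrite sumr_const card_ord mulr_natl.
  by apply: ler_sum => n _; exact: kap_le.
have b0 w : 0 < b w by apply: lt_le_trans (kapb w).
have PhiE w : Phi w = a w / b w.
  pose s2 := \sum_(n < N) g ko (v k n w).
  have s20 : s2 != 0.
    by apply: contraTneq (b0 w) => s20; rewrite /b /emp_mean -/s2 s20 mulr0 ltxx.
  have -> : a w / b w = (\sum_(n < N) gp (v k n w)) / s2.
    by rewrite /a /b /emp_mean -/s2; field; rewrite s20 gt_eqF.
  rewrite mulr_suml; apply: eq_bigr => m _.
  by rewrite /gp mulrAC.
have bPhi : bounded_rv Phi.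
  apply: bounded_rv01.
    apply: measurable_weighted_mean => //.
    exact: measurable_proposal.
  by move=> w; apply: weighted_mean01 => // x; exact: proposal01.
have e0 : 0 < e := pi_gt0 ko.
have /andP[c0 ce] : 0 <= c <= e := pi_le ko hu.
have biv : bounded_rv (fun w => (b w)^-1).
  split.
    by apply: measurable_fun_gt0V => //; have [] := bb.
  exists kap^-1 => w; rewrite ger0_norm ?invr_ge0 ?(ltW (b0 w))//.
  by rewrite lef_pV2 ?posrE.
(* With a = nu (g T h), b = nu g, c = pi (g T h) and e = pi g, the error a / b -
   c / e is A + B, and each term is at most 1 / kappa times an error at time k. *)
pose A w := (a w - c) * (b w)^-1.
pose B w := (c / e) * (e - b w) * (b w)^-1.
have bac : bounded_rv (fun w => a w - c) by apply: bounded_rvB => //; exact: bounded_rv_cst.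
have bbe : bounded_rv (fun w => e - b w) by apply: bounded_rvB => //; exact: bounded_rv_cst.
have bA : bounded_rv A by apply: bounded_rvM.
have bB : bounded_rv B by apply: bounded_rvM => //; exact: bounded_rvZ.
have split_err w : emp_mean k.+1 h w - pi k.+1 h = (emp_mean k.+1 h w - Phi w) + (A w + B w).
  rewrite (piS ko hu) PhiE -/gp -/c -/e /A /B.
  by field; rewrite !gt_eqF.
set eb := error_bound k / 2.
have eb0 : 0 < eb by rewrite divr_gt0 ?error_bound_gt0.
have ivsq w : 0 <= (b w)^-1 ^+ 2 <= kap^-1 ^+ 2.
  by rewrite sqr_ge0/= ler_pXn2r ?nnegrE ?invr_ge0 ?(ltW (b0 w)) ?(ltW kap_gt0)// lef_pV2 ?posrE.
have EA : \int[P]_w (A w ^+ 2) <= (kap^-1 * eb) ^+ 2.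
  apply: (@le_trans _ _ (\int[P]_w (kap^-1 ^+ 2 * (a w - c) ^+ 2))).
    apply: Ex_le; [exact: bounded_rvM|by apply: bounded_rvZ; exact: bounded_rvM|move=> w].
    rewrite /A exprMn mulrC; apply: ler_wpM2r; first exact: sqr_ge0.
    by have /andP[] := ivsq w.
  rewrite ExZ; last exact: bounded_rvM.
  by rewrite exprMn ler_wpM2l ?sqr_ge0//; exact: IH.
have EB : \int[P]_w (B w ^+ 2) <= (kap^-1 * eb) ^+ 2.
  apply: (@le_trans _ _ (\int[P]_w (kap^-1 ^+ 2 * (b w - e) ^+ 2))).
    apply: Ex_le; [exact: bounded_rvM| |move=> w].
      by apply: bounded_rvZ; apply: bounded_rvM; apply: bounded_rvB => //; exact: bounded_rv_cst.
    rewrite /B exprMn mulrC; apply: ler_pM; rewrite ?sqr_ge0//.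
      by have /andP[] := ivsq w.
    rewrite exprMn -[leRHS]mul1r (_ : (b w - e) ^+ 2 = (e - b w) ^+ 2); last by ring.
    apply: ler_wpM2r; first exact: sqr_ge0.
    by rewrite exprn_ile1 ?divr_ge0 ?(ltW e0)// ler_pdivrMr// mul1r.
  rewrite ExZ; last by apply: bounded_rvM; apply: bounded_rvB => //; exact: bounded_rv_cst.
  by rewrite exprMn ler_wpM2l ?sqr_ge0//; exact: IH.
have ki0 : 0 < kap^-1 by rewrite invr_gt0.
have EAB := Ex_sqrD_le bA bB (mulr_gt0 ki0 eb0) (mulr_gt0 ki0 eb0) EA EB.
have bD : bounded_rv (fun w => emp_mean k.+1 h w - Phi w).
  by apply: bounded_rvB => //; exact: bounded_emp_mean.
have ED : \int[P]_w ((emp_mean k.+1 h w - Phi w) ^+ 2) <= ((Num.sqrt N%:R)^-1 / 2) ^+ 2.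
  rewrite -sE; exact: (step_sampling_error psi_meas N_gt0 run gCE ko mh h01).
have s20 : 0 < (Num.sqrt N%:R)^-1 / 2 :> R by rewrite divr_gt0 ?invr_gt0.
have bAB : bounded_rv (fun w => A w + B w) by exact: bounded_rvD.
have ab0 : 0 < kap^-1 * eb + kap^-1 * eb by rewrite addr_gt0// mulr_gt0.
have := Ex_sqrD_le bD bAB s20 ab0 ED EAB.
under eq_Rintegral do rewrite -split_err.
move/le_trans; apply.
have l0 : 0 <= (Num.sqrt N%:R)^-1 / 2 + (kap^-1 * eb + kap^-1 * eb) by apply: addr_ge0; exact: ltW.
have r0 : 0 <= error_bound k.+1 / 2 by rewrite divr_ge0// ltW// error_bound_gt0.
rewrite ler_pXn2r ?nnegrE//.
rewrite error_boundS mulrDl lerD2l.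
have -> : 2 * kap ^- 2 * error_bound k / 2 = kap^-1 * eb * (2 * kap^-1).
  by rewrite /eb; field; rewrite gt_eqF.
have -> : kap^-1 * eb + kap^-1 * eb = kap^-1 * eb * 2 by ring.
apply: ler_wpM2l; first exact/ltW/mulr_gt0.
have k1 : 1 <= kap^-1 by rewrite -[leLHS]invr1 lef_pV2 ?posrE.
by lra.
Qed.

End error_propagation.

(** * The distance and the filtering distribution *)

Section distance.
Context {R : realType}.

(** The integral of f from that of its rescaling to the unit interval. *)
Lemma Rintegral_unit {d : measure_display} {T : measurableType d}
    (m : {measure set T -> \bar R}) (f : T -> R) :
  m setT = 1%E -> measurable_fun setT f -> (forall x, `|f x| <= 1) ->
  \int[m]_x f x = 2 * \int[m]_x ((f x + 1) / 2) - 1.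
Proof.
move=> m1 mf f1; have [g gE] := probability_of_measure m1.
have mg (h : T -> R) : \int[m]_x h x = \int[g]_x h x.
  by rewrite /Rintegral; congr fine; apply: eq_measure_integral => A mA _; exact/esym/gE.
rewrite !mg.
have bf : bounded_rv f by split=> //; exists 1.
have bh : bounded_rv (fun x => (f x + 1) / 2).
  rewrite (_ : (fun x => _) = fun x => 2^-1 * (f x + cst 1 x)); last first.
    by apply/funext => x; rewrite mulrC.
  by apply: bounded_rvZ; apply: bounded_rvD => //; exact: bounded_rv_cst.
transitivity (\int[g]_x (2 * ((f x + 1) / 2) - cst 1 x)).
  by apply: eq_Rintegral => x _; rewrite /cst; field.
by rewrite ExB ?ExZ ?Ex_cst//; [exact: bounded_rvZ|exact: bounded_rv_cst].
Qed.

Lemma empirical_setT {d : measure_display} {T : measurableType d} (N : nat)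
    (x : nat -> T) : (0 < N)%N -> empirical (R := R) N x setT = 1%E.
Proof.
move=> N0; transitivity ((N%:R^-1)%:E * \sum_(n < N) (\d_(x n) setT : \bar R))%E => //.
under eq_bigr do rewrite diracT.
rewrite sumEFin sumr_const card_ord -EFinM mulVf//.
by rewrite pnatr_eq0 -lt0n.
Qed.

Lemma Rintegral_empirical {d : measure_display} {T : measurableType d} (N : nat)
    (x : nat -> T) (h : T -> R) : measurable_fun setT h -> (forall t, 0 <= h t) ->
  \int[empirical (R := R) N x]_t h t = N%:R^-1 * \sum_(n < N) h (x n).
Proof.
move=> mh h0; rewrite /Rintegral /empirical.
have mh' : measurable_fun setT (fun t => (h t)%:E) by exact/measurable_EFinP.
rewrite ge0_integral_mscale//; last by move=> t _; rewrite lee_fin.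
rewrite ge0_integral_measure_sum//; last by move=> t _; rewrite lee_fin.
under eq_bigr do rewrite integral_dirac// diracT mul1e.
by rewrite sumEFin -EFinM.
Qed.

End distance.

Section bound.
Context {R : realType} {d p : nat} (psi : 'cV[R]_d -> 'cV[R]_d)
  (H : 'M[R]_(p, d)) (Sigma : 'M[R]_d) (Gamma : 'M[R]_p)
  (mu0 : probability 'cV[R]_d R)
  {dW : measure_display} {W : measurableType dW} (P : probability W R)
  (u xi : nat -> {RV P >-> 'cV[R]_d}) (y eta : nat -> {RV P >-> 'cV[R]_p}).
Variables N K : nat.
Hypothesis psi_meas : measurable_fun setT psi.
Hypothesis psi_bounded : exists M : R, forall x, `|psi x| <= M.
Hypothesis Sigma_spd : spd Sigma.
Hypothesis Gamma_spd : spd Gamma.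
Hypothesis model : is_model psi H Sigma Gamma mu0 u xi y eta.
Hypothesis K_gt0 : (0 < K)%N.
Hypothesis N_gt0 : (0 < N)%N.

Local Notation S := (innov_cov H Sigma Gamma).

(** The exact filter at time k with observations z, acting on functions. *)
Definition exact_filter (z : nat -> 'cV[R]_p) (k : nat) (h : 'cV[R]_d -> R) : R :=
  fine (unnorm_filter H Gamma u z k (EFin \o h)) /
  fine (unnorm_filter H Gamma u z k (cst 1%E)).

Let Zf z k h : unit_fun h ->
  unnorm_filter H Gamma u z k (EFin \o h) \is a fin_num.
Proof.
move=> [mh h01]; apply: unnorm_filter_fin => //; first exact/measurable_EFinP.
Qed.

Let Z_ge0 z k h : unit_fun h -> (0 <= unnorm_filter H Gamma u z k (EFin \o h))%E.
Proof.
by move=> [mh h01]; apply: unnorm_filter_ge0 => x; rewrite lee_fin; have /andP[] := h01 x.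
Qed.

Let Z_le z k h h' : unit_fun h -> unit_fun h' -> (forall x, h x <= h' x) ->
  (unnorm_filter H Gamma u z k (EFin \o h) <= unnorm_filter H Gamma u z k (EFin \o h'))%E.
Proof.
move=> [mh h01] [mh' h01'] hh'.
have ml h1 : measurable_fun setT h1 ->
    measurable_fun setT (fun w => ((likelihood H Gamma u z k w)%:E * (EFin \o h1) (u k w))%E).
  move=> mh1; apply: emeasurable_funM; apply/measurable_EFinP.
    exact: measurable_likelihood_rv.
  by apply: (measurableT_comp mh1); exact: measurable_funP.
apply: ge0_le_integral => //.
- move=> w _; rewrite mule_ge0// lee_fin ?likelihood_ge0//.
  by have /andP[] := h01 (u k w).
- exact: ml.
- exact: ml.
- by move=> w _; rewrite lee_wpmul2l// lee_fin ?likelihood_ge0.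
Qed.

Lemma exact_filter0 z h : unit_fun h -> exact_filter z 0%N h = \int[mu0]_x h x.
Proof.
move=> [mh h01]; rewrite /exact_filter /Rintegral.
have h0 x : 0 <= h x by have /andP[] := h01 x.
have l1 w : likelihood H Gamma u z 0%N w = 1 by rewrite /likelihood big_ord0.
have -> : unnorm_filter H Gamma u z 0%N (cst 1%E) = 1%E.
  rewrite /unnorm_filter; under eq_integral do rewrite l1 mul1e.
  by rewrite integral_cst// mul1e [LHS](probability_setT P).
rewrite divr1; congr fine; rewrite /unnorm_filter.
under [LHS]eq_integral do rewrite l1 mul1e.
rewrite -(ge0_integral_distribution (u 0%N) (f := EFin \o h)).
- apply: eq_measure_integral => A mA _; exact: (model_init model).
- exact/measurable_EFinP.
- by move=> x; rewrite lee_fin.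
Qed.

(** If a measure is Bayes' filter at the observations Y, then every run of the
    particle filter on Y is within the error bound of it. *)
Lemma gopf_bound_bayes (Y : 'M[R]_(p, K)) (mu : {measure set 'cV[R]_d -> \bar R}) :
  (forall A, measurable A -> mu A = (bayes_filter H Gamma u Y A)%:E) ->
  gopf_bound psi H Sigma Gamma mu0 N Y mu.
Proof.
move=> muE dW' W' P' v vt zeta run.
have [M psiM] := psi_bounded.
have S_spd := innov_cov_spd H Sigma_spd Gamma_spd.
have [gC [gCG gCE]] := exists_gaussian (gaussian_post_cov_total N_gt0 run K_gt0).
have [c c0 Zrec] := unnorm_filterS psi_meas model Sigma_spd Gamma_spd gCG.
pose z := col_seq Y.
pose g (k : 'I_K) x := gauss_exp S (col k Y - H *m psi x).
pose prop (k : 'I_K) := proposal psi H Sigma Gamma Y gC k.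
have gu (k : 'I_K) : unit_fun (g k) by exact: unit_fun_g.
pose gprop (k : 'I_K) h x := g k x * prop k h x.
have gpu (k : 'I_K) h : unit_fun h -> unit_fun (gprop k h).
  by move=> hu; exact: unit_fun_gprop.
have ZS (k : 'I_K) h : unit_fun h -> unnorm_filter H Gamma u z k.+1 (EFin \o h) =
    (c%:E * unnorm_filter H Gamma u z k (EFin \o gprop k h))%E.
  move=> [mh h01]; rewrite Zrec//; last first.
  - by move=> x; rewrite lee_fin; have /andP[] := h01 x.
  - exact/measurable_EFinP.
  congr (_ * unnorm_filter _ _ _ _ _ _)%E; apply/funext => x /=.
  by rewrite /gprop EFinM /z col_seqE; congr (_ * _)%E; rewrite /prop proposalE.
have ZS1 (k : 'I_K) : unnorm_filter H Gamma u z k.+1 (cst 1%E) =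
    (c%:E * unnorm_filter H Gamma u z k (EFin \o g k))%E.
  rewrite Zrec//; congr (_ * unnorm_filter _ _ _ _ _ _)%E; apply/funext => x /=.
  rewrite /z col_seqE integral_cst// mul1e.
  by rewrite [X in (_ * X)%E](probability_setT gC) mule1.
have Z1 k : 0 < fine (unnorm_filter H Gamma u z k (cst 1%E)) by exact: fine_unnorm_1_gt0.
have Zg0 (k : 'I_K) : 0 < fine (unnorm_filter H Gamma u z k (EFin \o g k)).
  have := Z1 k.+1; rewrite ZS1 fineM// ?Zf//=.
  by rewrite pmulr_rgt0.
have kap0 := kappa_gt0 psi H Sigma Gamma Y.
have main h : unit_fun h -> \int[P']_w ((emp_mean N v K h w - exact_filter z K h) ^+ 2)
    <= (error_bound N (kappa psi H Sigma Gamma Y) K / 2) ^+ 2.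
  move=> hu; apply: (filter_error psi_meas N_gt0 run S_spd gCE (pi := exact_filter z)) => //.
  - exact: kappa_le1.
  - move=> k x; exact: kappa_le_weight.
  - move=> h'; exact: exact_filter0.
  - move=> k h' h'u; rewrite /exact_filter ZS// ZS1.
    rewrite (fineM _ (Zf z k (gpu k h' h'u)))// fineM ?Zf//=.
    by field; rewrite !gt_eqF.
  - by move=> k; rewrite divr_gt0.
  - move=> k h' h'u; have gpu' := gpu k h' h'u; apply/andP; split.
      apply: divr_ge0; last exact/ltW.
      by apply: fine_ge0; exact: (Z_ge0 z k gpu').
    apply: ler_wpM2r; first by rewrite invr_ge0 ltW.
    apply: fine_le; [exact: (Zf z k gpu')|exact: (Zf z k (gu k))|apply: (Z_le z k gpu' (gu k)) => x].
    have [_ /(_ x)/andP[g0 _]] := gu k.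
    rewrite -[leRHS]mulr1 ler_wpM2l//.
    by have [mh' h'01] := h'u; have /andP[] : 0 <= prop k h' x <= 1 by exact: proposal01.
have [m [mE mI]] := bayes_filter_measure (P := P) H u Gamma_spd Y.
have mum (h : 'cV[R]_d -> R) : \int[mu]_x h x = \int[m]_x h x.
  by rewrite /Rintegral; congr fine; apply: eq_measure_integral => A mA _; rewrite muE// mE.
have muint h : unit_fun h -> \int[mu]_x h x = exact_filter z K h.
  move=> hu; have [mh h01] := hu; rewrite mum /Rintegral mI//; last first.
  - by move=> x; rewrite lee_fin; have /andP[] := h01 x.
  - exact/measurable_EFinP.
  rewrite -(fineK (Zf z K hu)) -EFinM /= mulrC.
  by [].
have mu1 : mu setT = 1%E.
  rewrite muE// /bayes_filter.
  have -> : (fun x => (\1_[set: 'cV[R]_d] x)%:E) = cst 1%E :> ('cV[R]_d -> \bar R).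
    by apply/funext => x; rewrite indicT.
  by rewrite divff// gt_eqF.
have -> : \sum_(k < K.+1) (2 * kappa psi H Sigma Gamma Y ^- 2) ^+ k / Num.sqrt N%:R
    = error_bound N (kappa psi H Sigma Gamma Y) K by [].
set eb := error_bound _ _ _.
have eb0 : 0 < eb by exact: error_bound_gt0.
apply: ge_ereal_sup => _ [f [mf f1] <-].
(* The affine rescaling of f to the unit interval halves the errors. *)
pose h x := (f x + 1) / 2.
have hu : unit_fun h.
  split; first by apply: measurable_funM => //; exact: measurable_funD.
  by move=> x; have := f1 x; rewrite ler_norml /h => /andP[fl fr]; lra.
have [mh h01] := hu.
have diffE w : (\int[empirical N (fun n => v K n w)]_x f x - \int[mu]_x f x) =
    2 * (emp_mean N v K h w - exact_filter z K h).
  rewrite (Rintegral_unit (empirical_setT (fun n => v K n w) N_gt0) mf f1).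
  rewrite (Rintegral_unit mu1 mf f1) -/(h _) muint//.
  rewrite Rintegral_empirical//; last by move=> x; have /andP[] := h01 x.
  by rewrite /emp_mean; ring.
pose D w := emp_mean N v K h w - exact_filter z K h.
have bD : bounded_rv (fun w => D w ^+ 2).
  have bD1 : bounded_rv D.
    by apply: bounded_rvB; [exact: bounded_emp_mean|exact: bounded_rv_cst].
  exact: bounded_rvM.
rewrite unlock.
rewrite (_ : (\int[P']_w _)%E = (4 * \int[P']_w (D w ^+ 2))%:E); last first.
  rewrite -ExZ// ExE; last exact: bounded_rvZ.
  by apply: eq_integral => w _; rewrite /= diffE exprMn; congr (_ * _)%:E; ring.
have -> : eb%:E = sqrte ((eb ^+ 2)%:E) by rewrite /= sqrtr_sqr gtr0_norm.
rewrite lee_sqrt lee_fin ?sqr_ge0//.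
have := main h hu; rewrite -/D -/eb => hD.
by rewrite -ler_pdivlMl//; apply: le_trans hD _; rewrite le_eqVlt; apply/orP; left;
  apply/eqP; field.
Qed.

End bound.

(** * The error bound for the filtering distribution *)

Unset Implicit Arguments.

Theorem theorem6p12 (R : realType) (d p : nat)
    (psi : 'cV[R]_d -> 'cV[R]_d) (H : 'M[R]_(p, d))
    (sigma gamma : R) (Sigma0 : 'M[R]_d) (Gamma0 : 'M[R]_p)
    (mu0 : probability 'cV[R]_d R)
    (psi_meas : measurable_fun setT psi)
    (psi_bounded : exists M : R, forall v, `|psi v| <= M)
    (sigma_gt0 : 0 < sigma) (gamma_gt0 : 0 < gamma)
    (Sigma0_spd : spd Sigma0) (Gamma0_spd : spd Gamma0)
    (dW : measure_display) (W : measurableType dW) (P : probability W R)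
    (u xi : nat -> {RV P >-> 'cV[R]_d}) (y eta : nat -> {RV P >-> 'cV[R]_p})
    (model : is_model psi H (sigma ^+ 2 *: Sigma0) (gamma ^+ 2 *: Gamma0) mu0
               u xi y eta)
    (K N : nat) (K_gt0 : (0 < K)%N) (N_gt0 : (0 < N)%N)
    (mu : R.-pker 'M[R]_(p, K) ~> 'cV[R]_d)
    (mu_filter : is_cond_law P (u K) (obs_matrix y K) mu) :
  {ae P, forall w,
     gopf_bound psi H (sigma ^+ 2 *: Sigma0) (gamma ^+ 2 *: Gamma0) mu0 N
       (obs_matrix y K w) (mu (obs_matrix y K w))} /\
  (continuous_version mu ->
   forall Y : 'M[R]_(p, K),
     gopf_bound psi H (sigma ^+ 2 *: Sigma0) (gamma ^+ 2 *: Gamma0) mu0 N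
       Y (mu Y)).
Proof.
have Sigma_spd := spdZ sigma_gt0 Sigma0_spd.
have Gamma_spd := spdZ gamma_gt0 Gamma0_spd.
split.
  have := cond_law_bayes_ae psi_meas model Gamma_spd mu_filter.
  apply: filterS => w muE.
  exact: (gopf_bound_bayes psi_meas psi_bounded Sigma_spd Gamma_spd model).
move=> mu_cont Y.
apply: (gopf_bound_bayes psi_meas psi_bounded Sigma_spd Gamma_spd model) => //.
exact: (cond_law_bayes_continuous psi_meas model Gamma_spd mu_filter mu_cont).
Qed.
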